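(* Let $\Theta\in(0,\pi/2)$ and let $A\in\mathbb{C}^{m\times m}$ be a unitary matrix with spectrum contained in $$\mathbb{S}_\Theta=\{z\in\mathbb{C} : |z|=1,\ \arg z\notin(\Theta,\pi-\Theta)\cup(-\pi+\Theta,-\Theta)\}.$$ For any $n\in\mathbb{N}$, the iteration $$X_{k+1}=r_{2n+1}(X_k;\Theta_k),\quad X_0=A,\qquad \Theta_{k+1}=|\arg r_{2n+1}(e^{i\Theta_k};\Theta_k)|,\quad \Theta_0=\Theta,$$ with $r_{2n+1}(\cdot\,;\Theta)$ the rational function defined in the context, converges to $\mathrm{sign}(A)$ with order of convergence $2n+1$. In fact, $$\|\log(X_k\,\mathrm{sign}(A)^{-1})\|\le 4\rho^{-(2n+1)^k}$$ for every $k\ge 0$, where $$\rho=\rho(\Theta)=\exp\left(\frac{\pi K(\cos\Theta)}{2K(\sin\Theta)}\right).$$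
   Context: $\|\cdot\|$ is the matrix 2-norm, $\log$ is the principal matrix logarithm, $\arg$ takes values in $(-\pi,\pi]$, and $\mathrm{sign}(A)=A(A^2)^{-1/2}$ with the principal square root (the matrix sign function, for $A$ with no purely imaginary eigenvalues). The order of convergence $2n+1$ is understood in the sense made precise by the displayed error bound, where $\rho>1$. $\mathrm{sn}(\cdot,\ell),\mathrm{cn}(\cdot,\ell),\mathrm{dn}(\cdot,\ell)$ denote Jacobi's elliptic functions with modulus $\ell$, and $K(\ell)=\int_0^{\pi/2}(1-\ell^2\sin^2\theta)^{-1/2}\,d\theta$ is the complete elliptic integral of the first kind. For $\Theta\in(0,\pi/2)$ put $\ell=\cos\Theta$, $\ell'=\sqrt{1-\ell^2}=\sin\Theta$, and for $n\in\mathbb{N}_0$ and $j=1,\dots,n$ put $v_j=\frac{2j-1}{2n+1}K(\ell')$ and $$a_j=a_j(\Theta)=\left(\frac{\ell\,\mathrm{sn}(v_j,\ell')+\mathrm{dn}(v_j,\ell')}{\mathrm{cn}(v_j,\ell')}\right)^{2(-1)^{j+n}} .$$ Define $$r_{2n+1}(z;\Theta)=z\prod_{j=1}^n\frac{z^2+a_j(\Theta)}{1+a_j(\Theta)z^2}.$$ For a square matrix $X$, $r_{2n+1}(X;\Theta)$ means $X\prod_{j=1}^n (X^2+a_j I)(I+a_jX^2)^{-1}$. *)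

(* Defs.v *)
From HB Require Import structures.
From mathcomp Require Import all_boot all_order all_algebra.
From mathcomp Require Import all_classical all_reals all_analysis.
From mathcomp Require Import complex.

Set Implicit Arguments.
Unset Strict Implicit.
Unset Printing Implicit Defensive.

Import Order.TTheory GRing.Theory Num.Theory.
Import numFieldNormedType.Exports.
Import ComplexField.Normc.

Local Open Scope classical_set_scope.
Local Open Scope ring_scope.
Local Open Scope complex_scope.

(* The argument in ]-pi, pi]; the value at 0 is irrelevant. *)
Definition argc (R : realType) (z : R[i]) : R :=
  let t := acos (complex.Re z / normc z) in if 0 <= complex.Im z then t else - t.

Definition arcs (R : realType) (Theta : R) : set R[i] :=
  [set z | [/\ `|z| = 1,
               ~ (Theta < argc z < pi - Theta) &
               ~ (- pi + Theta < argc z < - Theta)]].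

Definition vnorm2 (R : realType) (m : nat) (v : 'cV[R[i]]_m) : R :=
  Num.sqrt (\sum_i normc (v i 0) ^+ 2).

Definition mxnorm2 (R : realType) (m : nat) (A : 'M[R[i]]_m) : R :=
  sup [set vnorm2 (A *m v) | v in [set v : 'cV[R[i]]_m | vnorm2 v = 1]].

(* The exponential series, summed entrywise. *)
Definition expm (R : realType) (m : nat) (L : 'M[R[i]]_m) : 'M[R[i]]_m :=
  let S N : 'M[R[i]]_m := \sum_(0 <= k < N) (k`!%:R)^-1 *: L ^+ k in
  \matrix_(i, j) (limn (fun N => complex.Re (S N i j))
                  +i* limn (fun N => complex.Im (S N i j))).

(* The principal logarithm of a matrix B without eigenvalues on ]-oo, 0] is the
   unique logarithm of B whose eigenvalues lie in the strip |Im z| < pi; no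
   such logarithm exists for the other B, where logm B has the value 0. *)
Definition is_principal_log (R : realType) (m : nat) (B L : 'M[R[i]]_m) : Prop :=
  expm L = B /\ (forall z, eigenvalue L z -> - pi < complex.Im z < pi).

Definition logm (R : realType) (m : nat) (B : 'M[R[i]]_m) : 'M[R[i]]_m :=
  xget 0 [set L | is_principal_log B L].

(* The principal square root of a matrix B without eigenvalues on ]-oo, 0] is
   the unique square root of B whose eigenvalues have positive real part. *)
Definition is_principal_sqrt (R : realType) (m : nat) (B S : 'M[R[i]]_m) : Prop :=
  S *m S = B /\ (forall z, eigenvalue S z -> 0 < complex.Re z).

Definition sqrtm (R : realType) (m : nat) (B : 'M[R[i]]_m) : 'M[R[i]]_m :=
  xget 0 [set S | is_principal_sqrt B S].

Definition signm (R : realType) (m : nat) (A : 'M[R[i]]_m) : 'M[R[i]]_m :=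
  A *m invmx (sqrtm (A *m A)).

(* Elliptic integrals and functions take the modulus l, not the parameter l^2. *)
Definition elliptic_integrand (R : realType) (l t : R) : R :=
  (Num.sqrt (1 - l ^+ 2 * sin t ^+ 2))^-1.

Definition ellipticK (R : realType) (l : R) : R :=
  (\int[lebesgue_measure]_(t in `[0, pi / 2]) elliptic_integrand l t)%R.

(* The incomplete integral from 0 to phi, oriented when phi < 0. *)
Definition ellipticF (R : realType) (phi l : R) : R :=
  if 0 <= phi
  then (\int[lebesgue_measure]_(t in `[0, phi]) elliptic_integrand l t)%R
  else - (\int[lebesgue_measure]_(t in `[phi, 0]) elliptic_integrand l t)%R.

(* For 0 <= l < 1 the map phi |-> ellipticF phi l is a bijection of the real
   line; Jacobi's amplitude is its inverse. *)
Definition jacobi_am (R : realType) (u l : R) : R :=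
  xget 0 [set phi | ellipticF phi l = u].

Definition jacobi_sn (R : realType) (u l : R) : R := sin (jacobi_am u l).
Definition jacobi_cn (R : realType) (u l : R) : R := cos (jacobi_am u l).
Definition jacobi_dn (R : realType) (u l : R) : R :=
  Num.sqrt (1 - l ^+ 2 * jacobi_sn u l ^+ 2).

Definition zolo_v (R : realType) (n : nat) (Theta : R) (j : nat) : R :=
  (2 * j%:R - 1) / (2 * n + 1)%:R * ellipticK (sin Theta).

(* The outer exponent is an integer, hence the power ^ of ssrint. *)
Definition zolo_a (R : realType) (n : nat) (Theta : R) (j : nat) : R :=
  let l := cos Theta in
  let l' := sin Theta in
  let v := zolo_v n Theta j in
  ((l * jacobi_sn v l' + jacobi_dn v l') / jacobi_cn v l')
    ^ (2 * (-1) ^+ (j + n) : int).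

Definition zolo_r (R : realType) (n : nat) (z : R[i]) (Theta : R) : R[i] :=
  z * \prod_(1 <= j < n.+1)
        ((z ^+ 2 + (zolo_a n Theta j)%:C) / (1 + (zolo_a n Theta j)%:C * z ^+ 2)).

Definition zolo_den (R : realType) (n m : nat) (X : 'M[R[i]]_m) (Theta : R)
    (j : nat) : 'M[R[i]]_m :=
  1%:M + (zolo_a n Theta j)%:C *: (X *m X).

Definition zolo_rmx (R : realType) (n m : nat) (X : 'M[R[i]]_m) (Theta : R) :
    'M[R[i]]_m :=
  X *m \prod_(1 <= j < n.+1)
         ((X *m X + ((zolo_a n Theta j)%:C)%:M) *m invmx (zolo_den n X Theta j)).

Definition zolo_rho (R : realType) (Theta : R) : R :=
  expR (pi * ellipticK (cos Theta) / (2 * ellipticK (sin Theta))).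

(* Main.v *)
Require Import Defs.
From mathcomp Require Import all_boot all_order all_algebra.
From mathcomp Require Import all_classical all_reals all_analysis.
From mathcomp Require Import complex.
From mathcomp Require Import ring lra zify.
Import Order.TTheory GRing.Theory Num.Theory.
Import numFieldNormedType.Exports.
Local Open Scope classical_set_scope.
Local Open Scope ring_scope.
Local Open Scope complex_scope.
Set Implicit Arguments.
Unset Strict Implicit.
Unset Printing Implicit Defensive.

(** Write [N = 2 n + 1], [l = sin Theta], [K] for the complete integral of modulus
    [l], and let [rho] be [zolo_rho].  A unitary matrix is unitarily diagonalizable,
    so every [X k] is obtained from [A] by letting the scalar map act on the
    eigenvalues [+- e^(i phi)], and everything follows from two scalar facts: one
    step sends the arcs of half-width [Theta] into arcs of half-width [Theta'] with
    [rho Theta' = rho Theta ^ N] ([zolo_r_arc], [zolo_rho_next]), and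
    [Theta <= 4 / rho Theta] ([angle_le_rho]).

    For the first fact a point of the arc is written [e u = dn u + i l sn u].  By the
    addition theorems [e (u + w) * e (u - w)] is a factor
    [(z^2 + a) / (1 + a z^2)] at [z = e u], and the [a_j] are exactly those for
    which [r (e u)] is the product of [e (u + s w0)] over [s < N], where
    [w0 = 2 K / N + 2 K] ([zolo_r_prod]).  Shifting [u] by [w0] permutes the factors
    and shifting it by [2 K] conjugates them, so [r (e u)] is conjugated when [u]
    grows by [2 K / N]: the argument of [r] oscillates [N] times with the same
    amplitude [Theta'], and it is stationary at the [2 n] points
    [(2 i - N) K / N] inside each arc.  These give so many double roots of
    [sin^2 Theta' - sin^2 arg r] that its numerator is determined up to a constant,
    which is the identity

      [sin^2 Theta' - sin^2 arg r = kappa (sin^2 Theta - sin^2 phi) (d arg r / d phi)^2]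

    ([circ_identity], [zolo_identity]).  Read as a differential equation, it turns
    [sin (arg r) / sin Theta'] into the function [sn] of modulus [sin Theta'] along
    the arc, and [cos (arg r) / cos Theta'] into [sn] of modulus [cos Theta'] along
    the complementary arc.  Comparing quarter periods ([ellipticK_comparison]),
    [K (sin Theta') = C K (sin Theta) / N] and [K (cos Theta') = C K (cos Theta)]
    with the same [C] ([zolo_ellipticK]); the quotient is the claim on [rho].

    For the second fact, the Landen transformation [k1 = (1 - k') / (1 + k')] doubles
    [log rho] while [4 / k1 <= (4 / k)^2].  Hence an estimate [log rho <= log (4 / k) +
    constant] improves itself under iteration to [log rho <= log (4 / k)], and one
    further Landen step gives [rho <= 2 / tan (Theta / 2) <= 4 / Theta].

    The matrix square root and logarithm are picked by their defining properties,
    so the diagonal candidates have to be shown unique.  If [L] is any solution for a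
    diagonalizable right-hand side [B], a chain [v L = mu v + w], [w L = mu w] with
    [w <> 0] would give a chain for [B]; so [L] is diagonalizable, and its
    eigenvectors are eigenvectors of [B] with an eigenvalue that determines [mu]
    ([mx_eq_of_eigen]). *)

(** * Real derivatives and the elliptic integral *)

Section RealDerivatives.
Context {R : realType}.
Implicit Types (f g : R -> R) (x a b : R).

Lemma derive_cst c x : is_derive x 1 (fun _ : R => c : R) 0.
Proof. exact: is_derive_cst. Qed.

Lemma derive_id x : is_derive x 1 (fun t : R => t) 1.
Proof. exact: is_derive_id. Qed.

Lemma derive_add f g x a b : is_derive x 1 f a -> is_derive x 1 g b ->
  is_derive x 1 (fun t => f t + g t) (a + b).
Proof. by move=> fa gb; exact: (is_deriveD fa gb). Qed.

Lemma derive_opp f x a : is_derive x 1 f a -> is_derive x 1 (fun t => - f t) (- a).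
Proof. by move=> fa; exact: (is_deriveN fa). Qed.

Lemma derive_mul f g x a b : is_derive x 1 f a -> is_derive x 1 g b ->
  is_derive x 1 (fun t => f t * g t) (f x * b + g x * a).
Proof. by move=> fa gb; exact: (is_deriveM fa gb). Qed.

Lemma derive_exp f n x a : is_derive x 1 f a ->
  is_derive x 1 (fun t => f t ^+ n.+1) (n.+1%:R * f x ^+ n * a).
Proof.
move=> fa; have -> : (fun t => f t ^+ n.+1) = f ^+ n.+1 by rewrite exprfctE.
exact: (is_deriveX n.+1 fa).
Qed.

Lemma derive_inv f x a : f x != 0 -> is_derive x 1 f a ->
  is_derive x 1 (fun t => (f t)^-1) (- (f x ^- 2 * a)).
Proof.
by move=> f0 fa; apply: is_derive_eq (is_deriveV f0 fa) _; rewrite scaleNr.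
Qed.

Lemma derive_comp f g x a b : is_derive (g x) 1 f a -> is_derive x 1 g b ->
  is_derive x 1 (fun t => f (g t)) (a * b).
Proof. by move=> fa gb; exact: (is_derive1_comp fa gb). Qed.

Lemma derive_continuous f x a : is_derive x 1 f a -> {for x, continuous f}.
Proof.
by move=> [d _]; apply: differentiable_continuous; exact/derivable1_diffP.
Qed.

Lemma derive_zero_const f x y : (forall t : R, is_derive t 1 f 0) -> f x = f y.
Proof. exact: is_derive_0_is_cst. Qed.

Lemma derive_sqrt (x : R) : 0 < x -> is_derive x 1 (@Num.sqrt R) (2 * Num.sqrt x)^-1.
Proof. exact: is_derive1_sqrt. Qed.

Lemma derive_sin (x : R) : is_derive x 1 (fun t : R => sin t) (cos x).
Proof. exact: is_derive_sin. Qed.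

Lemma derive_cos (x : R) : is_derive x 1 (fun t : R => cos t) (- sin x).
Proof. exact: is_derive_cos. Qed.

End RealDerivatives.

(** Differentiates an explicit expression by structural rules, taking the
    derivatives of atoms from the context; side conditions are left as goals. *)
Ltac der := repeat match goal with
| |- is_derive _ _ (fun _ => ?c) _ => refine (derive_cst c _)
| |- is_derive _ _ (fun t => t) _ => refine (derive_id _)
| |- is_derive _ _ (fun t => @?f t + @?g t) _ =>
    notypeclasses refine (@derive_add _ f g _ _ _ _ _)
| |- is_derive _ _ (fun t => - @?f t) _ =>
    notypeclasses refine (@derive_opp _ f _ _ _)
| |- is_derive _ _ (fun t => @?f t * @?g t) _ =>
    notypeclasses refine (@derive_mul _ f g _ _ _ _ _)
| |- is_derive _ _ (fun t => @?f t ^+ _) _ =>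
    notypeclasses refine (@derive_exp _ f _ _ _ _)
| |- is_derive _ _ (fun t => (@?f t)^-1) _ =>
    notypeclasses refine (@derive_inv _ f _ _ _ _)
| |- is_derive _ _ (fun t => sin t) _ => refine (derive_sin _)
| |- is_derive _ _ (fun t => cos t) _ => refine (derive_cos _)
| |- is_derive _ _ sin _ => refine (derive_sin _)
| |- is_derive _ _ cos _ => refine (derive_cos _)
| H : _ |- is_derive _ _ _ _ => exact (H _)
| H : _ |- is_derive _ _ _ _ => exact H
| |- is_derive _ _ (fun t => ?h (@?f t)) _ =>
    notypeclasses refine (@derive_comp _ h f _ _ _ _ _)
end.

Section EllipticIntegral.
Context {R : realType} (l : R).
Hypothesis hl : 0 <= l < 1.
Notation mu := (@lebesgue_measure R).

Lemma modulus_sqr_lt1 : l ^+ 2 < 1. Proof. by case/andP: hl => l0 l1; rewrite expr_lt1. Qed.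

Lemma one_minus_modulus_gt0 s : s ^+ 2 <= 1 -> 0 < 1 - l ^+ 2 * s ^+ 2.
Proof.
move=> s1; rewrite subr_gt0 (le_lt_trans _ modulus_sqr_lt1)//.
by rewrite ler_piMr ?sqr_ge0.
Qed.

Lemma sin_sqr_le1 (t : R) : sin t ^+ 2 <= 1.
Proof. by have := cos2Dsin2 t; have := sqr_ge0 (cos t); lra. Qed.

Lemma elliptic_radicand_gt0 t : 0 < 1 - l ^+ 2 * sin t ^+ 2.
Proof. exact/one_minus_modulus_gt0/sin_sqr_le1. Qed.

Lemma elliptic_integrand_gt0 t : 0 < elliptic_integrand l t.
Proof. by rewrite invr_gt0 sqrtr_gt0 elliptic_radicand_gt0. Qed.

Lemma elliptic_integrand_ge1 t : 1 <= elliptic_integrand l t.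
Proof.
have r0 := elliptic_radicand_gt0 t.
rewrite /elliptic_integrand invf_ge1 ?sqrtr_gt0// -[leRHS]sqrtr1 ler_wsqrtr//.
by have := mulr_ge0 (sqr_ge0 l) (sqr_ge0 (sin t)); lra.
Qed.

Lemma continuous_elliptic_integrand : continuous (elliptic_integrand l).
Proof.
move=> t; eapply derive_continuous; rewrite /elliptic_integrand; der.
  by rewrite gt_eqF// sqrtr_gt0 elliptic_radicand_gt0.
exact/derive_sqrt/elliptic_radicand_gt0.
Qed.

Lemma integrable_elliptic_integrand (a b : R) :
  mu.-integrable `[a, b] (EFin \o elliptic_integrand l).
Proof.
apply: continuous_compact_integrable; first exact: segment_compact.
exact/continuous_subspaceT/continuous_elliptic_integrand.
Qed.

(** A fixed base point [a < 0] replaces the two cases of the definition by one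
    integral with a moving upper end, to which the fundamental theorem applies. *)
Lemma ellipticF_base (a y : R) : a < 0 -> a <= y -> ellipticF y l =
  (\int[mu]_(t in `[a, y]) elliptic_integrand l t)%R -
  (\int[mu]_(t in `[a, 0]) elliptic_integrand l t)%R.
Proof.
move=> a0 ay; rewrite /ellipticF.
have E (x z : R) : a <= x -> x <= z ->
  (\int[mu]_(t in `[a, z]) elliptic_integrand l t)%R -
  (\int[mu]_(t in `[a, x]) elliptic_integrand l t)%R =
  (\int[mu]_(t in `[x, z]) elliptic_integrand l t)%R.
  move=> ax xz; rewrite Rintegral_itvB ?bnd_simp//; last first.
    exact: integrable_elliptic_integrand.
  rewrite Rintegral_itv_obnd_cbnd//.
  apply: (@integrableS _ _ _ mu `[x, z]) => //.
    exact: subset_itv_oc_cc.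
  exact: integrable_elliptic_integrand.
case: ifPn => [y0|]; first by rewrite E// ltW.
by rewrite -ltNge => y0; rewrite -[RHS]opprB E// ltW.
Qed.

Lemma derive_ellipticF (y : R) :
  is_derive y 1 (fun x => ellipticF x l) (elliptic_integrand l y).
Proof.
pose a : R := - `|y| - 1.
have a0 : a < 0 by rewrite /a; have := normr_ge0 y; lra.
have ay : a < y by rewrite /a; have := ler_norm (- y); rewrite normrN; lra.
pose G x := (\int[mu]_(t in `[a, x]) elliptic_integrand l t)%R.
have y1 : y < y + 1 by rewrite ltrDl.
have [dG GE] := @continuous_FTC1_closed R (elliptic_integrand l) a y (y + 1)
  y1 (integrable_elliptic_integrand _ _) ay (@continuous_elliptic_integrand y).
have DG : is_derive y 1 G (elliptic_integrand l y).
  by apply: DeriveDef; [exact: dG|rewrite -derive1E; exact: GE].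
have := derive_add DG (derive_cst (- G 0) y); rewrite addr0.
apply: near_eq_is_derive.
near=> x; rewrite (@ellipticF_base a)//; near: x.
by exists (y - a) => /=; [rewrite subr_gt0|move=> z /=; rewrite ltr_norml; lra].
Unshelve. all: by end_near. Qed.

Lemma ellipticF0 : ellipticF 0 l = 0.
Proof. by rewrite (@ellipticF_base (-1)) ?subrr//; lra. Qed.

Lemma ellipticK_F : ellipticK l = ellipticF (pi / 2) l.
Proof. by rewrite /ellipticF ifT// divr_ge0// pi_ge0. Qed.

Lemma ellipticF_incr x y : x < y -> y - x <= ellipticF y l - ellipticF x l.
Proof.
move=> xy.
have [z _ ->] := @MVT R (fun x => ellipticF x l) (elliptic_integrand l) x y xy
  (fun z _ => derive_ellipticF z)
  (continuous_subspaceT (fun z => derive_continuous (derive_ellipticF z))).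
by have := elliptic_integrand_ge1 z; nra.
Qed.

Lemma ellipticF_lt x y : x < y -> ellipticF x l < ellipticF y l.
Proof. by move=> xy; have := ellipticF_incr xy; lra. Qed.

Lemma ellipticF_inj x y : ellipticF x l = ellipticF y l -> x = y.
Proof.
by move=> e; case: (ltgtP x y) => // /ellipticF_lt; rewrite e ltxx.
Qed.

Lemma ellipticF_odd x : ellipticF (- x) l = - ellipticF x l.
Proof.
pose F x := ellipticF x l.
have dF (t : R) : is_derive t 1 F (elliptic_integrand l t) := derive_ellipticF t.
have D (t : R) : is_derive t 1 (fun x => F (- x) + F x) 0.
  eapply is_derive_eq; first by der.
  by rewrite /elliptic_integrand sinN sqrrN mulrN1 addNr.
apply/eqP; rewrite -addr_eq0; apply/eqP.
by have := derive_zero_const x 0 D; rewrite /F oppr0 ellipticF0 addr0 => ->.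
Qed.

Lemma ellipticF_pi x : ellipticF (x + pi) l = ellipticF x l + 2 * ellipticK l.
Proof.
pose F x := ellipticF x l.
have dF (t : R) : is_derive t 1 F (elliptic_integrand l t) := derive_ellipticF t.
have D (t : R) : is_derive t 1 (fun x => F (x + pi) - F x) 0.
  eapply is_derive_eq; first by der.
  rewrite addr0 mulr1 /elliptic_integrand.
  have -> : sin (t + pi) = - sin t by exact: sinDpi.
  by rewrite sqrrN subrr.
have := derive_zero_const x (- (pi / 2)) D; rewrite /F.
have -> : - (pi / 2) + pi = pi / 2 :> R by field.
by rewrite ellipticF_odd -ellipticK_F => ?; lra.
Qed.

Lemma ellipticF_surj u : exists x, ellipticF x l = u.
Proof.
pose M := `|u| + 1.
have M0 : 0 < M by rewrite /M; have := normr_ge0 u; lra.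
have FM : M <= ellipticF M l.
  by have := ellipticF_incr M0; rewrite ellipticF0; lra.
have [|||x _ xE] := @IVT R (fun x => ellipticF x l) (- M) M u.
- lra.
- exact: (continuous_subspaceT (fun z => derive_continuous (derive_ellipticF z))).
- rewrite ellipticF_odd ge_min le_max.
  have : - M <= u <= M.
    by rewrite -ler_norml /M lerDl.
  by move=> ?; apply/andP; split; apply/orP; [left|right]; lra.
by exists x.
Qed.

Notation am u := (jacobi_am u l).

Lemma jacobi_amK u : ellipticF (am u) l = u.
Proof. by rewrite /jacobi_am; case: xgetP => // /(_ _)/= h; have [x] := ellipticF_surj u; move/h. Qed.

Lemma ellipticFK x : am (ellipticF x l) = x.
Proof. by apply: ellipticF_inj; rewrite jacobi_amK. Qed.

Lemma jacobi_am0 : am 0 = 0.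
Proof. by rewrite -[X in jacobi_am X]ellipticF0 ellipticFK. Qed.

Lemma jacobi_amN u : am (- u) = - am u.
Proof. by apply: ellipticF_inj; rewrite ellipticF_odd !jacobi_amK. Qed.

Lemma jacobi_am2K u : am (u + 2 * ellipticK l) = am u + pi.
Proof. by apply: ellipticF_inj; rewrite ellipticF_pi !jacobi_amK. Qed.

Lemma jacobi_am_quarter : am (ellipticK l) = pi / 2.
Proof. by rewrite ellipticK_F ellipticFK. Qed.

Lemma jacobi_am_lt u v : (am u < am v) = (u < v).
Proof.
apply/idP/idP => [/ellipticF_lt|uv]; first by rewrite !jacobi_amK.
rewrite ltNge; apply/negP; rewrite le_eqVlt => /orP[/eqP e|/ellipticF_lt].
  by move: uv; rewrite -(jacobi_amK u) -(jacobi_amK v) e ltxx.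
by rewrite !jacobi_amK ltNge ltW.
Qed.

Lemma derive_am (u : R) : is_derive u 1 (fun u => am u) (jacobi_dn u l).
Proof.
have := @is_derive_inverse R (fun x => ellipticF x l) (fun u => jacobi_am u l)
  (elliptic_integrand l (am u)) (am u).
rewrite jacobi_amK invrK; apply.
- by near=> x; rewrite ellipticFK.
- by near=> x; apply: derive_continuous; exact: derive_ellipticF.
- exact: derive_ellipticF.
- by rewrite gt_eqF// elliptic_integrand_gt0.
Unshelve. all: by end_near. Qed.

End EllipticIntegral.

(** * Jacobi functions and their addition theorems *)

Section JacobiFunctions.
Context {R : realType} (l : R).
Hypothesis hl : 0 <= l < 1.
Notation am u := (jacobi_am u l).
Notation sn := (fun u => jacobi_sn u l).
Notation cn := (fun u => jacobi_cn u l).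
Notation dn := (fun u => jacobi_dn u l).
Notation K := (ellipticK l).
Implicit Types u v w : R.

Lemma jacobi_cn2 u : cn u ^+ 2 = 1 - sn u ^+ 2.
Proof. exact: cos2sin2. Qed.

Lemma jacobi_sn2_le1 u : sn u ^+ 2 <= 1.
Proof. exact: sin_sqr_le1. Qed.

Lemma jacobi_dn2 u : dn u ^+ 2 = 1 - l ^+ 2 * sn u ^+ 2.
Proof. by rewrite sqr_sqrtr// ltW// one_minus_modulus_gt0// jacobi_sn2_le1. Qed.

Lemma jacobi_dn_gt0 u : 0 < dn u.
Proof. by rewrite sqrtr_gt0 one_minus_modulus_gt0// jacobi_sn2_le1. Qed.

Lemma derive_sn (u : R) : is_derive u 1 sn (cn u * dn u).
Proof.
rewrite /jacobi_sn; have da := derive_am hl.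
pose A := (fun u => am u); have dA (t : R) : is_derive t 1 A (dn t) := da t.
by have := derive_comp (derive_sin (A u)) (dA u).
Qed.

Lemma derive_cn (u : R) : is_derive u 1 cn (- sn u * dn u).
Proof.
rewrite /jacobi_cn; have da := derive_am hl.
pose A := (fun u => am u); have dA (t : R) : is_derive t 1 A (dn t) := da t.
by have := derive_comp (derive_cos (A u)) (dA u).
Qed.

Lemma derive_dn (u : R) : is_derive u 1 dn (- l ^+ 2 * sn u * cn u).
Proof.
rewrite {1}/jacobi_dn; pose S := sn.
have dS (t : R) : is_derive t 1 S (cn t * dn t) := derive_sn t.
have d0 : Num.sqrt (1 - l ^+ 2 * S u ^+ 2) != 0.
  by rewrite gt_eqF// sqrtr_gt0 one_minus_modulus_gt0// jacobi_sn2_le1.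
eapply is_derive_eq.
  der; apply: derive_sqrt; rewrite one_minus_modulus_gt0// jacobi_sn2_le1//.
rewrite /jacobi_dn -/(S u); field.
by rewrite d0.
Qed.

Lemma jacobi_sn0 : sn 0 = 0. Proof. by rewrite /jacobi_sn jacobi_am0// sin0. Qed.
Lemma jacobi_cn0 : cn 0 = 1. Proof. by rewrite /jacobi_cn jacobi_am0// cos0. Qed.
Lemma jacobi_dn0 : dn 0 = 1.
Proof. by rewrite /jacobi_dn jacobi_sn0 expr0n mulr0 subr0 sqrtr1. Qed.

Lemma jacobi_snN u : sn (- u) = - sn u.
Proof. by rewrite /jacobi_sn jacobi_amN// sinN. Qed.
Lemma jacobi_cnN u : cn (- u) = cn u.
Proof. by rewrite /jacobi_cn jacobi_amN// cosN. Qed.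
Lemma jacobi_dnN u : dn (- u) = dn u.
Proof. by rewrite /jacobi_dn jacobi_snN sqrrN. Qed.

Lemma jacobi_sn2K u : sn (u + 2 * K) = - sn u.
Proof. by rewrite /jacobi_sn jacobi_am2K//; exact: sinDpi. Qed.
Lemma jacobi_cn2K u : cn (u + 2 * K) = - cn u.
Proof. by rewrite /jacobi_cn jacobi_am2K//; exact: cosDpi. Qed.
Lemma jacobi_dn2K u : dn (u + 2 * K) = dn u.
Proof. by rewrite /jacobi_dn jacobi_sn2K sqrrN. Qed.

Lemma jacobi_snK : sn K = 1.
Proof. by rewrite /jacobi_sn jacobi_am_quarter// sin_pihalf. Qed.
Lemma jacobi_cnK : cn K = 0.
Proof. by rewrite /jacobi_cn jacobi_am_quarter// cos_pihalf. Qed.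
Lemma jacobi_dnK : dn K = Num.sqrt (1 - l ^+ 2).
Proof. by rewrite /jacobi_dn jacobi_snK expr1n mulr1. Qed.

Lemma ellipticK_gt0 : 0 < K.
Proof.
have := @jacobi_am_lt _ _ hl 0 K; rewrite jacobi_am0// jacobi_am_quarter// => <-.
by rewrite divr_gt0// pi_gt0.
Qed.

Lemma jacobi_am_bound u : - K < u < K -> - (pi / 2) < am u < pi / 2.
Proof. by rewrite -(jacobi_am_quarter hl) -(jacobi_amN hl) !jacobi_am_lt. Qed.

Lemma jacobi_cn_gt0 u : - K < u < K -> 0 < cn u.
Proof. by move/jacobi_am_bound => ?; exact: cos_gt0_pihalf. Qed.

Lemma jacobi_sn_lt u v : - K <= u -> u < v -> v <= K -> sn u < sn v.
Proof.
move=> Ku uv vK; have U w : (am u <= am w) = (u <= w) by rewrite !leNgt jacobi_am_lt.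
have le x y : x <= y -> am x <= am y by rewrite !leNgt jacobi_am_lt.
rewrite /jacobi_sn ltr_sin ?jacobi_am_lt// in_itv/= -(jacobi_am_quarter hl) -(jacobi_amN hl).
  by rewrite !le//; lra.
by rewrite !le//; lra.
Qed.

Definition jacobi_den u v := 1 - l ^+ 2 * sn u ^+ 2 * sn v ^+ 2.

Lemma jacobi_den_gt0 u v : 0 < jacobi_den u v.
Proof.
rewrite /jacobi_den -mulrA -exprMn one_minus_modulus_gt0// exprMn.
by rewrite mulr_ile1 ?sqr_ge0 ?jacobi_sn2_le1.
Qed.

(** Euler's device for the addition theorems: with [u + v] fixed to [a], a formula
    [N t / jacobi_den t (a - t)] has zero derivative, hence the same value for
    all [t], and at [t = 0] this value is the function to be computed. *)
Lemma quotient_const (N : R -> R) (a u v : R) :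
  (forall t : R, exists2 d, is_derive t 1 N d & d * jacobi_den t (a - t) =
     N t * (- l ^+ 2 * (2 * sn t * (cn t * dn t) * sn (a - t) ^+ 2
       - sn t ^+ 2 * (2 * sn (a - t) * (cn (a - t) * dn (a - t)))))) ->
  N u / jacobi_den u (a - u) = N v / jacobi_den v (a - v).
Proof.
move=> hN.
pose S := sn; have dS (t : R) : is_derive t 1 S (cn t * dn t) := derive_sn t.
have D0 t : 1 - l ^+ 2 * S t ^+ 2 * S (a - t) ^+ 2 != 0.
  by rewrite gt_eqF// jacobi_den_gt0.
apply: (@derive_zero_const _ (fun t => N t / (1 - l ^+ 2 * S t ^+ 2 * S (a - t) ^+ 2))).
move=> t; have [d dN] := hN t.
rewrite /jacobi_den -/(S t) -/(S (a - t)) => e.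
eapply is_derive_eq; first by der; exact: D0.
have d0 := D0 t.
apply: (mulIf (expf_neq0 2 d0)); rewrite mul0r.
transitivity (d * (1 - l ^+ 2 * S t ^+ 2 * S (a - t) ^+ 2) -
  N t * (- l ^+ 2 * (2 * S t * (cn t * dn t) * S (a - t) ^+ 2
       - S t ^+ 2 * (2 * S (a - t) * (cn (a - t) * dn (a - t)))))).
  by field; rewrite !exprMn.
by rewrite e subrr.
Qed.

Let S := sn.
Let C := cn.
Let D := dn.
Let dS (t : R) : is_derive t 1 S (cn t * dn t) := derive_sn t.
Let dC (t : R) : is_derive t 1 C (- sn t * dn t) := derive_cn t.
Let dD (t : R) : is_derive t 1 D (- l ^+ 2 * sn t * cn t) := derive_dn t.

Lemma jacobi_snD u v :
  sn (u + v) = (sn u * cn v * dn v + sn v * cn u * dn u) / jacobi_den u v.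
Proof.
pose N t := S t * C (u + v - t) * D (u + v - t) + S (u + v - t) * C t * D t.
have hN (t : R) : exists2 d, is_derive t 1 N d & d * jacobi_den t (u + v - t) =
     N t * (- l ^+ 2 * (2 * sn t * (cn t * dn t) * sn (u + v - t) ^+ 2
       - sn t ^+ 2 * (2 * sn (u + v - t) * (cn (u + v - t) * dn (u + v - t))))).
  eexists; first by rewrite /N; der.
  rewrite /N /S /C /D /jacobi_den /=; set w := _ - t.
  have := jacobi_cn2 t; have := jacobi_dn2 t.
  have := jacobi_cn2 w; have := jacobi_dn2 w.
  by rewrite /= => h1 h2 h3 h4; ring: h1 h2 h3 h4.
have := quotient_const u 0 hN.
rewrite /N /S /C /D /jacobi_den [u + v - u]addrAC subrr add0r subr0.
rewrite jacobi_sn0 jacobi_cn0 jacobi_dn0 expr0n/= !(mulr1, mul0r, mulr0, mul1r).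
by rewrite ?(add0r, subr0) divr1 => <-.
Qed.

Lemma jacobi_cnD u v :
  cn (u + v) = (cn u * cn v - sn u * sn v * dn u * dn v) / jacobi_den u v.
Proof.
pose N t := C t * C (u + v - t) - S t * S (u + v - t) * D t * D (u + v - t).
have hN (t : R) : exists2 d, is_derive t 1 N d & d * jacobi_den t (u + v - t) =
     N t * (- l ^+ 2 * (2 * sn t * (cn t * dn t) * sn (u + v - t) ^+ 2
       - sn t ^+ 2 * (2 * sn (u + v - t) * (cn (u + v - t) * dn (u + v - t))))).
  eexists; first by rewrite /N; der.
  rewrite /N /S /C /D /jacobi_den /=; set w := _ - t.
  have := jacobi_cn2 t; have := jacobi_dn2 t.
  have := jacobi_cn2 w; have := jacobi_dn2 w.
  by rewrite /= => h1 h2 h3 h4; ring: h1 h2 h3 h4.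
have := quotient_const u 0 hN.
rewrite /N /S /C /D /jacobi_den [u + v - u]addrAC subrr add0r subr0.
rewrite jacobi_sn0 jacobi_cn0 jacobi_dn0 expr0n/= !(mulr1, mul0r, mulr0, mul1r).
by rewrite ?(add0r, subr0) divr1 => <-.
Qed.

Lemma jacobi_dnD u v :
  dn (u + v) = (dn u * dn v - l ^+ 2 * sn u * sn v * cn u * cn v) / jacobi_den u v.
Proof.
pose N t := D t * D (u + v - t) - l ^+ 2 * S t * S (u + v - t) * C t * C (u + v - t).
have hN (t : R) : exists2 d, is_derive t 1 N d & d * jacobi_den t (u + v - t) =
     N t * (- l ^+ 2 * (2 * sn t * (cn t * dn t) * sn (u + v - t) ^+ 2
       - sn t ^+ 2 * (2 * sn (u + v - t) * (cn (u + v - t) * dn (u + v - t))))).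
  eexists; first by rewrite /N; der.
  rewrite /N /S /C /D /jacobi_den /=; set w := _ - t.
  have := jacobi_cn2 t; have := jacobi_dn2 t.
  have := jacobi_cn2 w; have := jacobi_dn2 w.
  by rewrite /= => h1 h2 h3 h4; ring: h1 h2 h3 h4.
have := quotient_const u 0 hN.
rewrite /N /S /C /D /jacobi_den [u + v - u]addrAC subrr add0r subr0.
rewrite jacobi_sn0 jacobi_cn0 jacobi_dn0 expr0n/= !(mulr1, mul0r, mulr0, mul1r).
by rewrite ?(add0r, subr0) divr1 => <-.
Qed.

End JacobiFunctions.

(** * Complete integrals from the differential equation of sn *)

(** The equation is the one satisfied by [sn (C t)], so [y] climbs from [0] to
    [+-1] in the time that [sn] needs for a quarter period.  In the coordinate
    [G = F (asin y)] it reads [G' = +-C]; by the mean value theorem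
    [|G t| = C (t - a)], without any discussion of the sign, and the end point, where
    [asin] is not differentiable, is reached by continuity of [y ^ 2]. *)
Lemma ellipticK_comparison {R : realType} (l : R) (y dy : R -> R) (a b C : R) :
  0 <= l < 1 -> a < b -> 0 < C ->
  {within `[a, b], continuous y} ->
  (forall t : R, a < t < b -> is_derive t 1 y (dy t)) ->
  (forall t, a < t < b ->
    dy t ^+ 2 = C ^+ 2 * ((1 - y t ^+ 2) * (1 - l ^+ 2 * y t ^+ 2))) ->
  (forall t, a < t < b -> y t ^+ 2 < 1) ->
  y a = 0 -> y b ^+ 2 = 1 ->
  ellipticK l = C * (b - a).
Proof.
move=> hl ab C0 cy Dy ODE y1 ya yb.
pose G t := ellipticF (asin (y t)) l.
have yb1 t : a < t < b -> -1 < y t < 1.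
  by move=> /y1 y1t; apply/andP; split; nra.
have DG t : a < t < b -> is_derive t 1 G
    (elliptic_integrand l (asin (y t)) * ((Num.sqrt (1 - y t ^+ 2))^-1 * dy t)).
  move=> tab; have Dyt := Dy t tab.
  apply: (@derive_comp _ (fun x => ellipticF x l) (fun t => asin (y t))).
    exact: derive_ellipticF.
  apply: (@derive_comp _ (@asin R) y) => //.
  by apply: is_derive1_asin; exact: yb1.
have G2 t : a < t < b -> (elliptic_integrand l (asin (y t)) *
    ((Num.sqrt (1 - y t ^+ 2))^-1 * dy t)) ^+ 2 = C ^+ 2.
  move=> tab; have r1 : 0 < 1 - y t ^+ 2 by rewrite subr_gt0; exact: y1.
  have r2 : 0 < 1 - l ^+ 2 * y t ^+ 2.
    by apply: one_minus_modulus_gt0 => //; exact/ltW/y1.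
  rewrite !exprMn ODE// /elliptic_integrand asinK; last first.
    by have := yb1 _ tab; rewrite in_itv/=; lra.
  rewrite !exprVn !sqr_sqrtr ?ltW//; move: r1 r2.
  move: (1 - y t ^+ 2) (1 - l ^+ 2 * y t ^+ 2) => p q p0 q0.
  by field; rewrite !gt_eqF.
have [cy' ya' yb'] := (continuous_within_itvP _ ab).1 cy.
have cG0 : G x @[x --> a^'+] --> G a.
  rewrite /G; apply: (@cvg_comp _ _ _ y (fun z => ellipticF (asin z) l)).
    exact: ya'.
  apply: (@continuous_comp _ _ _ (@asin R) (fun z => ellipticF z l)).
    by apply: continuous_asin; rewrite ya; lra.
  exact: derive_continuous (derive_ellipticF hl _).
have Ga : G a = 0 by rewrite /G ya -[X in asin X]sin0 sinK ?ellipticF0// in_itv/=; have := @pi_gt0 R; lra.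
have Gt t : a < t < b -> `|G t| = C * (t - a).
  move=> /andP[at1 tb].
  have [||c cat] := @MVT R G (fun t => elliptic_integrand l (asin (y t)) *
      ((Num.sqrt (1 - y t ^+ 2))^-1 * dy t)) a t at1.
  - by move=> x; rewrite in_itv/= => /andP[ax xt]; apply: DG; rewrite ax (lt_trans xt).
  - apply/(continuous_within_itvP _ at1); split; last 2 first.
    + exact: cG0.
    + apply: cvg_at_left_filter; apply: derive_continuous.
      by apply: DG; rewrite at1.
    + move=> x; rewrite in_itv/= => /andP[ax xt]; apply: derive_continuous.
      by apply: DG; rewrite ax (lt_trans xt).
  rewrite Ga subr0 => ->; rewrite normrM (gtr0_norm (_ : 0 < t - a)) ?subr_gt0//.
  congr (_ * _); apply/eqP; rewrite -(eqrXn2 (n := 2)) ?normr_ge0// ?ltW//.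
  rewrite real_normK ?num_real// G2//.
  by move: cat; rewrite in_itv/= => /andP[-> /lt_trans ->].
have am_t t : a < t < b -> C * (t - a) < ellipticK l /\ jacobi_sn (C * (t - a)) l ^+ 2 = y t ^+ 2.
  move=> tab; rewrite -Gt//; have yt := yb1 _ tab.
  have asyt : sin (asin (y t)) = y t by rewrite asinK// in_itv/=; lra.
  have [as1 as2] : - (pi / 2) < asin (y t) /\ asin (y t) < pi / 2.
    by split; [apply: asin_gtNpi2|apply: asin_ltpi2]; lra.
  have [g0|g0] := leP 0 (G t).
    rewrite ger0_norm// ellipticK_F; split; first exact: ellipticF_lt.
    by rewrite /jacobi_sn /G ellipticFK// asyt.
  rewrite ltr0_norm//; split.
    by rewrite ellipticK_F -ellipticF_odd//; apply: ellipticF_lt => //; lra.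
  by rewrite jacobi_snN// sqrrN /jacobi_sn /G ellipticFK// asyt.
(* Otherwise [sn (C (t - a))] would reach [1] at some [t < b]. *)
have le1 : C * (b - a) <= ellipticK l.
  rewrite leNgt; apply/negP => H.
  pose t := a + (ellipticK l / C).
  have K0 := ellipticK_gt0 hl.
  have tab : a < t < b.
    rewrite /t ltrDl divr_gt0//= addrC -ltrBrDr ltr_pdivrMr//; lra.
  have [+ _] := am_t _ tab; rewrite /t addrAC subrr add0r mulrC divfK ?gt_eqF// ltxx.
  by [].
apply/eqP; rewrite eq_le le1 andbT leNgt; apply/negP => H.
suff : jacobi_sn (C * (b - a)) l ^+ 2 = 1.
  have K0 := ellipticK_gt0 hl.
  have Cba : 0 < C * (b - a) by rewrite mulr_gt0// subr_gt0.
  have := @jacobi_sn_lt _ _ hl (C * (b - a)) (ellipticK l) _ H (lexx _).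
  have := @jacobi_sn_lt _ _ hl 0 (C * (b - a)) _ Cba le1.
  rewrite jacobi_snK// jacobi_sn0//.
  move: (jacobi_sn _ _) => s h1 h2; have := h1 _; have := h2 _.
  by nra.
rewrite -yb.
have c1 : (fun t => jacobi_sn (C * (t - a)) l ^+ 2) x @[x --> b^'-] --> jacobi_sn (C * (b - a)) l ^+ 2.
  apply: cvg_at_left_filter.
  pose S u := jacobi_sn u l.
  have dS (t : R) : is_derive t 1 S (jacobi_cn t l * jacobi_dn t l) := derive_sn hl t.
  have : exists d, is_derive b 1 (fun t => S (C * (t - a)) ^+ 2) d by eexists; der.
  by move=> [d]; exact: derive_continuous.
have c2 : (fun t => y t ^+ 2) x @[x --> b^'-] --> y b ^+ 2.
  by apply: (@cvg_comp _ _ _ y (fun z => z ^+ 2) _ _ _ yb'); exact: exprn_continuous.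
suff c3 : (fun t => jacobi_sn (C * (t - a)) l ^+ 2) x @[x --> b^'-] --> y b ^+ 2.
  exact: (cvg_unique _ c1 c3).
apply: cvg_trans c2; apply: near_eq_cvg; near=> t.
have tab : a < t < b.
  by apply/andP; split; near: t; [exact: nbhs_left_gt|exact: nbhs_left_lt].
by have [_] := am_t t tab.
Unshelve. all: by end_near. Qed.

(** * The Landen transformation and the size of rho *)

Section Landen.
Context {R : realType}.
Implicit Types k m : R.

(** Gauss' form of the Landen transformation:
    [y = (1 + k) s / (1 + k s^2)] with [s = sn] of modulus [k] satisfies the
    differential equation of [sn] of modulus [m]. *)
Lemma landen_ellipticK k m : 0 < k < 1 -> 0 <= m < 1 ->
  m ^+ 2 * (1 + k) ^+ 2 = 4 * k -> ellipticK m = (1 + k) * ellipticK k.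
Proof.
move=> hk hm mk; have hk' : 0 <= k < 1 by lra.
pose S u := jacobi_sn u k.
have dS (t : R) : is_derive t 1 S (jacobi_cn t k * jacobi_dn t k) := derive_sn hk' t.
have S1 t : S t ^+ 2 <= 1 := jacobi_sn2_le1 k t.
have D0 t : 0 < 1 + k * S t ^+ 2 by have := sqr_ge0 (S t); nra.
pose y t := (1 + k) * S t / (1 + k * S t ^+ 2).
pose dy t := (1 + k) * (1 - k * S t ^+ 2) / (1 + k * S t ^+ 2) ^+ 2 *
   (jacobi_cn t k * jacobi_dn t k).
have Dy (t : R) : is_derive t 1 y (dy t).
  have d0 := D0 t; rewrite /y; eapply is_derive_eq; first by der; rewrite gt_eqF.
  by rewrite /dy; field; rewrite gt_eqF.
have K0 := ellipticK_gt0 hk'.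
have Sb t : 0 < t < ellipticK k -> 0 < S t < 1.
  move=> /andP[t0 tK]; rewrite /S.
  have := @jacobi_sn_lt _ _ hk' 0 t; have := @jacobi_sn_lt _ _ hk' t (ellipticK k).
  by rewrite jacobi_sn0// jacobi_snK// => -> //; [move=> -> //|]; lra.
rewrite -[X in _ = _ * X]subr0.
apply: (@ellipticK_comparison R m y dy) => //.
- lra.
- exact: (continuous_subspaceT (fun z => derive_continuous (Dy z))).
- move=> t _; have := D0 t; rewrite /dy /y !exprMn.
  rewrite (jacobi_cn2 k t) (jacobi_dn2 hk' t) -/(S t).
  move: (S t) => s d0.
  have -> : 1 - m ^+ 2 * ((1 + k) ^+ 2 * s ^+ 2 * (1 + k * s ^+ 2)^-1 ^+ 2) =
     1 - 4 * k * (s ^+ 2 * (1 + k * s ^+ 2)^-1 ^+ 2) by rewrite -mk; ring.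
  by field; rewrite gt_eqF.
- move=> t /Sb; rewrite /y; move: (S t) => s s01.
  have d0 : 0 < 1 + k * s ^+ 2 by have := sqr_ge0 s; nra.
  have h1 : 0 < 1 - s by lra.
  have h2 : 0 < 1 - k * s by nra.
  have h3 := mulr_gt0 h1 h2; have h4 : 0 <= (1 + k) * s by apply: mulr_ge0; lra.
  by rewrite expr_div_n ltr_pdivrMr ?exprn_gt0// mul1r ltr_pXn2r// ?nnegrE; lra.
- by rewrite /y /S jacobi_sn0// mulr0 mul0r.
- by rewrite /y /S jacobi_snK// expr1n !mulr1 divff ?expr1n// gt_eqF//; lra.
Qed.

(** The exponent in [zolo_rho], as a function of two complementary moduli. *)
Definition log_rho k k' := pi * ellipticK k' / (2 * ellipticK k).

Lemma pythagorean_modulus k k' : 0 < k -> 0 < k' -> k ^+ 2 + k' ^+ 2 = 1 ->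
  0 < k < 1 /\ 0 < k' < 1.
Proof. by move=> *; split; apply/andP; split; nra. Qed.

(** [landen_ellipticK] is used twice, from [k1] up to [k] and from [k'] up to [k1'];
    the two factors [1 + k1] and [1 + k'] have product [2]. *)
Lemma landen_log_rho k k' : 0 < k -> 0 < k' -> k ^+ 2 + k' ^+ 2 = 1 ->
  exists k1 k1', [/\ 0 < k1, 0 < k1', k1 ^+ 2 + k1' ^+ 2 = 1,
    k1 = (1 - k') / (1 + k') & log_rho k1 k1' = 2 * log_rho k k'].
Proof.
move=> k0 k0' kk; have [k1 k1'] := pythagorean_modulus k0 k0' kk.
have d0 : 1 + k' != 0 by rewrite gt_eqF//; lra.
exists ((1 - k') / (1 + k')), (2 * Num.sqrt k' / (1 + k')).
have s2 : Num.sqrt k' ^+ 2 = k' by rewrite sqr_sqrtr// ltW.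
have a0 : 0 < (1 - k') / (1 + k') by rewrite divr_gt0; lra.
have b0 : 0 < 2 * Num.sqrt k' / (1 + k').
  by rewrite divr_gt0 ?mulr_gt0 ?sqrtr_gt0//; lra.
have ab : ((1 - k') / (1 + k')) ^+ 2 + (2 * Num.sqrt k' / (1 + k')) ^+ 2 = 1.
  by rewrite !expr_div_n exprMn s2; field.
split => //; rewrite /log_rho.
have [a1 b1] := pythagorean_modulus a0 b0 ab.
rewrite (@landen_ellipticK k' (2 * Num.sqrt k' / (1 + k')))//; last 2 first.
- lra.
- by rewrite expr_div_n exprMn s2; field.
have := @landen_ellipticK ((1 - k') / (1 + k')) k a1.
have -> : 1 + (1 - k') / (1 + k') = 2 / (1 + k') by field.
move=> -> //; last 2 first.
- lra.
- have -> : k ^+ 2 = 1 - k' ^+ 2 by rewrite -kk; ring.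
  by field.
have : ellipticK ((1 - k') / (1 + k')) != 0 by rewrite gt_eqF// ellipticK_gt0//; lra.
by move=> ?; field; rewrite d0.
Qed.

Lemma ellipticK_ge_pihalf k : 0 <= k < 1 -> pi / 2 <= ellipticK k.
Proof.
move=> hk; have := @ellipticF_incr _ _ hk 0 (pi / 2).
by rewrite ellipticF0// !subr0 -ellipticK_F; apply; rewrite divr_gt0// pi_gt0.
Qed.

(** Only the coefficient [1] of [- ln k] matters, because the additive constant is
    divided by [2] in every Landen step.  With [D = sqrt (1 - k'^2 sin^2)], the
    function [2 t - ln (cos t + D t)] grows at least as fast as the integral
    between [0] and [pi / 2]. *)
Lemma ellipticK_le_ln k k' : 0 < k -> 0 < k' -> k ^+ 2 + k' ^+ 2 = 1 ->
  ellipticK k' <= ln 4 - ln k + pi.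
Proof.
move=> k0 k0' kk; have [k1 k1'] := pythagorean_modulus k0 k0' kk.
have hk' : 0 <= k' < 1 by lra.
have kk' : k' ^+ 2 = 1 - k ^+ 2 by rewrite -kk; ring.
pose D (t : R) := Num.sqrt (1 - k' ^+ 2 * sin t ^+ 2).
have r0 := elliptic_radicand_gt0 hk'.
have D0 t : 0 < D t by rewrite sqrtr_gt0.
have D2 t : D t ^+ 2 = cos t ^+ 2 + k ^+ 2 * sin t ^+ 2.
  by rewrite sqr_sqrtr ?ltW// cos2sin2 kk'; ring.
pose F x := ellipticF x k'.
have dF (t : R) : is_derive t 1 F (D t)^-1 := derive_ellipticF hk' t.
have dD (t : R) : is_derive t 1 D (- k' ^+ 2 * sin t * cos t / D t).
  rewrite /D; eapply is_derive_eq; first by der; exact: derive_sqrt.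
  by rewrite /=; field; rewrite gt_eqF//; exact: D0.
have c0 (t : R) : 0 <= t <= pi / 2 -> 0 <= cos t.
  by move=> ?; apply: cos_ge0_pihalf; have := @pi_gt0 R; lra.
have s0 (t : R) : 0 <= t <= pi / 2 -> 0 <= sin t.
  by move=> ?; apply: sin_ge0_pi; have := @pi_gt0 R; lra.
pose H (t : R) := 2 * t - ln (cos t + D t) - F t.
pose dH t := 2 + (sin t + k' ^+ 2 * sin t * cos t / D t) / (cos t + D t) - (D t)^-1.
have cD0 (t : R) : 0 <= t <= pi / 2 -> 0 < cos t + D t.
  by move=> /c0 ct; have := D0 t; lra.
have DH (t : R) : 0 <= t <= pi / 2 -> is_derive t 1 H (dH t).
  move=> /cD0 cDt; rewrite /H; eapply is_derive_eq; first by der; exact: is_derive1_ln.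
  by have := D0 t => Dt; rewrite /dH; field; rewrite !gt_eqF.
have dH0 (t : R) : 0 <= t <= pi / 2 -> 0 <= dH t.
  move=> tt; have := c0 _ tt; have := s0 _ tt; have := D0 t; have := D2 t.
  have := cos2Dsin2 t; rewrite /dH.
  rewrite kk'; move: (cos t) (sin t) (D t) => c s d cs dd d0 ss cc.
  have -> : 2 + (s + (1 - k ^+ 2) * s * c / d) / (c + d) - d^-1 =
    (2 * d * (c + d) + s * d + (1 - k ^+ 2) * s * c - c - d) / (d * (c + d)).
    by field; rewrite !gt_eqF//; lra.
  have kd : k * s <= d.
    by rewrite -ler_sqr ?nnegrE ?(ltW d0) ?mulr_ge0//; [rewrite dd exprMn; have := sqr_ge0 c; lra|lra].
  rewrite divr_ge0//; last by rewrite mulr_ge0//; lra.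
  have sc : 1 <= s + c.
    by rewrite -ler_sqr ?nnegrE//; [have := mulr_ge0 ss cc; nra|lra].
  have h1 : (c + d) * 1 <= (c + d) * (s + c) by rewrite ler_wpM2l//; lra.
  have h2 : k ^+ 2 * s * c <= d * c.
    apply: ler_wpM2r => //; apply: le_trans kd.
    by rewrite expr2 -mulrA ler_piMl ?mulr_ge0//; lra.
  have h3 := mulr_ge0 (sqr_ge0 k) (sqr_ge0 s).
  by nra.
have pi20 : 0 < pi / 2 :> R by rewrite divr_gt0// pi_gt0.
have [||c cI HE] := @MVT R H dH 0 (pi / 2) pi20.
- by move=> x; rewrite in_itv/= => ?; apply: DH; lra.
- apply: derivable_within_continuous => x; rewrite in_itv/= => xI.
  by have [] := DH x xI.
have hc : 0 <= dH c by apply: dH0; move: cI; rewrite in_itv/=; lra.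
have : 0 <= H (pi / 2) - H 0 by rewrite HE mulr_ge0//; lra.
rewrite /H /F -ellipticK_F ellipticF0// cos0 cos_pihalf /D sin0 sin_pihalf.
have -> : 1 - k' ^+ 2 * 1 ^+ 2 = k ^+ 2 by rewrite kk'; ring.
rewrite sqrtr_sqr gtr0_norm// expr0n/= !mulr0 !subr0 sqrtr1 add0r.
have : ln (1 + 1) <= ln 4 :> R by rewrite ler_ln ?posrE//; lra.
lra.
Qed.

(** The error term is halved by a Landen step, while [ln 4 - ln k] at most
    doubles when [k] is replaced by [k1], since [k^2 <= 4 k1]. *)
Lemma log_rho_le_approx M k k' : 0 < k -> 0 < k' -> k ^+ 2 + k' ^+ 2 = 1 ->
  log_rho k k' <= ln 4 - ln k + pi / 2 ^+ M.
Proof.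
elim: M k k' => [|M IH] k k' k0 k0' kk.
  rewrite expr0 divr1; apply: le_trans (ellipticK_le_ln k0 k0' kk).
  have [k1 k1'] := pythagorean_modulus k0 k0' kk.
  have K1 : pi / 2 <= ellipticK k by apply: ellipticK_ge_pihalf; lra.
  have K0 : 0 < ellipticK k' by apply: ellipticK_gt0; lra.
  have := @pi_gt0 R => pi0.
  by rewrite /log_rho ler_pdivrMr; [nra|lra].
have [k1 [k1' [a0 b0 ab k1E e]]] := landen_log_rho k0 k0' kk.
have := IH _ _ a0 b0 ab; rewrite e.
have [hk hk'] := pythagorean_modulus k0 k0' kk.
have k1k : k ^+ 2 <= 4 * k1.
  have -> : k ^+ 2 = 1 - k' ^+ 2 by rewrite -kk; ring.
  rewrite k1E mulrA ler_pdivlMr; last lra.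
  nra.
have : ln (k ^+ 2) <= ln (4 * k1).
  by rewrite ler_ln// posrE; [rewrite exprn_gt0|rewrite mulr_gt0].
rewrite lnXn// lnM ?posrE//.
rewrite exprS invfM.
rewrite -mulr_natl; lra.
Qed.

Lemma log_rho_le k k' : 0 < k -> 0 < k' -> k ^+ 2 + k' ^+ 2 = 1 ->
  log_rho k k' <= ln 4 - ln k.
Proof.
move=> k0 k0' kk; rewrite leNgt; apply/negP => H.
pose d := log_rho k k' - (ln 4 - ln k).
have d0 : 0 < d by rewrite /d; lra.
have pi0 := @pi_gt0 R.
have [M hM] : exists M, pi / d < 2 ^+ M.
  exists (Num.truncn (pi / d)).+1.
  apply: (@lt_le_trans _ _ (Num.truncn (pi / d)).+1%:R).
    by apply: truncnS_gt.
  by rewrite -natrX ler_nat ltnW// ltn_expl.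
have := log_rho_le_approx M k0 k0' kk.
have : pi / 2 ^+ M < d.
  by rewrite ltr_pdivrMr ?exprn_gt0// mulrC -ltr_pdivrMr.
rewrite /d; lra.
Qed.

Lemma atan_le (x : R) : 0 <= x -> atan x <= x.
Proof.
rewrite le_eqVlt => /predU1P[<-|x0]; first by rewrite atan0.
have [|c _] := @MVT R (fun t => atan t) (fun t => (1 + t ^+ 2)^-1) 0 x x0
  (fun t _ => is_derive1_atan t).
  by apply: continuous_subspaceT => t; exact: continuous_atan.
rewrite atan0 !subr0 => ->.
apply: ler_piMl; first exact: ltW.
have := sqr_ge0 c => c0; rewrite invf_le1; lra.
Qed.

(** One more Landen step after [log_rho_le]: here [k1 = tan^2 (Theta / 2)]. *)
Lemma angle_le_rho (Theta : R) : 0 < Theta < pi / 2 ->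
  Theta <= 4 / zolo_rho Theta.
Proof.
move=> hT.
have k0 : 0 < sin Theta by apply: sin_gt0_pi; lra.
have k0' : 0 < cos Theta by apply: cos_gt0_pihalf; lra.
have kk : sin Theta ^+ 2 + cos Theta ^+ 2 = 1 by rewrite addrC cos2Dsin2.
have [k1 [k1' [a0 b0 ab k1E e]]] := landen_log_rho k0 k0' kk.
rewrite /zolo_rho -/(log_rho (sin Theta) (cos Theta)).
set L := log_rho _ _.
have L2 : 2 * L <= ln (4 / k1) by rewrite -e ln_div ?posrE//; exact: log_rho_le.
rewrite ler_pdivlMr ?expR_gt0//.
rewrite -ler_sqr ?nnegrE ?mulr_ge0 ?expR_ge0//; try lra.
rewrite exprMn -expRM_natl.
have : expR (2%:R * L) <= 4 / k1.
  by rewrite -[leRHS]lnK ?ler_expR// posrE divr_gt0.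
have T2 : Theta ^+ 2 <= 4 * k1.
  have c0 : 0 < cos (Theta / 2) by apply: cos_gt0_pihalf; lra.
  have s0 : 0 < sin (Theta / 2) by apply: sin_gt0_pi; lra.
  have TE : Theta = (Theta / 2) *+ 2 by rewrite -mulr_natr; field.
  have -> : k1 = tan (Theta / 2) ^+ 2.
    have cE : cos Theta = 2 * cos (Theta / 2) ^+ 2 - 1.
      by rewrite {1}TE cos_mulr2n mulr_natl.
    rewrite k1E cE /tan expr_div_n sin2cos2.
    have := exprn_gt0 2 c0; move: (cos (Theta / 2)) c0 => c c0 c2.
    by field; apply/andP; split; rewrite gt_eqF//; lra.
  have t0 : 0 <= tan (Theta / 2) by rewrite divr_ge0 ?ltW.
  have := atan_le t0; rewrite tanK; last by rewrite in_itv/=; lra.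
  by move=> ?; nra.
move=> E2.
have T20 := sqr_ge0 Theta.
apply: (@le_trans _ _ (4 * k1 * (4 / k1))).
  by apply: ler_pM => //; exact: expR_ge0.
by rewrite le_eqVlt; apply/orP; left; apply/eqP; field; rewrite gt_eqF.
Qed.

End Landen.

(** * A rational identity from its double roots *)

Section DoubleRoots.
Variable F : numFieldType.
Implicit Types (p q : {poly F}) (x y : F).

Lemma double_roots_dvdp (rs : seq F) q : uniq rs ->
  (forall x, x \in rs -> root q x) -> (forall x, x \in rs -> root q^`() x) ->
  (\prod_(x <- rs) ('X - x%:P)) ^+ 2 %| q.
Proof.
elim: rs q => [|x rs IH] q; first by rewrite big_nil expr1n dvd1p.
rewrite cons_uniq => /andP[xrs urs] hq hq'.
have /factor_theorem [q1 q1E] : root q x by apply: hq; rewrite mem_head.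
have /factor_theorem [q2 q2E] : root q1 x.
  have := hq' x (mem_head _ _); rewrite q1E derivM derivXsubC mulr1 /root.
  by rewrite hornerD hornerM hornerXsubC subrr mulr0 add0r.
have qE : q = ('X - x%:P) ^+ 2 * q2 by rewrite q1E q2E; ring.
rewrite big_cons exprMn qE dvdp_mul2l ?expf_neq0 ?polyXsubC_eq0//.
have nz y : y \in rs -> y - x != 0.
  by move=> yrs; rewrite subr_eq0; apply: contraNneq xrs => <-.
have r2 y : y \in rs -> q2.[y] = 0.
  move=> yrs; have := hq y; rewrite in_cons yrs orbT => /(_ isT).
  rewrite /root qE hornerM horner_exp hornerXsubC mulf_eq0 expf_eq0/=.
  by rewrite (negPf (nz _ yrs)) => /eqP.
apply: IH => // y yrs; first exact/rootP/r2.
have := hq' y; rewrite in_cons yrs orbT => /(_ isT).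
rewrite /root qE derivM hornerD !hornerM r2// mulr0 add0r.
by rewrite !hornerXsubC !mulf_eq0 !(negPf (nz _ yrs)).
Qed.

Lemma horner_deriv_prod (I : finType) (G : I -> {poly F}) x :
  (forall i, (G i).[x] != 0) ->
  (\prod_i G i)^`().[x] = (\prod_i G i).[x] * \sum_i (G i)^`().[x] / (G i).[x].
Proof.
move=> G0; elim/big_rec2: _ => [|i s p _ IH].
  by rewrite -polyC1 derivC horner0 mulr0.
rewrite derivM hornerD !hornerM IH; field.
exact: G0.
Qed.

End DoubleRoots.

Section CircleMap.
Context {F : numFieldType} (n : nat) (a : 'I_n -> F).
Implicit Types (z t : F).

(** The square of [z * prod_j (z^2 + a j) / (1 + a j z^2)], as a function of
    [t = z^2]; in this variable all the polynomials below have half the degree. *)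
Definition circ_sq t := t * \prod_j ((t + a j) / (1 + a j * t)) ^+ 2.
(** The logarithmic derivative [z r'(z) / r(z)] at [z^2 = t]; on the unit circle it
    is the derivative of the argument of [r] with respect to that of [z]. *)
Definition circ_speed t :=
  1 + 2 * \sum_j (t * (1 - a j ^+ 2) / ((t + a j) * (1 + a j * t))).
Definition circ_dom t :=
  t != 0 /\ forall j, (t + a j != 0) /\ (1 + a j * t != 0).
(** [sin^2 phi] as a function of [t = e^(2 i phi)]. *)
Definition sin_sq t : F := - (t - 1) ^+ 2 / (4 * t).

Let pnum : {poly F} := 'X * \prod_j ('X + (a j)%:P) ^+ 2.
Let pden : {poly F} := \prod_j (1 + a j *: 'X) ^+ 2.
(** The numerator of [circ_speed]. *)
Let pspeed : {poly F} := \prod_j (('X + (a j)%:P) * (1 + a j *: 'X)) +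
  2 *: \sum_j ((1 - a j ^+ 2) *: ('X * \prod_(i | i != j)
     (('X + (a i)%:P) * (1 + a i *: 'X)))).
(** The numerator of [mu - sin_sq (circ_sq t)]. *)
Let pdefect mu : {poly F} := (4 * mu) *: (pnum * pden) + (pnum - pden) ^+ 2.

Let size_lin1 j : (size ('X + (a j)%:P)%R <= 2)%N.
Proof. by rewrite size_XaddC. Qed.

Let size_lin2 j : (size (1 + a j *: 'X)%R <= 2)%N.
Proof.
rewrite (leq_trans (size_polyD _ _))// geq_max size_poly1/=.
by rewrite (leq_trans (size_scale_leq _ _))// size_polyX.
Qed.

Let size_sqr (p : {poly F}) : (size p <= 2)%N -> (size (p ^+ 2) <= 3)%N.
Proof. by move=> sp; rewrite expr2 (leq_trans (size_polyMleq _ _))//; lia. Qed.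

Let size_prod (P : pred 'I_n) (G : 'I_n -> {poly F}) :
  (forall j, (size (G j) <= 3)%N) -> (size (\prod_(j | P j) G j)%R <= (2 * #|P|).+1)%N.
Proof.
move=> sG; rewrite (leq_trans (size_poly_prod_leq _ _))// leq_subLR.
apply: (@leq_trans ((\sum_(j in P) 3).+1)); first by rewrite ltnS leq_sum.
have E c d e : c = d -> c = e -> (c * 3 < d + (2 * e).+1)%N by lia.
by rewrite sum_nat_const; apply: E.
Qed.

Let size_prodT (G : 'I_n -> {poly F}) :
  (forall j, (size (G j) <= 3)%N) -> (size (\prod_j G j)%R <= (2 * n).+1)%N.
Proof.
move=> sG; have nE : #|[pred j : 'I_n | true]| = n by rewrite -[RHS]card_ord; apply: eq_card.
by have := @size_prod predT G sG; rewrite nE.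
Qed.

Let size_pnum : (size pnum <= (2 * n).+2)%N.
Proof.
rewrite (leq_trans (size_polyMleq _ _))// size_polyX addSn -pred_Sn.
by rewrite add1n ltnS size_prodT// => j; exact/size_sqr/size_lin1.
Qed.

Let size_pden : (size pden <= (2 * n).+1)%N.
Proof.
by apply: size_prodT => j; exact/size_sqr/size_lin2.
Qed.

Let size_pspeed : (size pspeed <= (2 * n).+1)%N.
Proof.
have sG j : (size (('X + (a j)%:P)%R * (1 + a j *: 'X)%R)%R <= 3)%N.
  rewrite (leq_trans (size_polyMleq _ _))//.
  by have := size_lin1 j; have := size_lin2 j; lia.
rewrite (leq_trans (size_polyD _ _))// geq_max; apply/andP; split.
  exact: size_prodT.
rewrite (leq_trans (size_scale_leq _ _))// (leq_trans (size_sum _ _ _))//.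
apply/bigmax_leqP => j _; rewrite (leq_trans (size_scale_leq _ _))//.
rewrite (leq_trans (size_polyMleq _ _))// size_polyX addSn -pred_Sn.
have h : (size (\prod_(i | i != j) (('X + (a i)%:P) * (1 + a i *: 'X)))%R
    <= (2 * n.-1).+1)%N.
  by have := @size_prod (predC1 j) _ sG; rewrite cardC1 card_ord.
by have := ltn_ord j; lia.
Qed.

Let size_pdefect mu : (size (pdefect mu) <= (4 * n).+3)%N.
Proof.
have sn := size_pnum; have sd := size_pden.
rewrite (leq_trans (size_polyD _ _))// geq_max; apply/andP; split.
  by rewrite (leq_trans (size_scale_leq _ _))// (leq_trans (size_polyMleq _ _))//; lia.
have s : (size (pnum - pden)%R <= (2 * n).+2)%N.
  by rewrite (leq_trans (size_polyD _ _))// geq_max size_polyN sn (leq_trans sd).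
by rewrite expr2 (leq_trans (size_polyMleq _ _))//; lia.
Qed.

Section AtPoint.
Variable t : F.
Hypothesis ht : circ_dom t.

Let t0 : t != 0. Proof. by case: ht. Qed.
Let nz1 j : t + a j != 0. Proof. by case: ht => _ /(_ j)[]. Qed.
Let nz2 j : 1 + a j * t != 0. Proof. by case: ht => _ /(_ j)[]. Qed.

Let hornerL1 j : ('X + (a j)%:P).[t] = t + a j. Proof. by rewrite !hornerE. Qed.
Let hornerL2 j : (1 + a j *: 'X).[t] = 1 + a j * t. Proof. by rewrite !hornerE. Qed.

Let horner_pnum : pnum.[t] = t * \prod_j (t + a j) ^+ 2.
Proof.
rewrite hornerM hornerX horner_prod; congr (_ * _).
by apply: eq_bigr => j _; rewrite horner_exp hornerL1.
Qed.

Let horner_pden : pden.[t] = \prod_j (1 + a j * t) ^+ 2.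
Proof. by rewrite horner_prod; apply: eq_bigr => j _; rewrite horner_exp hornerL2. Qed.

Let pnum_neq0 : pnum.[t] != 0.
Proof. by rewrite horner_pnum mulf_neq0//; apply/prodf_neq0 => j _; rewrite expf_neq0. Qed.

Let pden_neq0 : pden.[t] != 0.
Proof. by rewrite horner_pden; apply/prodf_neq0 => j _; rewrite expf_neq0. Qed.

Let circ_sqE : circ_sq t = pnum.[t] / pden.[t].
Proof.
rewrite horner_pnum horner_pden /circ_sq -mulrA -prodf_div.
by congr (_ * _); apply: eq_bigr => j _; rewrite expr_div_n.
Qed.

Lemma horner_pspeed : pspeed.[t] =
  circ_speed t * \prod_j ((t + a j) * (1 + a j * t)).
Proof.
rewrite /circ_speed mulrDl mul1r hornerD horner_prod; congr (_ + _).
  by apply: eq_bigr => j _; rewrite hornerM hornerL1 hornerL2.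
rewrite hornerZ -mulrA; congr (_ * _).
rewrite horner_sum mulr_suml; apply: eq_bigr => j _.
rewrite hornerZ hornerM hornerX horner_prod [X in _ = _ * X](bigD1 j)//=.
under eq_bigr do rewrite hornerM hornerL1 hornerL2.
by field; rewrite nz1 nz2.
Qed.

Lemma defect_horner mu :
  (pdefect mu).[t] = 4 * (mu - sin_sq (circ_sq t)) * (pnum.[t] * pden.[t]).
Proof.
rewrite circ_sqE /sin_sq /pdefect hornerD hornerZ hornerM horner_exp hornerD hornerN.
by field; rewrite pnum_neq0 pden_neq0.
Qed.

Let deriv_sqr (p : {poly F}) : p.[t] != 0 ->
  (p ^+ 2)^`().[t] / (p ^+ 2).[t] = 2 * (p^`().[t] / p.[t]).
Proof.
by move=> p0; rewrite expr2 derivM hornerD !hornerM; field.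
Qed.

(** At a zero of the speed, numerator and denominator of [circ_sq] have the same
    logarithmic derivative [e], so the defect, a quadratic form in them, has
    logarithmic derivative [2 e]. *)
Lemma speed_zero_deriv mu :
  circ_speed t = 0 -> (pdefect mu).[t] = 0 -> (pdefect mu)^`().[t] = 0.
Proof.
move=> W0 Q0.
have dnum : pnum^`().[t] = pnum.[t] * (t^-1 + \sum_j 2 / (t + a j)).
  rewrite /pnum derivM derivX mul1r hornerD !hornerM hornerX.
  rewrite horner_deriv_prod; last by move=> j; rewrite horner_exp hornerL1 expf_neq0.
  have -> : \sum_j (('X + (a j)%:P) ^+ 2)^`().[t] / (('X + (a j)%:P) ^+ 2).[t] =
      \sum_j 2 / (t + a j).
    apply: eq_bigr => j _; rewrite deriv_sqr ?hornerL1//.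
    by rewrite derivD derivX derivC addr0 hornerC mul1r.
  by field.
have dden : pden^`().[t] = pden.[t] * \sum_j 2 * a j / (1 + a j * t).
  rewrite horner_deriv_prod; last by move=> j; rewrite horner_exp hornerL2 expf_neq0.
  congr (_ * _); apply: eq_bigr => j _; rewrite deriv_sqr ?hornerL2//.
  by rewrite derivD derivZ derivX -polyC1 derivC add0r hornerZ hornerC mulr1 mulrA.
have : \sum_j 2 * a j / (1 + a j * t) = t^-1 + \sum_j 2 / (t + a j).
  apply/eqP; rewrite eq_sym -subr_eq0 -addrA -sumrB; apply/eqP.
  apply: (mulfI t0); rewrite mulr0; transitivity (circ_speed t) => //.
  rewrite /circ_speed mulrDr divff//; congr (_ + _).
  rewrite !mulr_sumr; apply: eq_bigr => j _.
  by field; rewrite nz1 nz2.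
move=> dE; rewrite dE in dden.
set e := _ + _ in dnum dden.
transitivity (2 * e * (pdefect mu).[t]); last by rewrite Q0 mulr0.
rewrite /pdefect derivD derivZ derivM expr2 derivM !(hornerD, hornerZ, hornerM, hornerN, derivB).
by rewrite dnum dden /pnum !hornerM; ring.
Qed.


Lemma pnum_pden_prod :
  pnum.[t] * pden.[t] = t * (\prod_j ((t + a j) * (1 + a j * t))) ^+ 2.
Proof.
rewrite horner_pnum horner_pden -mulrA -big_split/= -prodrXl.
by congr (_ * _); apply: eq_bigr => j _; rewrite exprMn.
Qed.

Lemma pspeed_eq0 : (pspeed.[t] == 0) = (circ_speed t == 0).
Proof.
rewrite horner_pspeed mulf_eq0 orbC; case: eqP => // /eqP/prodf_eq0[j _].
by rewrite mulf_eq0 (negPf (nz1 j)) (negPf (nz2 j)).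
Qed.

Lemma prod_dom_neq0 : \prod_j ((t + a j) * (1 + a j * t)) != 0.
Proof. by apply/prodf_neq0 => j _; rewrite mulf_neq0. Qed.

End AtPoint.

(** Degree count.  The numerator of [mu - sin_sq (circ_sq t)] has degree at most
    [4 n + 2]; the [2 n] points of [zs] are double roots by [speed_zero_deriv] and
    [u], [v] are two more roots, so it is a constant times the corresponding product.
    The numerator of [circ_speed] has degree at most [2 n] and vanishes on [zs], so it
    is a constant times the product over [zs]. *)
Lemma circ_identity mu (u v : F) (zs : seq F) :
  uniq (u :: v :: zs) -> size zs = (2 * n)%N ->
  (forall t, t \in u :: v :: zs -> circ_dom t /\ sin_sq (circ_sq t) = mu) ->
  (forall t, t \in zs -> circ_speed t = 0) ->
  (forall j, a j != 0) ->
  (exists c, forall t, circ_dom t ->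
     mu - sin_sq (circ_sq t) = c * ((t - u) * (t - v) / t) * circ_speed t ^+ 2) /\
  (forall t, circ_dom t -> circ_speed t = 0 -> t \in zs).
Proof.
move=> uniq_all szs hall hspeed a0.
have [u_nin uniq_vzs] : u \notin v :: zs /\ uniq (v :: zs) by apply/andP.
have [v_nin uniq_zs] : v \notin zs /\ uniq zs by apply/andP.
have uv : u != v by move: u_nin; rewrite in_cons negb_or => /andP[].
have u_nin' : u \notin zs by move: u_nin; rewrite in_cons negb_or => /andP[].
have zs_dom t : t \in zs -> circ_dom t.
  by move=> tz; apply: (hall _ _).1; rewrite !in_cons tz !orbT.
have Q0 t : t \in u :: v :: zs -> (pdefect mu).[t] = 0.
  by move=> /hall[dt e]; rewrite defect_horner// e subrr mulr0 mul0r.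
pose P := \prod_(x <- zs) ('X - x%:P).
have sP : size P = (2 * n).+1 by rewrite size_prod_XsubC szs.
have mP : P \is monic by exact: monic_prod_XsubC.
have P0 t : t \notin zs -> P.[t] != 0.
  by move=> tz; have := root_prod_XsubC zs t; rewrite /root (negPf tz) => ->.
have [c c0 SE] : exists2 c, c != 0 & pspeed = c *: P.
  (* The value at [t = 0] is the product of the [a j]. *)
  have S0 : pspeed != 0.
    apply/eqP => S0; have : pspeed.[0] = \prod_j a j.
      rewrite hornerD horner_prod hornerZ horner_sum [X in _ * X]big1 => [|j _].
        rewrite mulr0 addr0; apply: eq_bigr => j _.
        by rewrite !hornerE ?(add0r, addr0, mulr0, mul0r, mulr1).
      by rewrite hornerZ hornerM hornerX mul0r mulr0.
    by rewrite S0 horner0 => /esym/eqP/prodf_eq0[j _]; exact/negP/a0.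
  have /dvdpP[q qE] : P %| pspeed.
    apply: uniq_roots_dvdp; last by rewrite uniq_rootsE.
    apply/allP => t tz; rewrite /root pspeed_eq0; last exact: zs_dom.
    by rewrite hspeed.
  have q0 : q != 0 by apply: contraNneq S0 => q0; rewrite qE q0 mul0r.
  have sq : (size q <= 1)%N.
    have := size_pspeed; rewrite qE size_Mmonic// sP.
    by set d := size q; clearbody d; clear; lia.
  exists q`_0; last by rewrite -mul_polyC -size1_polyC.
  by apply: contraNneq q0 => q00; rewrite (size1_polyC sq) q00.
split; last first.
  move=> t dt /eqP; rewrite -pspeed_eq0// SE hornerZ mulf_eq0 (negPf c0)/=.
  by apply: contraLR => /P0.
have [g QE] : exists g, pdefect mu = g *: (P ^+ 2 * (('X - u%:P) * ('X - v%:P))).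
  have /dvdpP[q qE] : P ^+ 2 %| pdefect mu.
    apply: double_roots_dvdp => // t tz; apply/rootP.
      by apply: Q0; rewrite !in_cons tz !orbT.
    apply: speed_zero_deriv; [exact: zs_dom|exact: hspeed|].
    by apply: Q0; rewrite !in_cons tz !orbT.
  have qr t : t \in u :: v :: zs -> t \notin zs -> root q t.
    move=> tin tn; have := Q0 _ tin; rewrite qE hornerM horner_exp => /eqP.
    by rewrite mulf_eq0 expf_eq0/= (negPf (P0 _ tn)) orbF.
  have /dvdpP[h hE] : \prod_(x <- [:: u; v]) ('X - x%:P) %| q.
    apply: uniq_roots_dvdp; last by rewrite uniq_rootsE /= in_cons in_nil orbF uv.
    by rewrite /= !qr// !in_cons eqxx ?orbT.
  rewrite !big_cons big_nil mulr1 in hE.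
  have {}qE : pdefect mu = h * (P ^+ 2 * (('X - u%:P) * ('X - v%:P))).
    by rewrite qE hE; ring.
  have [h0|h0] := eqVneq h 0.
    by exists 0; rewrite qE h0 mul0r scale0r.
  have mM : P ^+ 2 * (('X - u%:P) * ('X - v%:P)) \is monic.
    by rewrite !rpredM// ?rpredX// monicXsubC.
  have sM : size (P ^+ 2 * (('X - u%:P) * ('X - v%:P))) = (4 * n).+3.
    rewrite size_Mmonic ?monic_neq0 ?rpredM ?rpredX ?monicXsubC//.
    rewrite size_Mmonic ?polyXsubC_eq0 ?monicXsubC// !size_XsubC.
    by rewrite expr2 size_Mmonic ?monic_neq0// sP; clear; lia.
  have sh : (size h <= 1)%N.
    have := size_pdefect mu; rewrite qE size_Mmonic// sM.
    by set d := size h; clearbody d; clear; lia.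
  by exists h`_0; rewrite -mul_polyC -size1_polyC.
exists (g / (4 * c ^+ 2)) => t dt.
have := defect_horner dt mu; have := horner_pspeed dt.
have Pi0 := prod_dom_neq0 dt; have [t0 _] := dt.
rewrite pnum_pden_prod// QE SE !(hornerZ, hornerM, horner_exp) !hornerXsubC.
move: Pi0; set Pi := \prod_j _ => Pi0 E1 E2.
have {E1} PE : P.[t] = circ_speed t * Pi / c.
  by apply: (mulfI c0); rewrite E1; field.
apply: (@mulIf _ (4 * (t * Pi ^+ 2))).
  by rewrite !mulf_neq0 ?expf_neq0// pnatr_eq0.
transitivity (4 * (mu - sin_sq (circ_sq t)) * (t * Pi ^+ 2)); first ring.
by rewrite -E2 PE; field; rewrite c0 t0.
Qed.

End CircleMap.

(** * The rational map on the unit circle *)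

Section CirclePoints.
Context {R : realType}.
Implicit Types (x y a : R) (z : R[i]).

Definition blaschke a z : R[i] := (z ^+ 2 + a%:C) / (1 + a%:C * z ^+ 2).
(** The factor [(z^2 + a) / (1 + a z^2)] turns [e^(i phi)] into [e^(2 i psi)] with
    [tan psi = cayley a * tan phi]. *)
Definition cayley a : R := (1 - a) / (1 + a).

Lemma unit_normE z : (`|z| = 1) <-> (complex.Re z ^+ 2 + complex.Im z ^+ 2 = 1).
Proof.
case: z => x y; rewrite normc_def/=; split=> [[e]|->]; last by rewrite sqrtr1.
by rewrite -[LHS]sqr_sqrtr ?addr_ge0 ?sqr_ge0// e expr1n.
Qed.

Lemma complexE2 z : z ^+ 2 = (complex.Re z ^+ 2 - complex.Im z ^+ 2) +i*
   (2 * complex.Re z * complex.Im z).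
Proof. by case: z => x y /=; rewrite expr2; simpc; congr (_ +i* _); ring. Qed.

Lemma blaschke_dom a z : 0 < a -> a != 1 -> `|z| = 1 ->
  (z ^+ 2 + a%:C != 0) /\ (1 + a%:C * z ^+ 2 != 0).
Proof.
move=> a0 a1 z1.
have na : `|a%:C| = a%:C by rewrite normc_def/= expr0n/= addr0 sqrtr_sqr gtr0_norm.
have z2 : `|z ^+ 2| = 1 by rewrite normrX z1 expr1n.
split; rewrite addrC addr_eq0; apply/negP => /eqP /(congr1 Num.norm).
  rewrite normrN z2 na => -[ae]; by rewrite ae eqxx in a1.
rewrite normrN normrM z2 na mulr1 normr1 => -[ae]; by rewrite ae eqxx in a1.
Qed.

Lemma cayley_neq0 a : 0 < a -> a != 1 -> cayley a != 0.
Proof.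
move=> a0 a1; rewrite mulf_neq0//; first by rewrite subr_eq0 eq_sym.
by rewrite invr_eq0 gt_eqF//; lra.
Qed.

Lemma cayley_den_gt0 c x y : c != 0 -> x ^+ 2 + y ^+ 2 = 1 ->
  0 < x ^+ 2 + c ^+ 2 * y ^+ 2.
Proof.
move=> c0 xy; have := sqr_ge0 x; rewrite le_eqVlt => /predU1P[x0|x0].
  have -> : y ^+ 2 = 1 by rewrite -xy -x0 add0r.
  by rewrite -x0 add0r mulr1 exprn_even_gt0.
by rewrite ltr_wpDr// mulr_ge0 ?sqr_ge0.
Qed.

Definition blaschke_re c x y := (x ^+ 2 - c ^+ 2 * y ^+ 2) / (x ^+ 2 + c ^+ 2 * y ^+ 2).
Definition blaschke_im c x y := 2 * c * x * y / (x ^+ 2 + c ^+ 2 * y ^+ 2).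

Lemma cayley_denE a x y : 0 < a -> x ^+ 2 + cayley a ^+ 2 * y ^+ 2 =
  ((1 + a) ^+ 2 * x ^+ 2 + (1 - a) ^+ 2 * y ^+ 2) / (1 + a) ^+ 2.
Proof. by move=> a0; rewrite /cayley; field; rewrite gt_eqF//; lra. Qed.

Lemma blaschkeE a x y : 0 < a -> a != 1 -> x ^+ 2 + y ^+ 2 = 1 ->
  blaschke a (x +i* y) =
  blaschke_re (cayley a) x y +i* blaschke_im (cayley a) x y.
Proof.
move=> a0 a1 xy.
have [h1 h2] := @blaschke_dom a (x +i* y) a0 a1 ((unit_normE (x +i* y)).2 xy).
apply: (mulIf h2); rewrite divfK// complexE2/=; simpc.
have D0 := cayley_den_gt0 (cayley_neq0 a0 a1) xy.
have A0 : 1 + a != 0 by rewrite gt_eqF//; lra.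
have E0 : (1 + a) ^+ 2 * x ^+ 2 + (1 - a) ^+ 2 * y ^+ 2 != 0.
  by apply: contraTneq D0 => E; rewrite cayley_denE// E mul0r ltxx.
have y2 : y ^+ 2 = 1 - x ^+ 2 by rewrite -xy; ring.
rewrite /blaschke_re /blaschke_im cayley_denE// /cayley.
set E := _ + _ in E0 *.
have EE : E = (1 + a) ^+ 2 * x ^+ 2 + (1 - a) ^+ 2 * y ^+ 2 by [].
congr (_ +i* _).
  apply: (mulIf E0); transitivity (
     ((1 + a) ^+ 2 * x ^+ 2 - (1 - a) ^+ 2 * y ^+ 2) * (1 + a * (x ^+ 2 - y ^+ 2))
     - 2 * (1 - a) * (1 + a) * x * y * (a * (2 * x * y))).
    rewrite EE; ring: y2.
  by field; rewrite A0 E0.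
apply: (mulIf E0); transitivity (
     ((1 + a) ^+ 2 * x ^+ 2 - (1 - a) ^+ 2 * y ^+ 2) * (a * (2 * x * y))
     + 2 * (1 - a) * (1 + a) * x * y * (1 + a * (x ^+ 2 - y ^+ 2))).
  rewrite EE; ring: y2.
by field; rewrite A0 E0.
Qed.

(** The contribution of one factor to [circ_speed] is real on the unit circle. *)
Lemma blaschke_speedE a x y : 0 < a -> a != 1 -> x ^+ 2 + y ^+ 2 = 1 ->
  (x +i* y) ^+ 2 * (1 - a%:C ^+ 2) /
    (((x +i* y) ^+ 2 + a%:C) * (1 + a%:C * (x +i* y) ^+ 2)) =
  (cayley a / (x ^+ 2 + cayley a ^+ 2 * y ^+ 2))%:C.
Proof.
move=> a0 a1 xy.
have [h1 h2] := @blaschke_dom a (x +i* y) a0 a1 ((unit_normE (x +i* y)).2 xy).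
apply: (mulIf (mulf_neq0 h1 h2)); rewrite divfK ?mulf_neq0//.
have D0 := cayley_den_gt0 (cayley_neq0 a0 a1) xy.
have A0 : 1 + a != 0 by rewrite gt_eqF//; lra.
have E0 : (1 + a) ^+ 2 * x ^+ 2 + (1 - a) ^+ 2 * y ^+ 2 != 0.
  by apply: contraTneq D0 => E; rewrite cayley_denE// E mul0r ltxx.
have y2 : y ^+ 2 = 1 - x ^+ 2 by rewrite -xy; ring.
rewrite cayley_denE// /cayley complexE2 /= expr2; simpc.
set E := _ + _ in E0 *.
have EE : E = (1 + a) ^+ 2 * x ^+ 2 + (1 - a) ^+ 2 * y ^+ 2 by [].
have -> : (1 - a) / (1 + a) / (E / (1 + a) ^+ 2) = (1 - a) * (1 + a) / E.
  by field; rewrite A0 E0.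
congr (_ +i* _).
  apply: (mulIf E0); rewrite [RHS]mulrAC divfK// EE; ring: y2.
by apply: (mulIf E0); rewrite [RHS]mulrAC divfK// EE; ring: y2.
Qed.

End CirclePoints.

Section BigSymmetric.
Context {T : Type} {idx : T} (op : Monoid.com_law idx).

Lemma big_cyclic_shift (f : nat -> T) N : f N = f 0%N ->
  \big[op/idx]_(0 <= i < N) f i.+1 = \big[op/idx]_(0 <= i < N) f i.
Proof.
case: N => [|N] fN; first by rewrite !big_nil.
by rewrite big_nat_recr// big_nat_recl//= fN Monoid.mulmC.
Qed.

(** Over a complete residue system modulo [2 n + 1] the terms [i] and
    [2 n + 1 - i], that is [i] and [- i], are paired. *)
Lemma big_cyclic_fold (f g : nat -> T) n :
  (forall i, (1 <= i <= n)%N -> f (2 * n + 1 - i)%N = g i) ->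
  \big[op/idx]_(0 <= i < 2 * n + 1) f i =
  op (f 0%N) (\big[op/idx]_(1 <= i < n.+1) op (f i) (g i)).
Proof.
move=> fg; rewrite big_ltn ?addn1//; congr (op _ _).
rewrite (@big_cat_nat _ _ _ n.+1)//=; last by lia.
rewrite big_split/=; congr (op _ _).
rewrite big_nat_rev/= -[X in \big[_/_]_(X <= _ < _) _](add1n n) big_addn.
rewrite (_ : (2 * n).+1 - n = n.+1)%N; last lia.
by apply: eq_big_nat => i hi; rewrite -fg; [congr f|]; lia.
Qed.

End BigSymmetric.

Section JacobiCircle.
Context {R : realType} (l : R).
Hypothesis hl : 0 <= l < 1.
Implicit Types (u v w a : R).
Notation sn := (fun u => jacobi_sn u l).
Notation cn := (fun u => jacobi_cn u l).
Notation dn := (fun u => jacobi_dn u l).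
Notation K := (ellipticK l).

(** The point of the unit circle with sine [l * sn u] and cosine [dn u]: as [u] runs
    over [[-K, K]], it runs over the arc of half-width [asin l]. *)
Definition jacobi_pt u : R[i] := jacobi_dn u l +i* (l * jacobi_sn u l).
Notation e := jacobi_pt.

Lemma jacobi_pt_sqr u : dn u ^+ 2 + (l * sn u) ^+ 2 = 1.
Proof. by rewrite jacobi_dn2//; ring. Qed.

Lemma jacobi_pt_norm u : `|e u| = 1.
Proof. exact/unit_normE/jacobi_pt_sqr. Qed.

Lemma jacobi_pt_neq0 u : e u != 0.
Proof. by rewrite -normr_eq0 jacobi_pt_norm oner_eq0. Qed.

Lemma jacobi_ptN u : e (- u) = (e u)^-1.
Proof.
apply: (mulIf (jacobi_pt_neq0 u)); rewrite mulVf ?jacobi_pt_neq0//.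
rewrite /jacobi_pt jacobi_dnN// jacobi_snN//; simpc.
congr (_ +i* _); last by ring.
by rewrite -[RHS](jacobi_pt_sqr u) /=; ring.
Qed.

Lemma jacobi_pt2K u : e (u + 2 * K) = (e u)^-1.
Proof. by rewrite -jacobi_ptN /jacobi_pt jacobi_dn2K// jacobi_sn2K// jacobi_dnN// jacobi_snN. Qed.

Lemma jacobi_pt4K u m : e (u + 4 * K * m%:R) = e u.
Proof.
elim: m => [|m IH]; first by rewrite mulr0 addr0.
rewrite -IH -(natr1 m) mulrDr mulr1 addrA.
have -> : u + 4 * K * m%:R + 4 * K = u + 4 * K * m%:R + 2 * K + 2 * K by ring.
by rewrite !jacobi_pt2K invrK.
Qed.

Lemma jacobi_cn4K u m : cn (u + 4 * K * m%:R) = cn u.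
Proof.
elim: m => [|m IH]; first by rewrite mulr0 addr0.
rewrite -IH -(natr1 m) mulrDr mulr1 addrA.
have -> : u + 4 * K * m%:R + 4 * K = u + 4 * K * m%:R + 2 * K + 2 * K by ring.
by rewrite !jacobi_cn2K// opprK.
Qed.

Lemma jacobi_den_circ u w : jacobi_den l u w = dn u ^+ 2 + cn w ^+ 2 * (l * sn u) ^+ 2.
Proof. by rewrite /jacobi_den jacobi_dn2// jacobi_cn2; ring. Qed.

(** Both sides equal [(dn u + i c l sn u)^2 / (dn^2 u + c^2 l^2 sn^2 u)] with
    [c = cn w], the left one by the addition theorems. *)
Lemma jacobi_pt_pair u w a : 0 < a -> a != 1 -> cn w = cayley a ->
  e (u + w) * e (u - w) = blaschke a (e u).
Proof.
move=> a0 a1 cw; rewrite blaschkeE ?jacobi_pt_sqr// -cw /blaschke_re /blaschke_im.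
rewrite -jacobi_den_circ /jacobi_pt.
rewrite !(jacobi_dnD hl, jacobi_snD hl) (jacobi_snN hl) (jacobi_cnN hl) (jacobi_dnN hl).
have denN : jacobi_den l u (- w) = jacobi_den l u w by rewrite /jacobi_den jacobi_snN// sqrrN.
rewrite denN; simpc.
have D0 := jacobi_den_gt0 hl u w.
have := jacobi_cn2 l u; have := jacobi_dn2 hl u.
have := jacobi_cn2 l w; have := jacobi_dn2 hl w.
have : jacobi_den l u w = 1 - l ^+ 2 * jacobi_sn u l ^+ 2 * jacobi_sn w l ^+ 2 by [].
move: (jacobi_den l u w) D0 => D D0.
move: (jacobi_sn u l) (jacobi_cn u l) (jacobi_dn u l) => s c d.
move: (jacobi_sn w l) (jacobi_cn w l) (jacobi_dn w l) => s' c' d' DE h1 h2 h3 h4.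
have DD : D ^+ 2 != 0 by rewrite expf_neq0// gt_eqF.
have DD1 : D != 0 by rewrite gt_eqF.
congr (_ +i* _); apply: (mulIf DD).
  transitivity ((d ^+ 2 - c' ^+ 2 * (l * s) ^+ 2) * D); last by field.
  transitivity ((d * d' - l ^+ 2 * s * s' * c * c') * (d * d' + l ^+ 2 * s * s' * c * c')
    - l ^+ 2 * ((s * c' * d' + s' * c * d) * (s * c' * d' - s' * c * d))).
    by field.
  by rewrite DE; ring: h1 h2 h3 h4.
transitivity (2 * c' * d * (l * s) * D); last by field.
transitivity ((d * d' - l ^+ 2 * s * s' * c * c') * (l * (s * c' * d' - s' * c * d)) +
    (l * (s * c' * d' + s' * c * d)) * (d * d' + l ^+ 2 * s * s' * c * c')).
  by field.
by rewrite DE; ring: h1 h2 h3 h4.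
Qed.

Lemma jacobi_cn_pair u w :
  cn (u + w) + cn (u - w) =
  cn u * (2 * (cn w / (dn u ^+ 2 + cn w ^+ 2 * (l * sn u) ^+ 2))).
Proof.
rewrite -jacobi_den_circ !(jacobi_cnD hl) (jacobi_snN hl) (jacobi_cnN hl) (jacobi_dnN hl).
have denN : jacobi_den l u (- w) = jacobi_den l u w by rewrite /jacobi_den jacobi_snN// sqrrN.
by rewrite denN; field; rewrite gt_eqF// jacobi_den_gt0.
Qed.

(** Since the real part of [e u] is positive, squaring loses nothing. *)
Lemma jacobi_pt_sqr_inj u v : 0 < l -> - K <= u <= K -> - K <= v <= K ->
  e u ^+ 2 = e v ^+ 2 -> u = v.
Proof.
move=> l0 hu hv /eqP; rewrite eqf_sqr => /orP[|] /eqP [].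
  move=> _ /(mulfI (lt0r_neq0 l0)) s_eq.
  case: (ltgtP u v) => // [uv|vu].
    by have := @jacobi_sn_lt _ _ hl u v; rewrite s_eq ltxx => h; have := h _ uv; lra.
  by have := @jacobi_sn_lt _ _ hl v u; rewrite s_eq ltxx => h; have := h _ vu; lra.
by move=> d_eq _; have := jacobi_dn_gt0 hl u; have := jacobi_dn_gt0 hl v; lra.
Qed.

End JacobiCircle.

(** * The Zolotarev map in elliptic coordinates *)

Section ZolotarevStep.
Context {R : realType} (n : nat) (Theta : R).
Hypothesis hTheta : 0 < Theta < pi / 2.
Implicit Types (u v w x y : R) (z : R[i]).

Notation l := (sin Theta).
Notation lc := (cos Theta).
Notation K := (ellipticK (sin Theta)).
Notation N := ((2 * n + 1)%:R : R).
Notation e := (jacobi_pt (sin Theta)).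
Notation sn := (fun u => jacobi_sn u l).
Notation cn := (fun u => jacobi_cn u l).
Notation dn := (fun u => jacobi_dn u l).
Notation za j := (zolo_a n Theta j).

Lemma sin_angle_gt0 : 0 < l. Proof. by have := hTheta => h; apply: sin_gt0_pi; lra. Qed.
Lemma cos_angle_gt0 : 0 < lc. Proof. by have := hTheta => h; apply: cos_gt0_pihalf; lra. Qed.
Lemma angle_modulus : 0 <= l < 1.
Proof.
have l0 := sin_angle_gt0; rewrite ltW//= -(@expr_lt1 _ 2)// ?ltW//.
by have := cos2Dsin2 Theta; have := exprn_gt0 2 cos_angle_gt0; lra.
Qed.
Let hl := angle_modulus.

Lemma jacobi_pt_quarter : e K = lc +i* l.
Proof.
rewrite /jacobi_pt jacobi_dnK// jacobi_snK// mulr1 -cos2sin2 sqrtr_sqr gtr0_norm//.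
exact: cos_angle_gt0.
Qed.

Let N0 : 0 < N. Proof. by rewrite ltr0n addn1. Qed.
Let K0 : 0 < K := ellipticK_gt0 hl.

(** The spacing of the [v_j], plus the half period [2 K] that accounts for the
    alternating exponent of the [a_j]. *)
Definition zolo_shift : R := 2 * K * (2 * n + 2)%:R / N.
Notation w0 := zolo_shift.

Lemma jacobi_cn2Kn u m : cn (u + 2 * K * m%:R) = (-1) ^+ m * cn u.
Proof.
elim: m => [|m IH]; first by rewrite mulr0 addr0 expr0 mul1r.
by rewrite -(natr1 m) mulrDr mulr1 addrA jacobi_cn2K// IH exprS; ring.
Qed.

(** [(cos Theta sn v + dn v) / cn v] is [tan (am w / 2)] for [w = v + K], so its square has
    Cayley transform [cn (v + K)]; inverting it changes the sign, as does a shift of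
    [w] by [2 K]. *)
Lemma zolo_aP j : (1 <= j <= n)%N ->
  [/\ 0 < za j, za j != 1 & cayley (za j) = cn ((n.+1 - j)%:R * w0)].
Proof.
move=> /andP[j1 jn].
have parE : odd (n.+1 - j) = ~~ odd (j + n) by lia.
pose v := zolo_v n Theta j.
have vE : v = (2 * j%:R - 1) / N * K by [].
have j1R : 1 <= j%:R :> R by rewrite ler1n.
have jnR : j%:R <= n%:R :> R by rewrite ler_nat.
have NE : N = 2 * n%:R + 1 by rewrite natrD natrM.
have v0 : 0 < v by rewrite vE mulr_gt0// divr_gt0//; lra.
have vK : v < K.
  by rewrite vE gtr_pMl// ltr_pdivrMr// mul1r NE; lra.
have s0 : 0 < sn v.
  by have := @jacobi_sn_lt _ _ hl 0 v; rewrite jacobi_sn0// => -> //; lra.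
have c0 : 0 < cn v by apply: jacobi_cn_gt0 => //; lra.
have d0 : 0 < dn v := jacobi_dn_gt0 hl v.
have lc0 := cos_angle_gt0.
have lc2 : lc ^+ 2 = 1 - l ^+ 2 := cos2sin2 Theta.
(* Its positivity, from [0 < v < K], excludes [a_j = 1]. *)
have cKv : cn (K - v) = lc * sn v / dn v.
  rewrite jacobi_cnD// jacobi_cnK// jacobi_snK// jacobi_snN// jacobi_dnN//.
  rewrite jacobi_dnK// -lc2 sqrtr_sqr gtr0_norm//.
  have -> : jacobi_den l K (- v) = dn v ^+ 2.
    by rewrite /jacobi_den jacobi_snK// jacobi_snN// jacobi_dn2//; ring.
  by field; rewrite gt_eqF.
have cw : cn ((n.+1 - j)%:R * w0) = (-1) ^+ (n.+1 - j) * cn (K - v).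
  have -> : (n.+1 - j)%:R * w0 = (K - v) + 2 * K * (n.+1 - j)%:R.
    rewrite vE /zolo_shift natrB; last by rewrite ltnW.
    rewrite -(natr1 n) NE natrD natrM; field.
    by rewrite -NE gt_eqF.
  by rewrite jacobi_cn2Kn.
pose tau := (lc * sn v + dn v) / cn v.
have t0 : 0 < tau by rewrite divr_gt0// addr_gt0// mulr_gt0.
have ct : cayley (tau ^+ 2) = - cn (K - v).
  rewrite cKv /cayley /tau.
  have h : (cn v) ^+ 2 + (lc * sn v + dn v) ^+ 2 = 2 * dn v * (lc * sn v + dn v).
    have := jacobi_cn2 l v; have := jacobi_dn2 hl v => h1 h2.
    by ring: h1 h2 lc2.
  have h' : (cn v) ^+ 2 - (lc * sn v + dn v) ^+ 2 = - 2 * lc * sn v * (lc * sn v + dn v).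
    have := jacobi_cn2 l v; have := jacobi_dn2 hl v => h1 h2.
    by ring: h1 h2 lc2.
  have g0 : 0 < lc * sn v + dn v by rewrite addr_gt0// mulr_gt0.
  transitivity (((cn v) ^+ 2 - (lc * sn v + dn v) ^+ 2) /
     ((cn v) ^+ 2 + (lc * sn v + dn v) ^+ 2)).
    field; rewrite gt_eqF//=; last by rewrite addr_gt0// exprn_gt0.
    rewrite gt_eqF// addr_gt0// exprn_gt0//.
  by rewrite h h'; field; rewrite !gt_eqF.
have cinv x : 0 < x -> cayley x^-1 = - cayley x.
  by move=> x0; rewrite /cayley; field; rewrite !gt_eqF//; lra.
have aE : za j = if odd (n.+1 - j) then tau ^+ 2 else (tau ^+ 2)^-1.
  have -> : za j = exprz tau (2 * (-1) ^+ (j + n)) by [].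
  rewrite parE -signr_odd; case: (odd (j + n)) => //.
have a0 : 0 < za j by rewrite aE; case: ifP => _; rewrite ?invr_gt0 exprn_gt0.
have cE : cayley (za j) = cn ((n.+1 - j)%:R * w0).
  rewrite cw -signr_odd aE; case: (odd _); first by rewrite ct expr1 mulN1r.
  by rewrite cinv ?exprn_gt0// ct opprK expr0 mul1r.
split=> //; apply/eqP => a1; have := cE; rewrite a1 /cayley subrr mul0r cw.
move=> /esym/eqP; rewrite mulf_eq0 signr_eq0/= cKv.
by rewrite gt_eqF// divr_gt0// mulr_gt0.
Qed.

Lemma zolo_rE z : zolo_r n z Theta = z * \prod_(1 <= j < n.+1) blaschke (za j) z.
Proof. by []. Qed.

(** The speed [circ_speed] at the point [x + i y] of the unit circle. *)
Definition zolo_speed x y : R := 1 + 2 * \sum_(1 <= j < n.+1)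
  (cayley (za j) / (x ^+ 2 + cayley (za j) ^+ 2 * y ^+ 2)).

Lemma shiftN : N * w0 = 4 * K * n.+1%:R.
Proof.
rewrite /zolo_shift mulrC divfK ?gt_eqF// -(natr1 n) natrD natrM; ring.
Qed.

(** The index [j] contributes the two factors [s = i] and [s = N - i] with
    [i = n + 1 - j], which are [e (u + i w0)] and [e (u - i w0)] by periodicity. *)
Lemma zolo_r_prod u :
  zolo_r n (e u) Theta = \prod_(0 <= i < 2 * n + 1) e (u + i%:R * w0).
Proof.
rewrite (@big_cyclic_fold _ _ _ _ (fun i => e (u - i%:R * w0))); last first.
  move=> i hi; rewrite natrB; last lia.
  rewrite mulrBl shiftN.
  have -> : u + (4 * K * n.+1%:R - i%:R * w0) = u - i%:R * w0 + 4 * K * n.+1%:R by ring.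
  by rewrite jacobi_pt4K.
rewrite zolo_rE mul0r addr0; congr (_ * _).
rewrite big_nat_rev/=; apply: eq_big_nat => i hi.
have [a0 a1 ac] := @zolo_aP (1 + n.+1 - i.+1) ltac:(lia).
rewrite (jacobi_pt_pair hl _ a0 a1 (w := i%:R * w0))// ac.
by congr (cn (_%:R * _)); lia.
Qed.

(** The derivative in [u] of the argument of the product in [zolo_r_prod], divided
    by [l]. *)
Lemma zolo_speed_sum u :
  cn u * zolo_speed (dn u) (l * sn u) = \sum_(0 <= i < 2 * n + 1) cn (u + i%:R * w0).
Proof.
rewrite (@big_cyclic_fold _ _ _ _ (fun i => cn (u - i%:R * w0))); last first.
  move=> i hi; rewrite natrB; last lia.
  rewrite mulrBl shiftN.
  have -> : u + (4 * K * n.+1%:R - i%:R * w0) = u - i%:R * w0 + 4 * K * n.+1%:R by ring.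
  by rewrite jacobi_cn4K.
rewrite mul0r addr0 /zolo_speed mulrDr mulr1; congr (_ + _).
rewrite !mulr_sumr big_nat_rev/=; apply: eq_big_nat => i hi.
have [a0 a1 ->] := @zolo_aP (1 + n.+1 - i.+1) ltac:(lia).
rewrite jacobi_cn_pair// (_ : (n.+1 - (1 + n.+1 - i.+1) = i)%N)//; lia.
Qed.

End ZolotarevStep.

Section UnitCircle.
Context {R : realType}.
Implicit Types (x y : R) (z : R[i]).

Lemma sin_sq_unit z : `|z| = 1 -> sin_sq (z ^+ 2) = (complex.Im z ^+ 2)%:C.
Proof.
move=> z1; have z0 : z != 0 by rewrite -normr_eq0 z1 oner_eq0.
have := (unit_normE z).1 z1; case: z z1 z0 => x y z1 z0 /= xy.
rewrite /sin_sq; apply: (mulIf (_ : 4 * (x +i* y) ^+ 2 != 0)).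
  by rewrite mulf_neq0 ?expf_neq0// pnatr_eq0.
rewrite divfK; last by rewrite mulf_neq0 ?expf_neq0// pnatr_eq0.
have -> : (4 : R[i]) = 4%:C by rewrite rmorph_nat.
have x2 : x ^+ 2 = 1 - y ^+ 2 by rewrite -xy; ring.
rewrite complexE2/= expr2; simpc.
by congr (_ +i* _); ring: x2.
Qed.

Lemma unit_inv_Im z : `|z| = 1 -> complex.Im z^-1 ^+ 2 = complex.Im z ^+ 2.
Proof.
move=> z1; have z0 : z != 0 by rewrite -normr_eq0 z1 oner_eq0.
have xy := (unit_normE z).1 z1.
have -> : z^-1 = complex.Re z -i* complex.Im z.
  apply: (mulIf z0); rewrite mulVf//; case: z xy {z1 z0} => x y /= xy.
  by simpc; congr (_ +i* _); [rewrite -xy; ring|ring].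
by rewrite sqrrN.
Qed.

Lemma blaschke_norm (a : R) z : 0 < a -> a != 1 -> `|z| = 1 -> `|blaschke a z| = 1.
Proof.
move=> a0 a1 /unit_normE; case: z => x y /= xy; rewrite blaschkeE//.
apply/unit_normE; rewrite /= /blaschke_re /blaschke_im.
have D0 := cayley_den_gt0 (cayley_neq0 a0 a1) xy.
by field; rewrite exprMn gt_eqF.
Qed.

End UnitCircle.

Lemma node_index_le n i : i \in [:: 0, 2 * n + 1 & iota 1 (2 * n)]%N ->
  (i <= 2 * n + 1)%N.
Proof. by rewrite !in_cons mem_iota => /or3P[/eqP|/eqP|]; lia. Qed.

Lemma node_index_uniq n : uniq [:: 0, 2 * n + 1 & iota 1 (2 * n)]%N.
Proof. by rewrite /= !in_cons !mem_iota iota_uniq; lia. Qed.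

Lemma interior_index n i : (i \in iota 1 (2 * n)) = (1 <= i <= 2 * n)%N.
Proof. by rewrite mem_iota; lia. Qed.

Lemma double_neq_odd n i : ((2 * i)%N == (2 * n + 1)%N) = false.
Proof. by lia. Qed.

Section ZolotarevIdentity.
Context {R : realType} (n : nat) (Theta : R).
Hypothesis hTheta : 0 < Theta < pi / 2.
Implicit Types (u v w x y : R) (z : R[i]).

Notation l := (sin Theta).
Notation lc := (cos Theta).
Notation K := (ellipticK (sin Theta)).
Notation N := ((2 * n + 1)%:R : R).
Notation e := (jacobi_pt (sin Theta)).
Notation sn := (fun u => jacobi_sn u l).
Notation cn := (fun u => jacobi_cn u l).
Notation dn := (fun u => jacobi_dn u l).
Notation za j := (zolo_a n Theta j).
Notation w0 := (zolo_shift n Theta).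
Let hl := angle_modulus hTheta.
Let l0 := sin_angle_gt0 hTheta.
Let lc0 := cos_angle_gt0 hTheta.
Let N0 : 0 < N. Proof. by rewrite ltr0n addn1. Qed.
Let K0 : 0 < K := ellipticK_gt0 hl.

Let aa (i : 'I_n) : R[i] := (za i.+1)%:C.

Let za_gt0 (i : 'I_n) : 0 < za i.+1.
Proof. by have [] := zolo_aP hTheta (n := n) (j := i.+1) (ltn_ord i). Qed.
Let za_neq1 (i : 'I_n) : za i.+1 != 1.
Proof. by have [] := zolo_aP hTheta (n := n) (j := i.+1) (ltn_ord i). Qed.

Lemma zolo_r_norm z : `|z| = 1 -> `|zolo_r n z Theta| = 1.
Proof.
move=> z1; rewrite zolo_rE normrM z1 mul1r normr_prod big_add1 big_mkord.
by apply: big1 => i _; rewrite blaschke_norm.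
Qed.

Lemma zolo_r1 : zolo_r n 1 Theta = 1.
Proof.
rewrite zolo_rE mul1r big_add1 big_mkord big1// => i _.
rewrite /blaschke expr1n mulr1 divff//.
by have [] := @blaschke_dom R (za i.+1) 1 (za_gt0 i) (za_neq1 i) (normr1 _); rewrite expr1n mulr1.
Qed.

Lemma zolo_rN z : zolo_r n (- z) Theta = - zolo_r n z Theta.
Proof.
rewrite !zolo_rE mulNr; congr (- (_ * _)).
by apply: eq_bigr => j _; rewrite /blaschke sqrrN.
Qed.

Lemma zolo_ri_sqr : complex.Im (zolo_r n (0 +i* 1) Theta) ^+ 2 = 1.
Proof.
  have bi (i : 'I_n) : blaschke (za i.+1) (0 +i* 1) = -1.
    have c0 := cayley_neq0 (za_gt0 i) (za_neq1 i).
    rewrite blaschkeE//; last by rewrite expr0n expr1n add0r.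
    have -> : blaschke_re (cayley (za i.+1)) 0 1 = -1 by rewrite /blaschke_re; field.
    have -> : blaschke_im (cayley (za i.+1)) 0 1 = 0 by rewrite /blaschke_im; field.
    by apply/eqP; rewrite eq_complex/= oppr0 !eqxx.
  rewrite zolo_rE big_add1 big_mkord (eq_bigr _ (fun i _ => bi i)) prodr_const.
  by rewrite -signr_odd; case: (odd _); rewrite ?expr1 ?expr0 ?mulrN ?mulr1/= ?sqrrN expr1n.
Qed.

Let circ_dom_unit z : `|z| = 1 -> circ_dom aa (z ^+ 2).
Proof.
move=> z1; split; first by rewrite expf_neq0// -normr_eq0 z1 oner_eq0.
by move=> i; exact: blaschke_dom.
Qed.

Let circ_sq_unit z : circ_sq aa (z ^+ 2) = zolo_r n z Theta ^+ 2.
Proof. by rewrite zolo_rE exprMn big_add1 big_mkord -prodrXl. Qed.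

Let circ_speed_unit x y : x ^+ 2 + y ^+ 2 = 1 ->
  circ_speed aa ((x +i* y) ^+ 2) = (zolo_speed n Theta x y)%:C.
Proof.
move=> xy; rewrite /circ_speed /zolo_speed rmorphD rmorphM/= rmorph_nat rmorph1.
rewrite rmorph_sum/= big_add1 big_mkord; congr (_ + _ * _).
by apply: eq_bigr => i _; rewrite blaschke_speedE.
Qed.

(** The points where the argument of [r (e u)] is extremal; [i = 0] and
    [i = 2 n + 1] are the end points [-K] and [K]. *)
Definition zolo_node i : R := ((2 * i)%:R - N) / N * K.
Notation un := zolo_node.

Let nodeS i : un i.+1 + 2 * K = un i + w0.
Proof.
have := N0; rewrite /un /zolo_shift ?(natrM, natrD) -?(natr1 i) => h.
by field; rewrite gt_eqF.
Qed.

Let Z u := zolo_r n (e u) Theta.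
Let W u := cn u * zolo_speed n Theta (dn u) (l * sn u).

Let shift_fun (T : Type) (f : R -> T) u :
  (forall u m, f (u + 4 * K * m%:R) = f u) ->
  f (u + (2 * n + 1)%:R * w0) = f (u + 0%:R * w0).
Proof. by move=> fp; rewrite shiftN// fp mul0r addr0. Qed.

Let ZS u : Z (u + w0) = Z u.
Proof.
rewrite /Z !zolo_r_prod// -[RHS]big_cyclic_shift; last first.
  by apply: (shift_fun u (f := e)) => ? ?; rewrite jacobi_pt4K.
by apply: eq_bigr => i _; rewrite -(natr1 i) mulrDl mul1r -addrA (addrC w0).
Qed.

Let WS u : W (u + w0) = W u.
Proof.
rewrite /W !zolo_speed_sum// -[RHS]big_cyclic_shift; last first.
  by apply: (shift_fun u (f := cn)) => ? ?; rewrite jacobi_cn4K.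
by apply: eq_bigr => i _; rewrite -(natr1 i) mulrDl mul1r -addrA (addrC w0).
Qed.

Let Z2K u : Z (u + 2 * K) = (Z u)^-1.
Proof.
rewrite /Z !zolo_r_prod// -prodfV; apply: eq_bigr => i _.
by rewrite addrAC jacobi_pt2K.
Qed.

Let W2K u : W (u + 2 * K) = - W u.
Proof.
rewrite /W !zolo_speed_sum// -sumrN; apply: eq_bigr => i _.
by rewrite addrAC jacobi_cn2K.
Qed.

Let W_node i : W (un i) = 0.
Proof.
elim: i => [|i IH].
  rewrite /W /un muln0 sub0r mulNr divff ?gt_eqF// mulN1r.
  by rewrite jacobi_cnN// jacobi_cnK// mul0r.
by apply/eqP; rewrite -oppr_eq0 -W2K nodeS WS IH.
Qed.

(** [sin^2 Theta'], where [Theta'] is the amplitude of the argument of [r] on the arc. *)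
Definition zolo_sup_sq : R := complex.Im (zolo_r n (lc +i* l) Theta) ^+ 2.
Notation lam2 := zolo_sup_sq.

Let ptK : e K = lc +i* l := jacobi_pt_quarter hTheta.

Let Z_norm u : `|Z u| = 1. Proof. by apply: zolo_r_norm; exact: jacobi_pt_norm. Qed.

Let node_end : un (2 * n + 1) = K.
Proof. by rewrite /un natrM; field; rewrite gt_eqF. Qed.

Let Z_nodeS i : complex.Im (Z (un i.+1)) ^+ 2 = complex.Im (Z (un i)) ^+ 2.
Proof. by rewrite -unit_inv_Im// -Z2K nodeS ZS. Qed.

Lemma zolo_r_node i : complex.Im (Z (un i)) ^+ 2 = lam2.
Proof.
have E j : complex.Im (Z (un j)) ^+ 2 = complex.Im (Z (un 0)) ^+ 2.
  by elim: j => [//|j IH]; rewrite Z_nodeS.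
by rewrite E -(E (2 * n + 1)%N) node_end /Z ptK.
Qed.

Lemma zolo_node_lt i j : (i < j)%N -> un i < un j.
Proof.
move=> ij; rewrite /un ltr_pM2r// ltr_pM2r ?invr_gt0// ltrD2r ltr_nat.
by rewrite ltn_mul2l.
Qed.

Let node0 : un 0 = - K.
Proof. by rewrite /un muln0 sub0r mulNr divff ?gt_eqF// mulN1r. Qed.

Let node_le i : (i <= 2 * n + 1)%N -> - K <= un i <= K.
Proof.
move=> hi; rewrite -{1}node0 -{1}node_end.
have le a b : (a <= b)%N -> un a <= un b.
  by rewrite leq_eqVlt => /predU1P[->//|/zolo_node_lt/ltW].
by rewrite !le.
Qed.

Lemma zolo_node_interior i : (1 <= i <= 2 * n)%N -> - K < un i < K.
Proof.
move=> hi; rewrite -{1}node0 -{1}node_end.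
by rewrite !zolo_node_lt//; clear -hi; lia.
Qed.

Let speed_node i : (1 <= i <= 2 * n)%N ->
  zolo_speed n Theta (dn (un i)) (l * sn (un i)) = 0.
Proof.
move=> /zolo_node_interior/(jacobi_cn_gt0 hl) c0; apply/eqP.
by have /eqP := W_node i; rewrite /W mulf_eq0 (gt_eqF c0).
Qed.

(** [circ_identity] at the nodes.  The constant and the bounds on [sin^2 Theta'] come
    from evaluating the identity at [z = 1] and [z = i], where [r] is [1] and [+-i]
    and where the speed is nonzero because neither has the same square as a node. *)
Theorem zolo_identity :
  [/\ 0 < lam2 < 1,
    exists2 kappa, 0 < kappa & forall x y, x ^+ 2 + y ^+ 2 = 1 ->
      lam2 - complex.Im (zolo_r n (x +i* y) Theta) ^+ 2 =
      kappa * (l ^+ 2 - y ^+ 2) * zolo_speed n Theta x y ^+ 2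
  & forall x y, x ^+ 2 + y ^+ 2 = 1 -> zolo_speed n Theta x y = 0 ->
      exists2 i, (1 <= i <= 2 * n)%N & (x +i* y) ^+ 2 = e (un i) ^+ 2].
Proof.
pose zs := [seq e (un i) ^+ 2 | i <- iota 1 (2 * n)].
have zsP t : t \in zs -> exists2 i, (1 <= i <= 2 * n)%N & t = e (un i) ^+ 2.
  by case/mapP => i; rewrite interior_index => hi ->; exists i.
have zE : [:: e (un 0) ^+ 2, e (un (2 * n + 1)) ^+ 2 & zs] =
  [seq e (un i) ^+ 2 | i <- [:: 0, 2 * n + 1 & iota 1 (2 * n)]%N] by [].
have allP t : t \in [:: e (un 0) ^+ 2, e (un (2 * n + 1)) ^+ 2 & zs] ->
    exists2 i, (i <= 2 * n + 1)%N & t = e (un i) ^+ 2.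
  by rewrite zE => /mapP[i /node_index_le hi ->]; exists i.
have [|||||[c cE] speed0] := @circ_identity R[i] n aa lam2%:C (e (un 0) ^+ 2)
    (e (un (2 * n + 1)) ^+ 2) zs.
- rewrite zE map_inj_in_uniq; first exact: node_index_uniq.
  move=> i j /node_index_le hi' /node_index_le hj'.
  move=> /(jacobi_pt_sqr_inj hl l0 (node_le hi') (node_le hj')) uij.
  by case: (ltngtP i j) => // /zolo_node_lt; rewrite uij ltxx.
- by rewrite size_map size_iota.
- move=> t /allP[i hi ->]; split; first exact/circ_dom_unit/jacobi_pt_norm.
  rewrite circ_sq_unit sin_sq_unit; last exact: (Z_norm (un i)).
  by rewrite (zolo_r_node i).
- move=> t /zsP[i hi ->]; rewrite circ_speed_unit ?jacobi_pt_sqr//.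
  by rewrite speed_node.
- by move=> j; rewrite /aa fmorph_eq0 gt_eqF.
have sp0 x y : x ^+ 2 + y ^+ 2 = 1 -> zolo_speed n Theta x y = 0 ->
      exists2 i, (1 <= i <= 2 * n)%N & (x +i* y) ^+ 2 = e (un i) ^+ 2.
  move=> xy s0; apply/zsP/speed0; first exact/circ_dom_unit/unit_normE.
  by rewrite circ_speed_unit// s0.
have id x y : x ^+ 2 + y ^+ 2 = 1 ->
    (lam2 - complex.Im (zolo_r n (x +i* y) Theta) ^+ 2)%:C =
    4 * c * ((l ^+ 2 - y ^+ 2) * zolo_speed n Theta x y ^+ 2)%:C.
  move=> xy; have z1 : `|x +i* y| = 1 by apply/unit_normE.
  have := cE _ (circ_dom_unit z1).
  rewrite circ_sq_unit sin_sq_unit ?zolo_r_norm// circ_speed_unit// -rmorphB => ->.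
  rewrite rmorphM rmorphXn/= [RHS]mulrA; congr (_ * _).
  rewrite node0 node_end jacobi_ptN// ptK.
  have z0 : x +i* y != 0 by rewrite -normr_eq0 z1 oner_eq0.
  have p0 : lc +i* l != 0 by rewrite -ptK jacobi_pt_neq0.
  have p1 : `|lc +i* l| = 1 by rewrite -ptK jacobi_pt_norm.
  rewrite rmorphB/= -(sin_sq_unit z1) -(sin_sq_unit p1) /sin_sq.
  by field; rewrite z0 p0.
(* The node [u = 0] is missing because [2 i - N] is odd. *)
have sp1 : zolo_speed n Theta 1 0 != 0.
  apply/eqP => /sp0; rewrite expr1n expr0n addr0 => /(_ erefl)[i hi].
  have -> : (1 +i* 0 : R[i]) = e 0 by rewrite /jacobi_pt jacobi_dn0// jacobi_sn0// mulr0.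
  have hK : - K <= 0 <= K by have := K0; lra.
  have hi' : (i <= 2 * n + 1)%N by case/andP: hi => _ /leq_trans; apply; exact: leq_addr.
  move=> /(jacobi_pt_sqr_inj hl l0 hK (node_le hi'))/esym/eqP; rewrite /un !mulf_eq0 invr_eq0 (gt_eqF K0) (gt_eqF N0) !orbF subr_eq0 eqr_nat.
  by rewrite double_neq_odd.
(* All nodes have positive real part [dn u]. *)
have spi : zolo_speed n Theta 0 1 != 0.
  apply/eqP => /sp0; rewrite expr1n expr0n add0r => /(_ erefl)[i hi].
  move=> /eqP; rewrite eqf_sqr => /orP[|] /eqP [].
    by move=> d0; have := jacobi_dn_gt0 hl (un i); rewrite -d0 ltxx.
  by move=> d0; have := jacobi_dn_gt0 hl (un i); lra.
have r1 : zolo_r n (1 +i* 0) Theta = 1 := zolo_r1.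
have ri : complex.Im (zolo_r n (0 +i* 1) Theta) ^+ 2 = 1 := zolo_ri_sqr.
have l2 : l ^+ 2 + lc ^+ 2 = 1 by rewrite addrC cos2Dsin2.
have l20 : 0 < l ^+ 2 by rewrite exprn_gt0.
have lc20 : 0 < lc ^+ 2 by rewrite exprn_gt0.
pose s1 := zolo_speed n Theta 1 0; pose si := zolo_speed n Theta 0 1.
have s10 : 0 < s1 ^+ 2 by rewrite exprn_even_gt0.
have si0 : 0 < si ^+ 2 by rewrite exprn_even_gt0.
pose kappa := lam2 / (l ^+ 2 * s1 ^+ 2).
have cK : 4 * c = kappa%:C.
  have := id 1 0; rewrite expr1n expr0n addr0 => /(_ erefl).
  rewrite r1 /= expr0n !subr0 => lE.
  have h0 : (l ^+ 2 * s1 ^+ 2)%:C != 0 :> R[i] by rewrite fmorph_eq0 mulf_neq0// gt_eqF.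
  by rewrite /kappa fmorph_div; apply: (mulIf h0); rewrite divfK// -lE.
have idR x y : x ^+ 2 + y ^+ 2 = 1 ->
    lam2 - complex.Im (zolo_r n (x +i* y) Theta) ^+ 2 =
    kappa * (l ^+ 2 - y ^+ 2) * zolo_speed n Theta x y ^+ 2.
  by move=> /id; rewrite cK -rmorphM -mulrA => /complexI.
have kappa_ge0 : 0 <= kappa by rewrite divr_ge0 ?sqr_ge0// mulr_ge0// ltW.
have lamE : lam2 = kappa * (l ^+ 2 * s1 ^+ 2) by rewrite divfK// mulf_neq0// gt_eqF.
have := idR 0 1; rewrite expr1n expr0n add0r => /(_ erefl); rewrite ri -/si => lamE'.
have kappa0 : 0 < kappa.
  rewrite lt0r kappa_ge0 andbT; apply/eqP => k0.
  by move: lamE'; rewrite lamE k0 !mul0r sub0r => /eqP; rewrite oppr_eq0 oner_eq0.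
split => //; last by exists kappa.
apply/andP; split; first by rewrite lamE mulr_gt0// mulr_gt0.
rewrite -subr_lt0 lamE' -mulrA pmulr_rlt0// pmulr_llt0//; lra.
Qed.

End ZolotarevIdentity.

(** * One step of the iteration on angles *)

Section AngularSpeed.
Context {R : realType}.
Implicit Types (z : R -> R[i]) (w t a : R).

(** [z' = i w z] at [t]: a point of the unit circle moving with angular velocity [w]. *)
Definition turns z w t :=
  is_derive t (1:R) (fun s => complex.Re (z s)) (- complex.Im (z t) * w) /\
  is_derive t (1:R) (fun s => complex.Im (z s)) (complex.Re (z t) * w).

Lemma turns_mul z1 z2 w1 w2 t : turns z1 w1 t -> turns z2 w2 t ->
  turns (fun s => z1 s * z2 s) (w1 + w2) t.
Proof.
move=> [r1 i1] [r2 i2].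
have reE s : complex.Re (z1 s * z2 s) =
    complex.Re (z1 s) * complex.Re (z2 s) - complex.Im (z1 s) * complex.Im (z2 s).
  by case: (z1 s) (z2 s) => a b [c d].
have imE s : complex.Im (z1 s * z2 s) =
    complex.Re (z1 s) * complex.Im (z2 s) + complex.Im (z1 s) * complex.Re (z2 s).
  by case: (z1 s) (z2 s) => a b [c d].
pose x1 s := complex.Re (z1 s); pose x2 s := complex.Re (z2 s).
pose y1 s := complex.Im (z1 s); pose y2 s := complex.Im (z2 s).
have {}r1 : is_derive t (1:R) x1 (- y1 t * w1) by [].
have {}r2 : is_derive t (1:R) x2 (- y2 t * w2) by [].
have {}i1 : is_derive t (1:R) y1 (x1 t * w1) by [].
have {}i2 : is_derive t (1:R) y2 (x2 t * w2) by [].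
rewrite /turns reE imE; split.
  rewrite (_ : (fun s => _) = (fun s => x1 s * x2 s - y1 s * y2 s)); last exact/funext.
  by eapply is_derive_eq; [der|rewrite /x1 /x2 /y1 /y2; ring].
rewrite (_ : (fun s => _) = (fun s => x1 s * y2 s + y1 s * x2 s)); last exact/funext.
by eapply is_derive_eq; [der|rewrite /x1 /x2 /y1 /y2; ring].
Qed.

Lemma turns_prod (I : Type) (r : seq I) (z : I -> R -> R[i]) (w : I -> R) t :
  (forall i, turns (z i) (w i) t) ->
  turns (fun s => \prod_(i <- r) z i s) (\sum_(i <- r) w i) t.
Proof.
move=> zw; elim: r => [|i r IH].
  rewrite big_nil; rewrite (_ : (fun s => _) = (fun => 1)); last first.
    by apply/funext => s; rewrite big_nil.
  by split; rewrite /= ?mulr0; exact: derive_cst.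
rewrite big_cons (_ : (fun s => _) = (fun s => z i s * \prod_(i <- r) z i s)).
  exact: turns_mul.
by apply/funext => s; rewrite big_cons.
Qed.

Lemma turns_blaschke z w t a : 0 < a -> a != 1 -> (forall s, `|z s| = 1) ->
  turns z w t -> turns (fun s => blaschke a (z s))
    (2 * (cayley a / (complex.Re (z t) ^+ 2 + cayley a ^+ 2 * complex.Im (z t) ^+ 2)) * w) t.
Proof.
move=> a0 a1 z1 [r i]; pose c := cayley a.
pose x s := complex.Re (z s); pose y s := complex.Im (z s).
have xy s : x s ^+ 2 + y s ^+ 2 = 1 by have /unit_normE := z1 s.
have bE : (fun s => blaschke a (z s)) =
    (fun s => blaschke_re c (x s) (y s) +i* blaschke_im c (x s) (y s)).
  by apply/funext => s; rewrite -blaschkeE// /x /y; case: (z s).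
have {}r : is_derive t (1:R) x (- y t * w) by [].
have {}i : is_derive t (1:R) y (x t * w) by [].
have D0 : x t ^+ 2 + c ^+ 2 * y t ^+ 2 != 0.
  by rewrite gt_eqF// cayley_den_gt0// cayley_neq0.
have x2 : x t ^+ 2 = 1 - y t ^+ 2 by rewrite -(xy t); ring.
rewrite bE -/(x t) -/(y t) -/c; split; rewrite /= /blaschke_re /blaschke_im.
  eapply is_derive_eq; first by der.
  apply: (mulIf (expf_neq0 2 D0)); rewrite /=.
  transitivity (- (2 * c * x t * y t * 2 * c * w)); last by field; rewrite exprMn.
  transitivity (((x t ^+ 2 + c ^+ 2 * y t ^+ 2) * (- 2 * x t * y t * w - c ^+ 2 * 2 * y t * x t * w)
    - (x t ^+ 2 - c ^+ 2 * y t ^+ 2) * (- 2 * x t * y t * w + c ^+ 2 * 2 * y t * x t * w))).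
    by field; rewrite exprMn.
  ring: x2.
eapply is_derive_eq; first by der.
apply: (mulIf (expf_neq0 2 D0)); rewrite /=.
transitivity ((x t ^+ 2 - c ^+ 2 * y t ^+ 2) * 2 * c * w); last by field; rewrite exprMn.
transitivity ((x t ^+ 2 + c ^+ 2 * y t ^+ 2) * (2 * c * (x t * x t - y t * y t) * w)
    - (2 * c * x t * y t) * (- 2 * x t * y t * w + c ^+ 2 * 2 * y t * x t * w)).
  by field; rewrite exprMn.
ring: x2.
Qed.

(** Angular velocities add in products, and each factor multiplies the velocity of [z]
    by its contribution to the speed. *)
Lemma turns_zolo n (Theta : R) z w t : 0 < Theta < pi / 2 ->
  (forall s, `|z s| = 1) -> turns z w t ->
  turns (fun s => zolo_r n (z s) Theta)
    (zolo_speed n Theta (complex.Re (z t)) (complex.Im (z t)) * w) t.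
Proof.
move=> hT z1 zw.
have -> : (fun s => zolo_r n (z s) Theta) =
    (fun s => z s * \prod_(i < n) blaschke (zolo_a n Theta i.+1) (z s)).
  by apply/funext => s; rewrite zolo_rE big_add1 big_mkord.
rewrite /zolo_speed big_add1 big_mkord mulrDl mul1r mulrAC.
apply: turns_mul => //; rewrite mulr_sumr.
under eq_bigr do rewrite mulrAC.
apply: turns_prod => i.
by have [a0 a1 _] := zolo_aP hT (n := n) (j := i.+1) (ltn_ord i); exact: turns_blaschke.
Qed.

End AngularSpeed.

Section ZolotarevStepTheorem.
Context {R : realType} (n : nat) (Theta : R).
Hypothesis hTheta : 0 < Theta < pi / 2.
Implicit Types (u v w x y t : R) (z : R[i]).

Notation l := (sin Theta).
Notation lc := (cos Theta).
Notation K := (ellipticK (sin Theta)).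
Notation N := ((2 * n + 1)%:R : R).
Notation e := (jacobi_pt (sin Theta)).
Notation sn := (fun u => jacobi_sn u l).
Notation cn := (fun u => jacobi_cn u l).
Notation dn := (fun u => jacobi_dn u l).
Notation un := (@zolo_node R n Theta).
Notation lam2 := (@zolo_sup_sq R n Theta).
Notation speed := (zolo_speed n Theta).
Notation r z := (zolo_r n z Theta).
Let hl := angle_modulus hTheta.
Let l0 := sin_angle_gt0 hTheta.
Let lc0 := cos_angle_gt0 hTheta.
Let N0 : 0 < N. Proof. by rewrite ltr0n addn1. Qed.
Let K0 : 0 < K := ellipticK_gt0 hl.
Let lc2 : lc ^+ 2 = 1 - l ^+ 2 := cos2sin2 Theta.

Let hlc : 0 <= lc < 1.
Proof.
rewrite ltW//= -(@expr_lt1 _ 2)// ?ltW// lc2.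
by have := exprn_gt0 2 l0; lra.
Qed.

Let turns_pt t : turns e (l * cn t) t.
Proof.
rewrite /turns /=; split; last first.
  pose S := sn; have dS : is_derive t (1:R) S (cn t * dn t) := derive_sn hl t.
  by eapply is_derive_eq; [apply: (derive_mul (derive_cst l t) dS)|rewrite mulr0 addr0; ring].
by eapply is_derive_eq; [exact: derive_dn|rewrite /=; ring].
Qed.

Let turns_Z t : turns (fun s => r (e s)) (speed (dn t) (l * sn t) * (l * cn t)) t.
Proof. exact: (turns_zolo n hTheta (jacobi_pt_norm hl) (turns_pt t)). Qed.

Let Z_sqr z : `|z| = 1 -> complex.Re (r z) ^+ 2 = 1 - complex.Im (r z) ^+ 2.
Proof. by move=> /(zolo_r_norm n hTheta)/unit_normE <-; ring. Qed.

Lemma zolo_Im_le u : complex.Im (r (e u)) ^+ 2 <= lam2.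
Proof.
have [_ [kappa k0 idk] _] := zolo_identity n hTheta.
rewrite -subr_ge0 idk ?jacobi_pt_sqr// mulr_ge0 ?sqr_ge0// mulr_ge0 ?(ltW k0)//.
rewrite exprMn subr_ge0 ler_piMr ?sqr_ge0//; exact: jacobi_sn2_le1.
Qed.

(** [r (e u)] cannot leave the right half plane, in which it starts at [u = 0]: on the
    imaginary axis [Im^2] would be [1], above its maximum on the arc. *)
Lemma zolo_Re_gt0 u : 0 < complex.Re (r (e u)).
Proof.
have [/andP[_ lam1] _ _] := zolo_identity n hTheta.
have nz v : complex.Re (r (e v)) != 0.
  apply/eqP => X0; have := Z_sqr (jacobi_pt_norm hl v); rewrite X0 expr0n/=.
  by have := zolo_Im_le v; lra.
have X1 : complex.Re (r (e 0)) = 1.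
  have -> : e 0 = 1 by rewrite /jacobi_pt jacobi_dn0// jacobi_sn0// mulr0.
  by rewrite zolo_r1.
pose X v := complex.Re (r (e v)).
have cX : continuous X.
  by move=> v; have [dX _] := turns_Z v; exact: (derive_continuous dX).
rewrite -/(X u) lt0r nz/= leNgt; apply/negP => Xu.
have ivt a b : a <= b -> Num.min (X a) (X b) <= 0 <= Num.max (X a) (X b) -> False.
  move=> ab m; have [c _ /eqP] := IVT ab (continuous_subspaceT cX) m.
  by rewrite (negPf (nz c)).
have X01 : X 0 = 1 by [].
case: (leP 0 u) => u0.
  by apply: (ivt 0 u u0); rewrite X01 ge_min le_max ler01 (ltW Xu) orbT.
by apply: (ivt u 0 (ltW u0)); rewrite X01 ge_min le_max ler01 (ltW Xu) orbT.
Qed.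

Let node_mid : un n.+1 = K / N.
Proof.
have := N0; rewrite /zolo_node natrM natrD natrM -(natr1 n) => h.
by field; rewrite gt_eqF.
Qed.

(** The identity [zolo_identity] as a differential equation, with [C^2 = 1 / kappa]. *)
Lemma zolo_ellipticK :
  exists2 C, 0 < C &
    ellipticK (Num.sqrt lam2) = C * (K / N) /\
    ellipticK (Num.sqrt (1 - lam2)) = C * ellipticK lc.
Proof.
have [/andP[lam0 lam1] [kappa k0 idk] nodes] := zolo_identity n hTheta.
pose lam := Num.sqrt lam2; have lamE : lam ^+ 2 = lam2 by rewrite sqr_sqrtr// ltW.
have lam_gt0 : 0 < lam by rewrite sqrtr_gt0.
pose lam' := Num.sqrt (1 - lam2).
have lamE' : lam' ^+ 2 = 1 - lam2 by rewrite sqr_sqrtr//; lra.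
have lam_gt0' : 0 < lam' by rewrite sqrtr_gt0; lra.
pose C := (Num.sqrt kappa)^-1.
have C0 : 0 < C by rewrite invr_gt0 sqrtr_gt0.
have CE : C ^+ 2 = kappa^-1 by rewrite exprVn sqr_sqrtr// ltW.
exists C => //; split.
  (* On the arc: [sin (arg r) / sin Theta'] from [u = 0] to the first node [K / N]. *)
  have K'0 : 0 < K / N by rewrite divr_gt0.
  rewrite -[X in _ = _ * X]subr0.
  pose y t := complex.Im (r (e t)) / lam.
  pose dy t := complex.Re (r (e t)) * (speed (dn t) (l * sn t) * (l * cn t)) / lam.
  have Dy t : is_derive t (1:R) y (dy t).
    have [_ dI] := turns_Z t.
    rewrite /y /dy; eapply is_derive_eq; first exact: (derive_mul dI (derive_cst _ _)).
    by rewrite mulr0 add0r mulrC.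
  have idt t : lam2 - complex.Im (r (e t)) ^+ 2 =
      kappa * (l * cn t) ^+ 2 * speed (dn t) (l * sn t) ^+ 2.
    rewrite idk ?jacobi_pt_sqr//; congr (_ * _ * _).
    by rewrite !exprMn (jacobi_cn2 l t); ring.
  apply: (@ellipticK_comparison R lam y dy) => //.
  - by rewrite ltW//= -(@expr_lt1 _ 2)// ?ltW// lamE.
  - exact: (continuous_subspaceT (fun t => derive_continuous (Dy t))).
  - move=> t _; rewrite /dy /y expr_div_n expr_div_n exprMn Z_sqr ?jacobi_pt_norm// lamE.
    have := idt t; rewrite CE; set Y := complex.Im _ ^+ 2; set S := speed _ _; set c := l * _.
    move=> E; have -> : (S * c) ^+ 2 = (lam2 - Y) / kappa.
      by rewrite E; field; rewrite gt_eqF.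
    by field; rewrite !gt_eqF.
  - move=> t /andP[t0 tK]; rewrite /y expr_div_n lamE ltr_pdivrMr// mul1r -subr_gt0 idt.
    have tK' : t < K.
      by rewrite (lt_le_trans tK)// ler_pdivrMr// ler_peMr ?(ltW K0)// ler1n addn1.
    have c0 : 0 < cn t by apply: jacobi_cn_gt0 => //; have := K0; lra.
    rewrite pmulr_rgt0; last by rewrite mulr_gt0// exprn_gt0// mulr_gt0.
    rewrite exprn_even_gt0//=.
    apply/eqP => s0; have [i hi] := nodes _ _ (jacobi_pt_sqr hl t) s0.
    have hu := zolo_node_interior hTheta hi.
    have h1 : - K <= t <= K by have := K0; lra.
    have h2 : - K <= un i <= K by lra.
    move=> /(jacobi_pt_sqr_inj hl l0 h1 h2) tE.
    have [ni|ni] := leqP i n.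
      have : un i <= 0.
        rewrite /zolo_node pmulr_lle0// pmulr_lle0 ?invr_gt0// subr_le0 ler_nat.
        by rewrite (leq_trans _ (leq_addr _ _))// leq_mul2l ni.
      by rewrite -tE; lra.
    have : K / N <= un i.
      move: ni; rewrite leq_eqVlt -node_mid => /predU1P[<-//|/(zolo_node_lt n hTheta)/ltW//].
    by rewrite -tE; lra.
  - rewrite /y; have -> : e 0 = 1 by rewrite /jacobi_pt jacobi_dn0// jacobi_sn0// mulr0.
    by rewrite zolo_r1// mul0r.
  - rewrite /y expr_div_n lamE -node_mid zolo_r_node// divff// gt_eqF//.
rewrite -[X in _ = _ * X]subr0.
(* On the complementary arc, from [i] down to [e^(i Theta)], parametrized by the
   Jacobi functions of modulus [cos Theta]: [cos (arg r) / cos Theta']. *)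
pose z t : R[i] := (lc * jacobi_sn t lc) +i* jacobi_dn t lc.
have zxy t : (lc * jacobi_sn t lc) ^+ 2 + jacobi_dn t lc ^+ 2 = 1.
  by rewrite jacobi_dn2//; ring.
have z1 t : `|z t| = 1 by exact/unit_normE/zxy.
have turns_z t : turns z (- (lc * jacobi_cn t lc)) t.
  rewrite /turns /=; split.
    pose S u := jacobi_sn u lc.
    have dS : is_derive t (1:R) S (jacobi_cn t lc * jacobi_dn t lc) := derive_sn hlc t.
    by eapply is_derive_eq; [apply: (derive_mul (derive_cst lc t) dS)|rewrite mulr0 addr0; ring].
  by eapply is_derive_eq; [exact: derive_dn|rewrite /=; ring].
have turns_rz t := turns_zolo n hTheta z1 (turns_z t).
pose y t := complex.Re (r (z t)) / lam'.
pose S t := speed (lc * jacobi_sn t lc) (jacobi_dn t lc).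
pose dy t := complex.Im (r (z t)) * (S t * (lc * jacobi_cn t lc)) / lam'.
have Dy t : is_derive t (1:R) y (dy t).
  have [dI _] := turns_rz t.
  rewrite /y /dy; eapply is_derive_eq; first exact: (derive_mul dI (derive_cst _ _)).
  by rewrite mulr0 add0r /= -/(S t); ring.
have idt t : complex.Im (r (z t)) ^+ 2 - lam2 =
    kappa * (lc * jacobi_cn t lc) ^+ 2 * S t ^+ 2.
  rewrite -opprB idk// jacobi_dn2// exprMn jacobi_cn2 lc2 /S; ring.
have Y2 t : complex.Im (r (z t)) ^+ 2 = 1 - complex.Re (r (z t)) ^+ 2.
  by rewrite Z_sqr//; ring.
apply: (@ellipticK_comparison R lam' y dy) => //.
- by rewrite ltW//= -(@expr_lt1 _ 2)// ?ltW// lamE'; lra.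
- exact: ellipticK_gt0.
- exact: (continuous_subspaceT (fun t => derive_continuous (Dy t))).
- move=> t _; rewrite /dy /y !expr_div_n !exprMn lamE' CE.
  have := idt t; rewrite Y2; move: (complex.Re _ ^+ 2) (S t ^+ 2) => X s; rewrite exprMn.
  move=> E; have -> : s * (lc ^+ 2 * jacobi_cn t lc ^+ 2) = (1 - X - lam2) / kappa.
    by rewrite E; field; rewrite gt_eqF.
  have h : 1 - lam2 != 0 by rewrite subr_eq0 eq_sym lt_eqF.
  by field; rewrite h gt_eqF.
- move=> t /andP[t0 tK]; rewrite /y expr_div_n lamE' ltr_pdivrMr ?subr_gt0// mul1r.
  have c0 : 0 < jacobi_cn t lc by apply: jacobi_cn_gt0 => //; lra.
  suff : 0 < complex.Im (r (z t)) ^+ 2 - lam2 by rewrite Y2; lra.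
  rewrite idt pmulr_rgt0; last by rewrite mulr_gt0// exprn_gt0// mulr_gt0.
  rewrite exprn_even_gt0//=.
  apply/eqP => s0; have [i hi] := nodes _ _ (zxy t) s0.
  have le1 : (l * sn (un i)) ^+ 2 <= l ^+ 2.
    by rewrite exprMn ler_piMr ?sqr_ge0//; exact: jacobi_sn2_le1.
  have lt2 : l ^+ 2 < jacobi_dn t lc ^+ 2.
    have := exprn_gt0 2 c0; rewrite jacobi_dn2// jacobi_cn2 lc2 => h.
    have := mulr_gt0 (exprn_gt0 2 lc0) h; rewrite lc2; lra.
  move=> /eqP; rewrite eqf_sqr => /orP[|] /eqP [_ dE].
    by move: lt2; rewrite dE ltNge le1.
  by move: lt2; rewrite dE sqrrN ltNge le1.
- rewrite /y; apply/eqP; rewrite mulf_eq0; apply/orP; left.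
  have z0E : z 0 = 0 +i* 1 by rewrite /z jacobi_sn0// jacobi_dn0// mulr0.
  by rewrite -(sqrf_eq0 (complex.Re _)) Z_sqr// z0E zolo_ri_sqr// subrr.
- rewrite /y expr_div_n lamE'.
  have -> : z (ellipticK lc) = lc +i* l.
    by rewrite /z jacobi_snK// jacobi_dnK// mulr1 -sin2cos2 sqrtr_sqr gtr0_norm.
  rewrite Z_sqr ?divff//.
    by rewrite -/(zolo_sup_sq n Theta) subr_eq0 eq_sym lt_eqF.
  by apply/unit_normE; rewrite /= cos2Dsin2.
Qed.

End ZolotarevStepTheorem.

Section Arcs.
Context {R : realType}.
Implicit Types (t phi Theta : R) (z : R[i]).

Definition cis phi : R[i] := cos phi +i* sin phi.

Lemma cis_norm phi : `|cis phi| = 1.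
Proof. by apply/unit_normE; rewrite /= cos2Dsin2. Qed.

Lemma unit_Re_bound z : `|z| = 1 -> -1 <= complex.Re z <= 1.
Proof.
by move=> /unit_normE h; have := sqr_ge0 (complex.Im z); move: h => h1 h2; apply/andP; split; nra.
Qed.

Lemma unit_normc z : `|z| = 1 -> ComplexField.Normc.normc z = 1.
Proof.
by move=> /unit_normE; case: z => x y /= ->; rewrite sqrtr1.
Qed.

Lemma abs_argc z : `|z| = 1 -> `|argc z| = acos (complex.Re z).
Proof.
move=> z1; rewrite /argc unit_normc// divr1.
have a0 : 0 <= acos (complex.Re z) by apply: acos_ge0; exact: unit_Re_bound.
by case: ifP => _; rewrite ?normrN ger0_norm.
Qed.

Lemma cis_of_half z T : `|z| = 1 -> 0 < complex.Re z -> 0 < T < pi / 2 ->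
  complex.Im z ^+ 2 <= sin T ^+ 2 ->
  exists2 phi, `|phi| <= T & z = cis phi.
Proof.
move=> z1 x0 hT yT; have xy := (unit_normE z).1 z1.
have y1 : -1 <= complex.Im z <= 1.
  by have := sqr_ge0 (complex.Re z) => h; apply/andP; split; nra.
have sT : 0 < sin T by apply: sin_gt0_pi; lra.
have yT' : - sin T <= complex.Im z <= sin T.
  by apply/andP; split; nra.
have pi0 := @pi_gt0 R.
have sinasin : sin (asin (complex.Im z)) = complex.Im z by rewrite asinK// in_itv.
have as1 : - (pi / 2) <= asin (complex.Im z) <= pi / 2.
  by rewrite asin_geNpi2// asin_lepi2.
exists (asin (complex.Im z)).
  rewrite ler_norml; apply/andP; split.
    rewrite leNgt; apply/negP => h; have : sin (asin (complex.Im z)) < sin (- T).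
      by rewrite ltr_sin// in_itv/=; lra.
    by rewrite sinasin sinN; lra.
  rewrite leNgt; apply/negP => h; have : sin T < sin (asin (complex.Im z)).
    by rewrite ltr_sin// in_itv/=; lra.
  by rewrite sinasin; lra.
rewrite /cis sinasin cos_asin//.
have -> : 1 - complex.Im z ^+ 2 = complex.Re z ^+ 2 by rewrite -xy; ring.
by rewrite sqrtr_sqr gtr0_norm//; case: z {z1 x0 yT xy y1 yT' sinasin as1}.
Qed.

End Arcs.

Section Step.
Context {R : realType} (n : nat) (Theta : R).
Hypothesis hTheta : 0 < Theta < pi / 2.
Notation next := `|argc (zolo_r n (cis Theta) Theta)|.
Let l0 := sin_angle_gt0 hTheta.
Let lc0 := cos_angle_gt0 hTheta.
Let hl := angle_modulus hTheta.
Notation lam2 := (@zolo_sup_sq R n Theta).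

Let ptK : jacobi_pt (sin Theta) (ellipticK (sin Theta)) = cis Theta :=
  jacobi_pt_quarter hTheta.

Let X_gt0 : 0 < complex.Re (zolo_r n (cis Theta) Theta).
Proof. by rewrite -ptK; exact: zolo_Re_gt0. Qed.

Let X_sqr : complex.Re (zolo_r n (cis Theta) Theta) ^+ 2 = 1 - lam2.
Proof.
have /unit_normE h := zolo_r_norm n hTheta (cis_norm Theta).
by rewrite -h /zolo_sup_sq -/(cis Theta); ring.
Qed.

Lemma cos_next : cos next = Num.sqrt (1 - lam2).
Proof.
have z1 := zolo_r_norm n hTheta (cis_norm Theta).
rewrite abs_argc// acosK; last by rewrite in_itv/= unit_Re_bound.
by rewrite -X_sqr sqrtr_sqr gtr0_norm.
Qed.

Lemma sin_next : sin next = Num.sqrt lam2.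
Proof.
have z1 := zolo_r_norm n hTheta (cis_norm Theta).
rewrite abs_argc// sin_acos ?unit_Re_bound// X_sqr; congr Num.sqrt; ring.
Qed.

Lemma next_bound : 0 < next < pi / 2.
Proof.
have [/andP[lam0 lam1] _ _] := zolo_identity n hTheta.
have z1 := zolo_r_norm n hTheta (cis_norm Theta).
have b1 := unit_Re_bound z1; have pi0 := @pi_gt0 R.
have n0 : next <= pi by rewrite abs_argc// acos_lepi.
have s0 : 0 < sin next by rewrite sin_next sqrtr_gt0.
have c0 : 0 < cos next by rewrite cos_next sqrtr_gt0; lra.
have := normr_ge0 (argc (zolo_r n (cis Theta) Theta)); move: n0 s0 c0.
move: next => t t_pi s0 c0 t0; apply/andP; split.
  rewrite lt_neqAle t0 andbT; apply/eqP => t00; by rewrite -t00 sin0 ltxx in s0.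
rewrite ltNge; apply/negP => ht.
have : 0 <= cos (pi - t) by apply: cos_ge0_pihalf; lra.
have -> : cos (pi - t) = - cos t by rewrite cosB cospi sinpi; ring.
lra.
Qed.

Lemma zolo_rho_next : zolo_rho next = zolo_rho Theta ^+ (2 * n + 1).
Proof.
have [C C0 [k1 k2]] := zolo_ellipticK n hTheta.
rewrite /zolo_rho cos_next sin_next k1 k2 -expRM_natl; congr expR.
have K0 := ellipticK_gt0 hl.
have N0 : 0 < ((2 * n + 1)%:R : R) by rewrite ltr0n addn1.
by move: N0; set N := _%:R => N0; field; rewrite !gt_eqF.
Qed.

(** The arc is the image of [jacobi_pt], where [zolo_Re_gt0] and [zolo_Im_le] apply. *)
Lemma zolo_r_arc phi : `|phi| <= Theta ->
  exists2 psi, `|psi| <= next & zolo_r n (cis phi) Theta = cis psi.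
Proof.
rewrite ler_norml => hphi; have pi0 := @pi_gt0 R; have hT := hTheta.
have in_pi t : - Theta <= t <= Theta -> t \in `[(- (pi/2)), pi/2].
  by rewrite in_itv/=; lra.
have sphi : - sin Theta <= sin phi <= sin Theta.
  rewrite -sinN; apply/andP; split; rewrite leNgt ltr_sin; first [exact: in_pi | apply: in_pi; lra | lra].
have sl : -1 <= sin phi / sin Theta <= 1.
  by rewrite ler_pdivlMr// ler_pdivrMr//; lra.
pose u := ellipticF (asin (sin phi / sin Theta)) (sin Theta).
have snu : jacobi_sn u (sin Theta) = sin phi / sin Theta.
  by rewrite /jacobi_sn ellipticFK// asinK// in_itv.
have -> : cis phi = jacobi_pt (sin Theta) u.
  rewrite /jacobi_pt /jacobi_dn snu /cis; congr (_ +i* _); last first.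
    by field; rewrite gt_eqF.
  have -> : 1 - sin Theta ^+ 2 * (sin phi / sin Theta) ^+ 2 = cos phi ^+ 2.
    by rewrite cos2sin2; field; rewrite gt_eqF.
  by rewrite sqrtr_sqr ger0_norm// cos_ge0_pihalf//; lra.
apply: cis_of_half.
- by apply: zolo_r_norm => //; exact: jacobi_pt_norm.
- exact: zolo_Re_gt0.
- exact: next_bound.
- have [/andP[lam0 _] _ _] := zolo_identity n hTheta.
  by rewrite sin_next sqr_sqrtr ?(ltW lam0)// zolo_Im_le.
Qed.

End Step.

(** * The complex and the matrix exponential *)

Section ComplexExponential.
Context {R : realType}.
Implicit Types (z w : R[i]).

Definition cexp z : R[i] := (expR (complex.Re z) * cos (complex.Im z)) +i*
                            (expR (complex.Re z) * sin (complex.Im z)).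

(** Limits are taken componentwise because that is how [expm] takes them. *)
Definition ccvg (u : nat -> R[i]) z :=
  ((fun N => complex.Re (u N)) @ \oo --> complex.Re z) /\
  ((fun N => complex.Im (u N)) @ \oo --> complex.Im z).

Lemma ReD z w : complex.Re (z + w) = complex.Re z + complex.Re w.
Proof. by case: z w => a b []. Qed.
Lemma ImD z w : complex.Im (z + w) = complex.Im z + complex.Im w.
Proof. by case: z w => a b []. Qed.
Lemma ReM z w : complex.Re (z * w) =
  complex.Re z * complex.Re w - complex.Im z * complex.Im w.
Proof. by case: z w => a b []. Qed.
Lemma ImM z w : complex.Im (z * w) =
  complex.Re z * complex.Im w + complex.Im z * complex.Re w.
Proof. by case: z w => a b []. Qed.

Lemma ccvg_unique u z w : ccvg u z -> ccvg u w -> z = w.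
Proof.
move=> [r1 i1] [r2 i2]; have := cvg_unique _ r1 r2; have := cvg_unique _ i1 i2.
by case: z w {r1 i1 r2 i2} => a b [c d] /= -> // ->.
Qed.

Lemma ccvg_ext u v z : (forall N, u N = v N) -> ccvg u z -> ccvg v z.
Proof. by move=> uv; have -> : u = v by exact/funext. Qed.

Lemma ccvg_add u v z w : ccvg u z -> ccvg v w -> ccvg (fun N => u N + v N) (z + w).
Proof.
move=> [r1 i1] [r2 i2]; split.
  by rewrite ReD; under eq_fun do rewrite ReD; exact: cvgD.
by rewrite ImD; under eq_fun do rewrite ImD; exact: cvgD.
Qed.

Lemma ccvg_cst z : ccvg (fun _ => z) z.
Proof. by split; exact: cvg_cst. Qed.

Lemma ccvg_mul u v z w : ccvg u z -> ccvg v w -> ccvg (fun N => u N * v N) (z * w).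
Proof.
move=> [r1 i1] [r2 i2]; split.
  by rewrite ReM; under eq_fun do rewrite ReM; apply: cvgB; exact: cvgM.
by rewrite ImM; under eq_fun do rewrite ImM; apply: cvgD; exact: cvgM.
Qed.

Lemma ccvg_sum (I : Type) (r : seq I) (u : I -> nat -> R[i]) (z : I -> R[i]) :
  (forall i, ccvg (u i) (z i)) ->
  ccvg (fun N => \sum_(i <- r) u i N) (\sum_(i <- r) z i).
Proof.
move=> uz; elim: r => [|i r IH].
  rewrite big_nil; apply: ccvg_ext (ccvg_cst 0) => N; by rewrite big_nil.
rewrite big_cons; apply: ccvg_ext (ccvg_add (uz i) IH) => N.
by rewrite big_cons.
Qed.

Lemma ccvg_shift u z : ccvg (fun N => u N.+1) z -> ccvg u z.
Proof. by move=> [r i]; split; rewrite -cvg_shiftS. Qed.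

Lemma series_dominated_cvg (u : R^nat) (M : R) :
  (forall k, `|u k| <= M ^+ k / k`!%:R) -> cvgn (series u).
Proof.
move=> uM; apply: normed_cvg; apply: series_le_cvg (is_cvg_series_exp_coeff M) => //=.
by move=> k; apply: le_trans (uM k).
Qed.

Lemma Re_le_normc z : `|complex.Re z| <= ComplexField.Normc.normc z.
Proof.
by case: z => x y /=; rewrite -sqrtr_sqr ler_wsqrtr// lerDl sqr_ge0.
Qed.
Lemma Im_le_normc z : `|complex.Im z| <= ComplexField.Normc.normc z.
Proof.
by case: z => x y /=; rewrite -sqrtr_sqr ler_wsqrtr// lerDr sqr_ge0.
Qed.
Lemma normcX z k : ComplexField.Normc.normc (z ^+ k) = ComplexField.Normc.normc z ^+ k.
Proof.
elim: k => [|k IH]; first by rewrite !expr0 ComplexField.Normc.normc1.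
by rewrite !exprS ComplexField.Normc.normcM IH.
Qed.

Definition exp_sum z N : R[i] := \sum_(0 <= k < N) (k`!%:R)^-1 * z ^+ k.

Lemma Re_sum (I : Type) (r : seq I) (F : I -> R[i]) :
  complex.Re (\sum_(i <- r) F i) = \sum_(i <- r) complex.Re (F i).
Proof. by elim: r => [|i r IH]; rewrite ?big_nil// !big_cons ReD IH. Qed.
Lemma Im_sum (I : Type) (r : seq I) (F : I -> R[i]) :
  complex.Im (\sum_(i <- r) F i) = \sum_(i <- r) complex.Im (F i).
Proof. by elim: r => [|i r IH]; rewrite ?big_nil// !big_cons ImD IH. Qed.

Lemma natc_inv k : (k`!%:R : R[i])^-1 = ((k`!%:R)^-1)%:C.
Proof. by rewrite fmorphV rmorph_nat. Qed.

(** Along [t |-> t z] the real and imaginary parts [f], [g] of the exponential series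
    are power series solving [f' = a f - b g], [g' = b f + a g]; rotating and
    rescaling by [e^(- a t)] gives two functions with zero derivative. *)
Lemma exp_sum_cvg z : ccvg (exp_sum z) (cexp z).
Proof.
pose a := complex.Re z; pose b := complex.Im z.
pose M := ComplexField.Normc.normc z.
pose c k : R := complex.Re (z ^+ k) / k`!%:R.
pose d k : R := complex.Im (z ^+ k) / k`!%:R.
have cc t : cvgn (pseries c t).
  apply: (@series_dominated_cvg _ (M * `|t|)) => k.
  rewrite normrM normrX exprMn /c normrM normfV normr_nat.
  rewrite mulrAC ler_pM2r ?invr_gt0 ?ltr0n ?fact_gt0//.
  by rewrite ler_wpM2r ?exprn_ge0// -normcX Re_le_normc.
have cd t : cvgn (pseries d t).
  apply: (@series_dominated_cvg _ (M * `|t|)) => k.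
  rewrite normrM normrX exprMn /d normrM normfV normr_nat.
  rewrite mulrAC ler_pM2r ?invr_gt0 ?ltr0n ?fact_gt0//.
  by rewrite ler_wpM2r ?exprn_ge0// -normcX Im_le_normc.
have lin (x y : R) (p q : R^nat) t : cvgn (pseries p t) -> cvgn (pseries q t) ->
    pseries (fun k => x * p k + y * q k) t @ \oo -->
    x * limn (pseries p t) + y * limn (pseries q t).
  move=> hp hq; rewrite (_ : pseries _ t = (fun N => x * pseries p t N + y * pseries q t N)).
    by apply: cvgD; apply: cvgM => //; exact: cvg_cst.
  apply/funext => N; rewrite /pseries /series /= !mulr_sumr -big_split/=.
  by apply: eq_bigr => k _; ring.
have k0 k : (k`!%:R : R) != 0 by rewrite pnatr_eq0 -lt0n fact_gt0.
have k1 k : (k.+1%:R : R) != 0 by rewrite pnatr_eq0.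
have dc : pseries_diffs c = (fun k => a * c k + (- b) * d k).
  apply/funext => k; rewrite /pseries_diffs /c /d exprS ReM factS natrM -/a -/b.
  by move: (k0 k) (k1 k); move: k.+1%:R k`!%:R => p q q0 p0; field; rewrite q0 p0.
have dd : pseries_diffs d = (fun k => b * c k + a * d k).
  apply/funext => k; rewrite /pseries_diffs /c /d exprS ImM factS natrM -/a -/b.
  by move: (k0 k) (k1 k); move: k.+1%:R k`!%:R => p q q0 p0; field; rewrite q0 p0.
have clin (x y : R) t : cvgn (pseries (fun k => x * c k + y * d k) t).
  by apply: cvgP; exact: lin.
have ddiffs (x y : R) : pseries_diffs (fun k => x * c k + y * d k) =
    (fun k => (x * a + y * b) * c k + (- x * b + y * a) * d k).
  apply/funext => k; transitivity (x * pseries_diffs c k + y * pseries_diffs d k).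
    by rewrite /pseries_diffs; ring.
  by rewrite dc dd; ring.
pose f t := limn (pseries c t); pose g t := limn (pseries d t).
have df (t : R) : is_derive t (1:R) f (a * f t + - b * g t).
  rewrite -(cvg_lim _ (lin a (- b) c d t (cc t) (cd t)))// -dc.
  have lt : `|t| < `| `|t| + 1 | by rewrite [ltRHS]ger0_norm ?ltrDl// addr_ge0.
  by apply: (@pseries_snd_diffs _ c (`|t| + 1)) => //; rewrite dc ?ddiffs; exact: clin.
have dg (t : R) : is_derive t (1:R) g (b * f t + a * g t).
  rewrite -(cvg_lim _ (lin b a c d t (cc t) (cd t)))// -dd.
  have lt : `|t| < `| `|t| + 1 | by rewrite [ltRHS]ger0_norm ?ltrDl// addr_ge0.
  by apply: (@pseries_snd_diffs _ d (`|t| + 1)) => //; rewrite dd ?ddiffs; exact: clin.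
have at0 (p : R^nat) : limn (pseries p 0) = p 0%N.
  apply: cvg_lim => //; rewrite -cvg_shiftS.
  rewrite (_ : (fun N => _) = (fun => p 0%N)); first exact: cvg_cst.
  apply/funext => N; rewrite /pseries /series /= big_nat_recl// big1 => [|k _].
    by rewrite expr0 mulr1 addr0.
  by rewrite expr0n/= mulr0.
have f0 : f 0 = 1 by rewrite /f at0 /c expr0 fact0 divr1.
have g0 : g 0 = 0 by rewrite /g at0 /d expr0 mul0r.
pose E (t : R) := expR t.
have dE (t : R) : is_derive t (1:R) E (E t) := is_derive_expR t.
have h1 : E (- a * 1) * (cos (b * 1) * f 1 + sin (b * 1) * g 1) = 1.
  transitivity (E (- a * 0) * (cos (b * 0) * f 0 + sin (b * 0) * g 0)).
    apply: (@derive_zero_const _ (fun t => E (- a * t) * (cos (b * t) * f t + sin (b * t) * g t))).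
    by move=> t; eapply is_derive_eq; [by der|rewrite /=; ring].
  by rewrite !mulr0 cos0 sin0 f0 g0 /E expR0; ring.
have h2 : E (- a * 1) * (cos (b * 1) * g 1 - sin (b * 1) * f 1) = 0.
  transitivity (E (- a * 0) * (cos (b * 0) * g 0 - sin (b * 0) * f 0)).
    apply: (@derive_zero_const _ (fun t => E (- a * t) * (cos (b * t) * g t - sin (b * t) * f t))).
    by move=> t; eapply is_derive_eq; [by der|rewrite /=; ring].
  by rewrite !mulr0 cos0 sin0 f0 g0 /E expR0; ring.
rewrite !mulr1 /E in h1 h2.
have Ea : expR a * expR (- a) = 1 by rewrite -expRD subrr expR0.
have {}h1 : cos b * f 1 + sin b * g 1 = expR a.
  by rewrite -[LHS]mul1r -{1}Ea -mulrA h1 mulr1.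
have {}h2 : cos b * g 1 - sin b * f 1 = 0.
  by rewrite -[LHS]mul1r -{1}Ea -mulrA h2 mulr0.
have cs := cos2Dsin2 b.
have f1 : f 1 = expR a * cos b.
  rewrite -h1; transitivity (f 1 * (cos b ^+ 2 + sin b ^+ 2) + sin b * (cos b * g 1 - sin b * f 1)).
    by rewrite h2 cs mulr1 mulr0 addr0.
  ring.
have g1 : g 1 = expR a * sin b.
  rewrite -h1; transitivity (g 1 * (cos b ^+ 2 + sin b ^+ 2) - cos b * (cos b * g 1 - sin b * f 1)).
    by rewrite h2 cs mulr1 mulr0 subr0.
  ring.
split; rewrite /cexp /= -/a -/b.
  rewrite -f1; rewrite (_ : (fun N => _) = pseries c 1); first exact: cc.
  apply/funext => N; rewrite /exp_sum Re_sum; apply: eq_bigr => k _.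
  by rewrite natc_inv ReM /= mul0r subr0 /c expr1n mulr1 mulrC.
rewrite -g1; rewrite (_ : (fun N => _) = pseries d 1); first exact: cd.
apply/funext => N; rewrite /exp_sum Im_sum; apply: eq_bigr => k _.
by rewrite natc_inv ImM /= mul0r addr0 /d expr1n mulr1 mulrC.
Qed.

End ComplexExponential.

Section MatrixExponential.
Context {R : realType} {m : nat}.
Implicit Types (A L : 'M[R[i]]_m) (v w : 'rV[R[i]]_m) (z mu : R[i]).
Notation normc := ComplexField.Normc.normc.

Definition mexp_sum L N : 'M[R[i]]_m := \sum_(0 <= k < N) (k`!%:R)^-1 *: L ^+ k.

Definition mcvg (U : nat -> 'M[R[i]]_m) A := forall i j, ccvg (fun N => U N i j) (A i j).

Lemma normc_sum_le (I : Type) (r : seq I) (F : I -> R[i]) :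
  normc (\sum_(i <- r) F i) <= \sum_(i <- r) normc (F i).
Proof.
elim: r => [|i r IH]; first by rewrite !big_nil ComplexField.Normc.normc0.
rewrite !big_cons; apply: le_trans (le_normcD _ _) _.
by rewrite lerD2l.
Qed.

Lemma mexp_entry_bound L : exists M : R, forall k i j, normc ((L ^+ k) i j) <= M ^+ k.
Proof.
pose B := \sum_i \sum_j normc (L i j).
have n0 z : 0 <= normc z by case: z => x y; exact: sqrtr_ge0.
have B0 : 0 <= B by rewrite sumr_ge0// => i _; rewrite sumr_ge0.
have LB i j : normc (L i j) <= B.
  rewrite /B (bigD1 i)//= (bigD1 j)//= -addrA lerDl addr_ge0 ?sumr_ge0// => i' _.
  by rewrite sumr_ge0.
exists (m%:R * B) => k; elim: k => [|k IH] i j.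
  rewrite !expr0 mxE; case: (i == j); first by rewrite ComplexField.Normc.normc1.
  by rewrite ComplexField.Normc.normc0.
rewrite exprSr mxE; apply: le_trans (normc_sum_le _ _) _.
apply: (@le_trans _ _ (\sum_(l < m) (m%:R * B) ^+ k * B)).
  apply: ler_sum => l _; rewrite ComplexField.Normc.normcM.
  by apply: ler_pM.
by rewrite sumr_const card_ord exprSr -[leLHS]mulr_natl mulrCA.
Qed.

Lemma mexp_sum_entry L N i j :
  mexp_sum L N i j = \sum_(0 <= k < N) (k`!%:R)^-1 * (L ^+ k) i j.
Proof. by rewrite /mexp_sum summxE; apply: eq_bigr => k _; rewrite mxE. Qed.

Lemma expm_cvg L : mcvg (mexp_sum L) (expm L).
Proof.
have [M LM] := mexp_entry_bound L.
have k0 k : (0 : R) < k`!%:R by rewrite ltr0n fact_gt0.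
have key (f : R[i] -> R) (h : forall z z1, f (z + z1) = f z + f z1)
    (hz : forall (x : R) z, f (x%:C * z) = x * f z) (hn : forall z, `|f z| <= normc z) i j :
  cvgn (fun N => f (mexp_sum L N i j)).
  have -> : (fun N => f (mexp_sum L N i j)) = series (fun k => f ((L ^+ k) i j) / k`!%:R).
    apply/funext => N; rewrite mexp_sum_entry /series/=.
    have f0 : f 0 = 0 by have := hz 0 0; rewrite mulr0 mul0r.
    elim: N => [|N IH]; first by rewrite !big_nil.
    by rewrite !big_nat_recr//= h IH natc_inv hz mulrC.
  apply: (@series_dominated_cvg _ _ M) => k.
  rewrite normrM normfV normr_nat ler_pM2r ?invr_gt0//.
  by apply: le_trans (hn _) (LM _ _ _).
move=> i j; split.
  rewrite /expm mxE/=; have h (x : R) z : complex.Re (x%:C * z) = x * complex.Re z.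
    by rewrite ReM /= mul0r subr0.
  exact: (key (@complex.Re R) (@ReD R) h (@Re_le_normc R) i j).
rewrite /expm mxE/=; have h (x : R) z : complex.Im (x%:C * z) = x * complex.Im z.
  by rewrite ImM /= mul0r addr0.
exact: (key (@complex.Im R) (@ImD R) h (@Im_le_normc R) i j).
Qed.

Lemma mcvg_unique U A B : mcvg U A -> mcvg U B -> A = B.
Proof. by move=> ua ub; apply/matrixP => i j; exact: ccvg_unique (ua i j) (ub i j). Qed.

Lemma mcvg_mull (P : 'M[R[i]]_m) U A : mcvg U A -> mcvg (fun N => P *m U N) (P *m A).
Proof.
move=> ua i j; rewrite mxE; apply: (ccvg_ext (u := fun N => \sum_k P i k * U N k j)).
  by move=> N; rewrite mxE.
by apply: ccvg_sum => k; apply: ccvg_mul => //; exact: ccvg_cst.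
Qed.

Lemma mcvg_mulr (P : 'M[R[i]]_m) U A : mcvg U A -> mcvg (fun N => U N *m P) (A *m P).
Proof.
move=> ua i j; rewrite mxE; apply: (ccvg_ext (u := fun N => \sum_k U N i k * P k j)).
  by move=> N; rewrite mxE.
by apply: ccvg_sum => k; apply: ccvg_mul => //; exact: ccvg_cst.
Qed.

(** The partial sums of the series act by
    [v S_(N+1) = s_(N+1) v + s_N w], since the derivative of [mu^k / k!] is
    [mu^(k-1) / (k-1)!]. *)
Lemma eigen_expm L mu v w : v *m L = mu *: v + w -> w *m L = mu *: w ->
  v *m expm L = cexp mu *: v + cexp mu *: w.
Proof.
move=> vL wL.
have wk k : w *m L ^+ k = mu ^+ k *: w.
  elim: k => [|k IH]; first by rewrite !expr0 mulmx1 scale1r.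
  by rewrite exprSr mulmxA IH -scalemxAl wL scalerA -exprSr.
have vk k : v *m L ^+ k = mu ^+ k *: v + (k%:R * mu ^+ k.-1) *: w.
  elim: k => [|k IH]; first by rewrite !expr0 mulmx1 scale1r mul0r scale0r addr0.
  rewrite exprSr mulmxA IH mulmxDl -!scalemxAl vL wL scalerDr !scalerA -addrA -scalerDl.
  congr (_ *: _ + _ *: _); first by rewrite -exprSr.
  rewrite -(natr1 k) /= mulrDl mul1r addrC; congr (_ + _).
  by case: k {IH} => [|k]; rewrite ?mul0r// -mulrA -exprSr.
have vS N : v *m mexp_sum L N.+1 = exp_sum mu N.+1 *: v + exp_sum mu N *: w.
  elim: N => [|N IH].
    rewrite /mexp_sum /exp_sum !big_nat1 big_nil !expr0 fact0 invr1 scale1r mulmx1.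
    by rewrite mulr1 scale1r scale0r addr0.
  rewrite /mexp_sum big_nat_recr//= mulmxDr -/(mexp_sum L N.+1) IH.
  rewrite /exp_sum [in RHS]big_nat_recr//= [X in _ = _ + X *: _]big_nat_recr//=.
  rewrite -!/(exp_sum mu _) -scalemxAr vk scalerDr !scalerA !scalerDl.
  rewrite addrACA; congr (_ + (_ + _ *: _)).
  have n0 : (N.+1%:R : R[i]) != 0 by rewrite pnatr_eq0.
  by rewrite mulrA factS natrM invfM (mulrAC _^-1) (mulVf n0) mul1r.
apply/matrixP => i j; rewrite [LHS]mxE [RHS]mxE [X in _ = X + _]mxE [X in _ = _ + X]mxE.
apply: (@ccvg_unique _ (fun N => (v *m mexp_sum L N) i j)).
  apply: (ccvg_ext (u := fun N => \sum_k v i k * mexp_sum L N k j)).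
    by move=> N; rewrite mxE.
  by apply: ccvg_sum => k; apply: ccvg_mul; [exact: ccvg_cst|exact: expm_cvg].
apply: ccvg_shift.
apply: (ccvg_ext (u := fun N => exp_sum mu N.+1 * v i j + exp_sum mu N * w i j)).
  by move=> N; rewrite vS !mxE.
have [r1 i1] := exp_sum_cvg mu.
have c1 : ccvg (fun N => exp_sum mu N.+1) (cexp mu).
  split.
    by rewrite (cvg_shiftS (fun N => complex.Re (exp_sum mu N))).
  by rewrite (cvg_shiftS (fun N => complex.Im (exp_sum mu N))).
by apply: ccvg_add; apply: ccvg_mul; (exact: ccvg_cst || exact: c1 || exact: exp_sum_cvg).
Qed.

End MatrixExponential.

Section SpectralUniqueness.
Context {C : numClosedFieldType}.

Lemma row_unitmx_neq0 n (Q : 'M[C]_n) i : Q \in unitmx -> row i Q != 0.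
Proof.
move=> Qu; apply/eqP => r0; have : row i Q *m invmx Q = 0 by rewrite r0 mul0mx.
rewrite -row_mul mulmxV// row1 => /rowP/(_ i); rewrite !mxE !eqxx => /eqP.
by rewrite oner_eq0.
Qed.

Lemma nonuniq_perm (T : eqType) (s : seq T) : ~~ uniq s ->
  exists x s', perm_eq s [:: x, x & s'].
Proof.
elim: s => [//|x s IH] /=; rewrite negb_and negbK => /orP[xs|/IH[y [s' hs]]].
  by exists x, (rem x s); rewrite perm_cons perm_to_rem.
exists y, (x :: s'); apply: (@perm_trans _ [:: x, y, y & s']); first by rewrite perm_cons.
by apply/permP => a /=; lia.
Qed.

(** If [mu] were a multiple root of the minimal polynomial [q (X - mu)^2], a row of
    [q (X - mu)] at [L] would end a chain of length two starting at a row of [q]. *)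
Lemma diagonalizable_no_chain n (L : 'M[C]_n) :
  (forall mu (v w : 'rV_n), v *m L = mu *: v + w -> w *m L = mu *: w -> w = 0) ->
  diagonalizable L.
Proof.
case: n L => [|n] L chain.
  by rewrite [L]flatmx0; exact: diagonalizable0.
apply/diagonalizableP.
have [rs rsE] := closed_field_poly_normal (mxminpoly L).
have lead1 : lead_coef (mxminpoly L) = 1 by apply/eqP; exact: mxminpoly_monic.
rewrite lead1 scale1r in rsE.
have urs : uniq rs; last by exists rs => //; rewrite -rsE.
apply/negPn/negP => /nonuniq_perm[mu [rs' prs]].
pose q := \prod_(x <- rs') ('X - x%:P).
have pE : mxminpoly L = q * ('X - mu%:P) * ('X - mu%:P).
  by rewrite rsE (perm_big _ prs)/= !big_cons -/q; ring.
have hX p : horner_mx L (p * ('X - mu%:P)) = horner_mx L p *m (L - mu%:M).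
  by rewrite rmorphM rmorphB /= horner_mx_X horner_mx_C.
have h0 : horner_mx L (q * ('X - mu%:P)) = 0.
  apply/row_matrixP => i; rewrite row0.
  apply: (chain mu (row i (horner_mx L q))).
    by rewrite hX !row_mul mulmxBr mul_mx_scalar addrC subrK.
  apply/eqP; rewrite -subr_eq0 -mul_mx_scalar -mulmxBr -row_mul -hX -pE.
  by rewrite mx_root_minpoly row0.
have := mxminpoly_min h0; rewrite pE => /dvdp_leq.
have mq : q \is monic by exact: monic_prod_XsubC.
rewrite monic_neq0 ?rpredM ?monicXsubC// => /(_ isT).
rewrite size_Mmonic ?monicXsubC ?monic_neq0 ?rpredM ?monicXsubC//.
rewrite size_XsubC addn2 /= ltnn //.
Qed.

(** The uniqueness principle for matrix functions.  As [B] is diagonalizable, a chain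
    of length two for [L], which is also one for [B] because [gamma <> 0], is trivial;
    so [L] has a basis of eigenvectors, and each is an eigenvector of [B] whose
    eigenvalue [beta] determines [mu]. *)
Lemma mx_eq_of_eigen n (P L : 'M[C]_n) (b l : 'rV[C]_n) :
  P \in unitmx ->
  let B := invmx P *m diag_mx b *m P in
  (forall mu, eigenvalue L mu -> exists beta gamma, [/\ gamma != 0,
     forall v w : 'rV_n, v *m L = mu *: v + w -> w *m L = mu *: w ->
       v *m B = beta *: v + gamma *: w &
     forall i, b 0 i = beta -> l 0 i = mu]) ->
  L = invmx P *m diag_mx l *m P.
Proof.
move=> Pu B hL.
have coord (v w : 'rV_n) (d : 'rV_n) i :
    v *m (invmx P *m diag_mx d *m P) = w -> (v *m invmx P) 0 i * d 0 i = (w *m invmx P) 0 i.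
  by move=> <-; rewrite !mulmxA mulmxK// mul_mx_diag !mxE.
have eig mu (v : 'rV_n) : v != 0 -> v *m L = mu *: v -> eigenvalue L mu.
  by move=> v0 vL; apply/eigenvalueP; exists v.
have chain mu (v w : 'rV_n) : v *m L = mu *: v + w -> w *m L = mu *: w -> w = 0.
  move=> vL wL; apply/eqP/negPn/negP => w0.
  have [beta [gamma [g0 hB _]]] := hL _ (eig _ _ w0 wL).
  have vB := hB _ _ vL wL.
  have wB : w *m B = beta *: w by rewrite (hB w 0) ?mul0mx ?scaler0 ?addr0.
  have : w *m invmx P = 0.
    apply/rowP => i; rewrite [RHS]mxE; apply/eqP/negPn/negP => y0.
    have e1 := coord _ _ _ i wB; rewrite -scalemxAl [RHS]mxE in e1.
    have bE : b 0 i = beta by apply: (mulIf y0); rewrite mulrC.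
    have := coord _ _ _ i vB; rewrite mulmxDl -!scalemxAl [RHS]mxE.
    rewrite [X in _ = X + _]mxE [X in _ = _ + X]mxE bE mulrC.
    move=> /esym/eqP; rewrite -subr_eq0 addrAC subrr add0r mulf_eq0 (negPf g0)/=.
    exact/negP.
  by move=> /(congr1 (mulmx^~ P)); rewrite mulmxKV// mul0mx => wz; rewrite wz eqxx in w0.
have [Q Qu /diagonalizable_forPex[d QL]] := diagonalizable_no_chain chain.
have {}QL : Q *m L = diag_mx d *m Q by exact/simmxP.
apply: (can_inj (mulKmx Qu)); rewrite QL; apply/row_matrixP => i.
rewrite [LHS]row_mul row_diag_mx -scalemxAl -rowE.
have rL : row i Q *m L = d 0 i *: row i Q.
  by rewrite -row_mul QL row_mul row_diag_mx -scalemxAl -rowE.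
have [beta [gamma [_ hB hl]]] := hL _ (eig _ _ (row_unitmx_neq0 i Qu) rL).
have rB : row i Q *m B = beta *: row i Q.
  by rewrite (hB (row i Q) 0) ?mul0mx ?scaler0 ?addr0.
rewrite row_mul; apply: (can_inj (mulmxK (_ : invmx P \in unitmx))); first by rewrite unitmx_inv.
rewrite !mulmxA mulmxK// mul_mx_diag -scalemxAl; apply/rowP => k.
rewrite [LHS]mxE [RHS]mxE.
have e1 := coord _ _ _ k rB; rewrite -scalemxAl [RHS]mxE in e1.
have [->|y0] := eqVneq ((row i Q *m invmx P) 0 k) 0; first by rewrite mulr0 mul0r.
have bE : b 0 k = beta by apply: (mulIf y0); rewrite mulrC.
by rewrite (hl _ bE) mulrC.
Qed.

End SpectralUniqueness.

(** * Functions and norms of unitarily diagonalizable matrices *)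

Section DiagonalCalculus.
Context {C : fieldType} {m : nat} (P : 'M[C]_m).
Hypothesis Pu : P \in unitmx.
Implicit Types (f g : 'I_m -> C) (z : C).

(** The matrix with eigenvalues [f i] and left eigenvectors the rows of [P]. *)
Definition diag_conj f : 'M[C]_m := invmx P *m diag_mx (\row_i f i) *m P.

Lemma diag_conj_row (d : 'rV[C]_m) : invmx P *m diag_mx d *m P = diag_conj (fun i => d 0 i).
Proof. by congr (_ *m diag_mx _ *m _); apply/rowP => i; rewrite mxE. Qed.

Lemma diag_conj_ext f g : f =1 g -> diag_conj f = diag_conj g.
Proof. by move=> /funext ->. Qed.

Lemma diag_conj_mul f g : diag_conj f *m diag_conj g = diag_conj (fun i => f i * g i).
Proof.
rewrite /diag_conj !mulmxA mulmxK// -[_ *m diag_mx _ *m diag_mx _]mulmxA mulmx_diag.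
by congr (_ *m diag_mx _ *m _); apply/rowP => i; rewrite !mxE.
Qed.

Lemma diag_conj_add f g : diag_conj f + diag_conj g = diag_conj (fun i => f i + g i).
Proof.
rewrite /diag_conj -mulmxDl -mulmxDr -raddfD/=.
by congr (_ *m diag_mx _ *m _); apply/rowP => i; rewrite !mxE.
Qed.

Lemma diag_conj_scale z f : z *: diag_conj f = diag_conj (fun i => z * f i).
Proof.
rewrite /diag_conj scalemxAl scalemxAr -linearZ/=.
by congr (_ *m diag_mx _ *m _); apply/rowP => i; rewrite !mxE.
Qed.

Lemma diag_conj_scalar z : diag_conj (fun=> z) = z%:M.
Proof.
rewrite /diag_conj (_ : \row_ _ _ = const_mx z); last by apply/rowP => i; rewrite !mxE.
by rewrite diag_const_mx mul_mx_scalar -scalemxAl mulVmx// scalemx1.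
Qed.

Lemma diag_conj_inv f : (forall i, f i != 0) ->
  diag_conj f \in unitmx /\ invmx (diag_conj f) = diag_conj (fun i => (f i)^-1).
Proof.
move=> f0; have e : diag_conj f *m diag_conj (fun i => (f i)^-1) = 1%:M.
  by rewrite diag_conj_mul -diag_conj_scalar; apply: diag_conj_ext => i; rewrite divff.
have [u _] := mulmx1_unit e; split => //.
by apply: (can_inj (mulKmx u)); rewrite e mulmxV.
Qed.

Lemma diag_conj_prod (I : Type) (r : seq I) (F : I -> 'I_m -> C) :
  \prod_(j <- r) diag_conj (F j) = diag_conj (fun i => \prod_(j <- r) F j i).
Proof.
elim: r => [|j r IH].
  rewrite big_nil -[1]/(1%:M) -diag_conj_scalar; apply: diag_conj_ext => i; by rewrite big_nil.
rewrite big_cons IH -[_ * _]/(_ *m _) diag_conj_mul; apply: diag_conj_ext => i; by rewrite big_cons.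
Qed.

Lemma diag_conj_sum (I : Type) (r : seq I) (F : I -> 'I_m -> C) :
  \sum_(j <- r) diag_conj (F j) = diag_conj (fun i => \sum_(j <- r) F j i).
Proof.
elim: r => [|j r IH].
  rewrite big_nil (_ : 0 = (0 : C)%:M); last by rewrite scalemx0 || exact/esym/raddf0.
  by rewrite -diag_conj_scalar; apply: diag_conj_ext => i; rewrite big_nil.
by rewrite big_cons IH diag_conj_add; apply: diag_conj_ext => i; rewrite big_cons.
Qed.

Lemma diag_conj_exp f k : diag_conj f ^+ k = diag_conj (fun i => f i ^+ k).
Proof.
elim: k => [|k IH]; first by rewrite expr0 -[1]/(1%:M) -diag_conj_scalar.
by rewrite exprS IH -[_ * _]/(_ *m _) diag_conj_mul; apply: diag_conj_ext => i; rewrite exprS.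
Qed.

Lemma eigenvalue_diag_conj f z : eigenvalue (diag_conj f) z -> exists i, z = f i.
Proof.
move=> /eigenvalueP[v vf v0].
have w0 : v *m invmx P != 0.
  apply: contra v0 => /eqP w0; rewrite -[v](mulmxKV Pu) w0 mul0mx//.
have [i wi] : exists i, (v *m invmx P) 0 i != 0.
  apply/existsP; rewrite -negb_forall; apply: contra w0 => /forallP w0.
  by apply/eqP/rowP => i; rewrite [RHS]mxE; apply/eqP.
exists i; apply: (mulIf wi).
have := congr1 (fun u => (u *m invmx P) 0 i) vf.
rewrite /diag_conj -scalemxAl !mulmxA mulmxK// mul_mx_diag !mxE => <-.
by rewrite mulrC.
Qed.

End DiagonalCalculus.

Lemma expm_diag_conj (R : realType) m (P : 'M[R[i]]_m) f : P \in unitmx ->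
  expm (diag_conj P f) = diag_conj P (fun i => cexp (f i)).
Proof.
move=> Pu; apply: (mcvg_unique (expm_cvg (diag_conj P f))).
have -> : mexp_sum (diag_conj P f) = (fun N => diag_conj P (fun i => exp_sum (f i) N)).
  apply/funext => N; rewrite /mexp_sum.
  under eq_bigr do rewrite (diag_conj_exp Pu) diag_conj_scale.
  by rewrite (diag_conj_sum Pu).
apply: mcvg_mulr; apply: mcvg_mull => i j; rewrite mxE.
apply: (ccvg_ext (u := fun N => exp_sum ((\row_i f i) 0 i) N *+ (i == j))).
  by move=> N; rewrite !mxE.
rewrite mxE; case: (i == j); last by rewrite !mulr0n; exact: ccvg_cst.
by rewrite !mulr1n mxE; exact: exp_sum_cvg.
Qed.

Section SpectralNorm.
Context {R : realType} {m : nat}.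
Implicit Types (P : 'M[R[i]]_m) (v : 'cV[R[i]]_m).
Notation normc := ComplexField.Normc.normc.

Lemma normc_ge0 (z : R[i]) : 0 <= normc z. Proof. by case: z => x y; exact: sqrtr_ge0. Qed.

Lemma normc_sqr (z : R[i]) : (normc z ^+ 2)%:C = z * (z^*)%R.
Proof. by rewrite rmorphXn -normCK. Qed.

Lemma vnorm2_ge0 v : 0 <= vnorm2 v. Proof. exact: sqrtr_ge0. Qed.

Lemma vnorm2_sqr v : vnorm2 v ^+ 2 = \sum_i normc (v i 0) ^+ 2.
Proof. by rewrite sqr_sqrtr// sumr_ge0// => i _; exact: sqr_ge0. Qed.

Lemma vnorm2_unitary P v : P \is unitarymx -> vnorm2 (P *m v) = vnorm2 v.
Proof.
move=> uP.
have dot (w : 'cV[R[i]]_m) : (\sum_i normc (w i 0) ^+ 2)%:C = (w^T *m (map_mx Num.conj w)) 0 0.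
  by rewrite rmorph_sum/= mxE; apply: eq_bigr => i _; rewrite normc_sqr !mxE.
rewrite /vnorm2; congr Num.sqrt; apply: (@complexI R); rewrite !dot.
rewrite trmx_mul map_mxM -mulmxA [P^T *m _]mulmxA.
suff -> : P^T *m map_mx Num.conj P = 1%:M by rewrite mul1mx.
have uPT : P^T \is unitarymx by rewrite trmx_unitary.
by have /unitarymxP := uPT; rewrite trmxK.
Qed.

Lemma vnorm2_diag_conj P (f : 'I_m -> R[i]) (c : R) v : P \is unitarymx -> 0 <= c ->
  (forall i, normc (f i) <= c) -> vnorm2 (diag_conj P f *m v) <= c * vnorm2 v.
Proof.
move=> uP c0 fc; rewrite -(vnorm2_unitary v uP) /diag_conj -!mulmxA.
have uP' : invmx P \is unitarymx by rewrite (invmx_unitary uP) trmxC_unitary.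
rewrite (vnorm2_unitary _ uP').
rewrite -ler_sqr ?nnegrE ?mulr_ge0 ?vnorm2_ge0// exprMn !vnorm2_sqr mulr_sumr.
apply: ler_sum => i _; rewrite mul_diag_mx !mxE ComplexField.Normc.normcM exprMn.
by rewrite ler_wpM2r ?sqr_ge0// ler_sqr ?nnegrE ?normc_ge0.
Qed.

Lemma mxnorm2_diag_conj P (f : 'I_m -> R[i]) (c : R) : P \is unitarymx -> 0 <= c ->
  (forall i, normc (f i) <= c) -> 0 <= mxnorm2 (diag_conj P f) <= c.
Proof.
move=> uP c0 fc; rewrite /mxnorm2; set S := [set _ | _ in _].
have ubS : ubound S c.
  by move=> _ [v /= v1 <-]; have := vnorm2_diag_conj v uP c0 fc; rewrite v1 mulr1.
have [->|S0] := eqVneq S set0; first by rewrite sup0 lexx.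
have /set0P[x Sx] := S0.
apply/andP; split; last by apply: ge_sup => //; exists x.
apply: le_trans (ub_le_sup _ Sx); last by exists c.
by case: Sx => v _ <-; exact: vnorm2_ge0.
Qed.

End SpectralNorm.

(** * Convergence to the matrix sign *)

Section ScalarFacts.
Context {R : realType}.
Implicit Types (phi psi Theta x y : R) (z : R[i]).
Notation normc := ComplexField.Normc.normc.

(** The sign is that of the real part, which does not vanish on the arcs. *)
Lemma arcs_half Theta z : 0 < Theta < pi / 2 -> arcs Theta z ->
  exists b : bool, exists2 phi, `|phi| <= Theta & z = (-1) ^+ b * cis phi.
Proof.
move=> hT [z1 h1 h2]; have /unit_normE xy := z1.
have pi0 := @pi_gt0 R.
have xb := unit_Re_bound z1.
have a0 : 0 <= acos (complex.Re z) by apply: acos_ge0.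
have a1 : acos (complex.Re z) <= pi by apply: acos_lepi.
have cE : cos (acos (complex.Re z)) = complex.Re z by rewrite acosK// in_itv.
have ht : acos (complex.Re z) <= Theta \/ pi - Theta <= acos (complex.Re z).
  move: h1 h2; rewrite /argc unit_normc// divr1; move: (acos _) a0 a1 => t t0 t1.
  case: ifP => _ h1 h2.
    case: (leP t Theta) => ht; [by left|right].
    by rewrite leNgt; apply/negP => ht'; apply: h1; rewrite ht ht'.
  case: (leP t Theta) => ht; [by left|right].
  rewrite leNgt; apply/negP => ht'; apply: h2; apply/andP; split; lra.
have c0 : 0 < cos Theta by apply: cos_gt0_pihalf; lra.
have mono (s t : R) : 0 <= s -> s <= t -> t <= pi -> cos t <= cos s.
  move=> s0 st t1; have h : cos t < cos s \/ s = t; last by case: h => [/ltW|->].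
  move: st; rewrite le_eqVlt => /predU1P[->|st]; [by right|left].
  by rewrite ltr_cos// in_itv/=; lra.
have x2 : cos Theta ^+ 2 <= complex.Re z ^+ 2.
  case: ht => ht.
    have Tpi : Theta <= pi by lra.
    have := mono _ _ a0 ht Tpi; rewrite cE => h; nra.
  have T0 : 0 <= pi - Theta by lra.
  have := mono _ _ T0 ht a1; rewrite cE => h.
  have e : cos (pi - Theta) = - cos Theta by rewrite cosB cospi sinpi; ring.
  rewrite e in h; nra.
have y2 : complex.Im z ^+ 2 <= sin Theta ^+ 2.
  by have := cos2Dsin2 Theta; lra.
have x0 : complex.Re z != 0.
  by apply/eqP => x0; move: x2; rewrite x0 expr0n/=; have := exprn_gt0 2 c0; lra.
case: (ltP 0 (complex.Re z)) => hx.
  have [phi hphi zE] := cis_of_half z1 hx hT y2.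
  by exists false, phi => //; rewrite expr0 mul1r.
have zN1 : `|- z| = 1 by rewrite normrN.
have ReN : complex.Re (- z) = - complex.Re z by case: (z).
have ImN : complex.Im (- z) = - complex.Im z by case: (z).
have [||phi hphi zE] := cis_of_half zN1 _ hT _.
- by rewrite ReN oppr_gt0 lt_neqAle x0.
- by rewrite ImN sqrrN.
- by exists true, phi => //; rewrite expr1 mulN1r -zE opprK.
Qed.

Lemma abs_sin_le x : `|sin x| <= `|x|.
Proof.
have pos y : 0 <= y -> `|sin y| <= y.
  rewrite le_eqVlt => /predU1P[<-|y0]; first by rewrite sin0 normr0.
  have [|c _] := @MVT R sin cos 0 y y0 (fun t _ => is_derive_sin t).
    by apply: continuous_subspaceT => t; exact: continuous_sin.
  rewrite sin0 !subr0 => ->; rewrite normrM (gtr0_norm y0).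
  by rewrite ler_piMl ?(ltW y0)// cos_max.
case: (leP 0 x) => x0; first by rewrite (ger0_norm x0) pos.
by rewrite -normrN -sinN (ltr0_norm x0) pos// oppr_ge0 ltW.
Qed.

Lemma cis_dist phi : normc (cis phi - 1) <= `|phi|.
Proof.
have -> : cis phi - 1 = (cos phi - 1) +i* sin phi.
  by rewrite /cis; simpc.
rewrite /= -[`|phi|]ger0_norm// -sqrtr_sqr ler_wsqrtr//.
have hE : phi = (phi / 2) *+ 2 by rewrite -mulr_natr; field.
have := abs_sin_le (phi / 2); rewrite -ler_sqr ?nnegrE// !real_normK ?num_real// => h.
have cE : cos phi = 1 - 2 * sin (phi / 2) ^+ 2.
  by rewrite {1}hE cos_mulr2n cos2sin2; ring.
have := cos2Dsin2 phi; move: h cE; rewrite expr_div_n => h cE cs.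
have -> : (cos phi - 1) ^+ 2 + sin phi ^+ 2 = 2 - 2 * cos phi.
  by rewrite (_ : sin phi ^+ 2 = 1 - cos phi ^+ 2); [ring|lra].
lra.
Qed.

Lemma zolo_r_sign n Theta (b : bool) z :
  zolo_r n ((-1) ^+ b * z) Theta = (-1) ^+ b * zolo_r n z Theta.
Proof. by case: b; rewrite ?expr0 ?mul1r// expr1 !mulN1r zolo_rN. Qed.

Lemma zolo_rho_gt1 Theta : 0 < Theta < pi / 2 -> 1 < zolo_rho Theta.
Proof.
move=> hT; rewrite /zolo_rho -expR0 ltr_expR.
have hl := angle_modulus hT; have K1 := ellipticK_gt0 hl.
have c0 := cos_angle_gt0 hT.
have c1 : cos Theta < 1.
  have := cos2Dsin2 Theta; have := exprn_gt0 2 (sin_angle_gt0 hT) => s0 cs.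
  by rewrite -(@expr_lt1 _ 2)// ?ltW//; lra.
have K2 : 0 < ellipticK (cos Theta) by apply: ellipticK_gt0; rewrite c1 ltW.
by rewrite divr_gt0 ?mulr_gt0// pi_gt0.
Qed.

Lemma cexp_i phi : cexp (0 +i* phi) = cis phi.
Proof. by rewrite /cexp /= expR0 !mul1r. Qed.

Lemma cis_inj phi psi : - pi < phi < pi -> - (pi / 2) < psi < pi / 2 ->
  cis phi = cis psi -> phi = psi.
Proof.
move=> h1 h2 [ec es].
have e : cis phi = cis psi by rewrite /cis ec es.
have pi0 := @pi_gt0 R.
have c0 : 0 < cos phi by rewrite ec; exact: cos_gt0_pihalf.
have h3 : - (pi / 2) <= phi <= pi / 2.
  apply/andP; split; rewrite leNgt; apply/negP => h.
    have : 0 <= cos (pi + phi) by apply: cos_ge0_pihalf; lra.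
    have -> : cos (pi + phi) = - cos phi by rewrite cosD cospi sinpi; ring.
    lra.
  have : 0 <= cos (pi - phi) by apply: cos_ge0_pihalf; lra.
  have -> : cos (pi - phi) = - cos phi by rewrite cosB cospi sinpi; ring.
  lra.
by apply: sin_inj => //; rewrite in_itv/=; lra.
Qed.

End ScalarFacts.

Section MatrixFunctions.
Context {R : realType} {m : nat} (P : 'M[R[i]]_m).
Hypothesis Pu : P \in unitmx.
Implicit Types (phi : 'I_m -> R) (x : 'I_m -> R[i]).

Lemma zolo_den_diag_conj n Theta x j : 0 < Theta < pi / 2 -> (1 <= j <= n)%N ->
  (forall i, `|x i| = 1) ->
  zolo_den n (diag_conj P x) Theta j = diag_conj P (fun i => 1 + (zolo_a n Theta j)%:C * x i ^+ 2) /\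
  zolo_den n (diag_conj P x) Theta j \in unitmx.
Proof.
move=> hT hj x1.
have e : zolo_den n (diag_conj P x) Theta j = diag_conj P (fun i => 1 + (zolo_a n Theta j)%:C * x i ^+ 2).
  by rewrite /zolo_den (diag_conj_mul Pu) diag_conj_scale -(diag_conj_scalar Pu) diag_conj_add.
split => //; rewrite e; have [a0 a1 _] := zolo_aP hT hj.
by have [] := @diag_conj_inv _ _ _ Pu (fun i => 1 + (zolo_a n Theta j)%:C * x i ^+ 2)
  (fun i => (blaschke_dom a0 a1 (x1 i)).2).
Qed.

Lemma zolo_rmx_diag_conj n Theta x : 0 < Theta < pi / 2 -> (forall i, `|x i| = 1) ->
  zolo_rmx n (diag_conj P x) Theta = diag_conj P (fun i => zolo_r n (x i) Theta).
Proof.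
move=> hT x1; rewrite /zolo_rmx.
rewrite (eq_big_nat _ _ (F2 := fun j => diag_conj P (fun i => blaschke (zolo_a n Theta j) (x i)))).
  by rewrite (diag_conj_prod Pu) (diag_conj_mul Pu).
move=> j hj; have hj' : (1 <= j <= n)%N by lia.
have [-> _] := zolo_den_diag_conj hT hj' x1.
have [a0 a1 _] := zolo_aP hT hj'.
have [_ ->] := @diag_conj_inv _ _ _ Pu (fun i => 1 + (zolo_a n Theta j)%:C * x i ^+ 2)
  (fun i => (blaschke_dom a0 a1 (x1 i)).2).
by rewrite (diag_conj_mul Pu) -(diag_conj_scalar Pu) diag_conj_add (diag_conj_mul Pu).
Qed.

(** The sign of a square root of [e^(2 i phi)] is fixed by the positive real part. *)
Lemma sqrtm_diag_conj phi : (forall i, - (pi / 2) < phi i < pi / 2) ->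
  sqrtm (diag_conj P (fun i => cis (phi i) ^+ 2)) = diag_conj P (fun i => cis (phi i)).
Proof.
move=> hphi; rewrite /sqrtm; case: xgetP => [S _ [SS Spos]|h]; last first.
  exfalso; apply: (h (diag_conj P (fun i => cis (phi i)))); split.
    exact: diag_conj_mul.
  by move=> z /(eigenvalue_diag_conj Pu)[i ->] /=; exact: cos_gt0_pihalf.
apply: (@mx_eq_of_eigen _ _ P S (\row_i cis (phi i) ^+ 2) (\row_i cis (phi i)) Pu) => mu mu_eig.
have mu0 := Spos _ mu_eig.
exists (mu ^+ 2), (2 * mu); split.
- by rewrite mulf_neq0 ?pnatr_eq0//; apply: contraTneq mu0 => ->; rewrite ltxx.
- move=> v w vS wS; rewrite -[_ *m _ *m P]/(diag_conj P _) -SS mulmxA vS mulmxDl -scalemxAl vS wS.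
  rewrite scalerDr scalerA -addrA -scalerDl; congr (_ + _ *: _); ring.
- move=> i; rewrite !mxE => /eqP; rewrite eqf_sqr => /orP[/eqP//|/eqP e].
  have := cos_gt0_pihalf (hphi i); have -> : cos (phi i) = complex.Re (cis (phi i)) by [].
  have ReN : complex.Re (- mu) = - complex.Re mu by case: (mu).
  by rewrite e ReN oppr_gt0 => /(lt_trans mu0); rewrite ltxx.
Qed.

(** In the strip [|Im| < pi] the exponential takes a value of modulus [1] at most once,
    at a purely imaginary point. *)
Lemma logm_diag_conj phi : (forall i, - (pi / 2) < phi i < pi / 2) ->
  is_principal_log (diag_conj P (fun i => cis (phi i))) (diag_conj P (fun i => 0 +i* phi i)) /\
  logm (diag_conj P (fun i => cis (phi i))) = diag_conj P (fun i => 0 +i* phi i).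
Proof.
move=> hphi; have pi0 := @pi_gt0 R.
have pl : is_principal_log (diag_conj P (fun i => cis (phi i))) (diag_conj P (fun i => 0 +i* phi i)).
  split; first by rewrite (expm_diag_conj _ Pu); apply: diag_conj_ext => i; exact: cexp_i.
  by move=> z /(eigenvalue_diag_conj Pu)[i ->] /=; have := hphi i; lra.
split => //; rewrite /logm; case: xgetP => [L _ [LB Lstrip]|h]; last by have := h _ pl.
apply: (@mx_eq_of_eigen _ _ P L (\row_i cis (phi i)) (\row_i (0 +i* phi i)) Pu) => mu mu_eig.
have mu_b := Lstrip _ mu_eig.
have e0 : cexp mu = (expR (complex.Re mu))%:C * cis (complex.Im mu).
  by rewrite /cexp /cis; simpc.
exists (cexp mu), (cexp mu); split.
- rewrite e0 mulf_neq0//; first by rewrite fmorph_eq0 gt_eqF// expR_gt0.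
  by rewrite -normr_eq0 cis_norm oner_eq0.
- by move=> v w vL wL; rewrite -[_ *m _ *m P]/(diag_conj P _) -LB; exact: eigen_expm.
- move=> i; rewrite !mxE => ce.
  have := cis_norm (phi i); rewrite ce e0 normrM cis_norm mulr1 => n1.
  have E1 : expR (complex.Re mu) = 1.
    by move: n1; rewrite normc_def/= expr0n/= addr0 sqrtr_sqr gtr0_norm ?expR_gt0// => -[].
  have R0 : complex.Re mu = 0 by apply: expR_inj; rewrite E1 expR0.
  rewrite e0 E1 mul1r in ce.
  have := cis_inj mu_b (hphi i) (esym ce).
  by case: (mu) R0 => a b /= -> ->.
Qed.

End MatrixFunctions.

Section UnitarySpectrum.
Context {R : realType} {m : nat}.

Lemma unitary_diag_conj (A : 'M[R[i]]_m) : A \is unitarymx ->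
  exists2 P, P \is unitarymx & exists d, A = diag_conj P d /\ forall i, eigenvalue A (d i).
Proof.
move=> uA; have nA : A \is normalmx.
  apply/normalmxP; rewrite (unitarymxP uA).
  by rewrite -invmx_unitary// mulVmx// unitarymx_unit.
have uP := spectral_unitarymx A; exists (spectralmx A) => //.
have AE := elimT (@orthomx_spectralP _ _ A) nA.
set P := spectralmx A in uP AE *; set d := spectral_diag A in AE.
have Pu : P \in unitmx := unitarymx_unit uP.
exists (fun i => d 0 i); split.
  by rewrite -diag_conj_row.
move=> i; apply/eigenvalueP; exists (row i P).
  by rewrite AE !mulmxA -row_mul mulmxV// row1 -rowE row_diag_mx -scalemxAl -rowE.
exact: row_unitmx_neq0.
Qed.

End UnitarySpectrum.

Theorem theorem3p2 (R : realType) (m : nat) (Theta : R) (A : 'M[R[i]]_m)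
    (hTheta : 0 < Theta < pi / 2)
    (hA : A \is unitarymx)
    (hspec : forall z : R[i], eigenvalue A z -> arcs Theta z)
    (n : nat) (hn : (0 < n)%N)
    (X : nat -> 'M[R[i]]_m) (T : nat -> R)
    (hX0 : X 0%N = A) (hT0 : T 0%N = Theta)
    (hX : forall k, X k.+1 = zolo_rmx n (X k) (T k))
    (hT : forall k, T k.+1 = `|argc (zolo_r n (cos (T k) +i* sin (T k)) (T k))|) :
  [/\ (* the iteration is well defined *)
      forall k, 0 < T k < pi / 2,
      forall k j, (1 <= j <= n)%N -> zolo_den n (X k) (T k) j \in unitmx,
      (* it converges to sign(A) *)
      (fun k => mxnorm2 (X k - signm A)) @ \oo --> (0 : R),
      (* with order 2n+1 *)
      1 < zolo_rho Theta &
      forall k, is_principal_log (X k *m invmx (signm A))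
                  (logm (X k *m invmx (signm A))) /\
                mxnorm2 (logm (X k *m invmx (signm A)))
                  <= 4 * zolo_rho Theta ^- ((2 * n + 1) ^ k)%N].
Proof.
have [P uP [d [AE deig]]] := unitary_diag_conj hA.
have Pu := unitarymx_unit uP.
have /fin_all_exists[b /fin_all_exists[phi0 phi0P]] (i : 'I_m) :
    exists b : bool, exists phi, `|phi| <= Theta /\ d i = (-1) ^+ b * cis phi.
  have [b [phi h1 h2]] := arcs_half hTheta (hspec _ (deig i)).
  by exists b, phi.
pose eps i : R[i] := (-1) ^+ b i.
have eps2 i : eps i * eps i = 1 by rewrite /eps; case: (b i); rewrite ?expr0 ?expr1 ?mulr1// mulrNN mulr1.
have eps0 i : eps i != 0 by rewrite signr_eq0.
have eps_norm i : `|eps i| = 1 by rewrite normr_sign.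
have T_next k : T k.+1 = `|argc (zolo_r n (cis (T k)) (T k))| by rewrite hT.
have T_half k : 0 < T k < pi / 2.
  by elim: k => [|k IH]; [rewrite hT0|rewrite T_next next_bound].
(* The exponents [N ^ k] come from iterating [rho |-> rho ^ N]. *)
have rhoT k : zolo_rho (T k) = zolo_rho Theta ^+ ((2 * n + 1) ^ k).
  elim: k => [|k IH]; first by rewrite hT0 expn0 expr1.
  by rewrite T_next zolo_rho_next// IH -exprM -expnSr.
(* The signs of the eigenvalues never change, and the angles stay within [T k]. *)
have Xk k : exists phi : 'I_m -> R, (forall i, `|phi i| <= T k) /\
    X k = diag_conj P (fun i => eps i * cis (phi i)).
  elim: k => [|k [phi [hphi XE]]].
    exists phi0; rewrite hX0 hT0; split=> [i|]; first by have [] := phi0P i.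
    by rewrite AE; apply: diag_conj_ext => i; have [] := phi0P i.
  have /fin_all_exists[psi hpsi] (i : 'I_m) : exists psi,
      `|psi| <= T k.+1 /\ zolo_r n (cis (phi i)) (T k) = cis psi.
    have [psi h1 h2] := zolo_r_arc n (T_half k) (hphi i).
    by exists psi; rewrite T_next.
  exists psi; split=> [i|]; first by have [] := hpsi i.
  have x1 i : `|eps i * cis (phi i)| = 1 by rewrite normrM eps_norm cis_norm mulr1.
  rewrite hX XE (zolo_rmx_diag_conj Pu n (T_half k) x1).
  by apply: diag_conj_ext => i; rewrite zolo_r_sign; have [_ ->] := hpsi i.
have rho1 := zolo_rho_gt1 hTheta.
have T_le k : T k <= 4 * zolo_rho Theta ^- ((2 * n + 1) ^ k)%N.
  by rewrite -rhoT; exact: angle_le_rho.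
have phi_half k (phi : R) : `|phi| <= T k -> - (pi / 2) < phi < pi / 2.
  by have := T_half k; rewrite ler_norml; lra.
have cis0 (phi : R) : cis phi != 0 by rewrite -normr_eq0 cis_norm oner_eq0.
have signE : signm A = diag_conj P eps.
  have AE0 : A = diag_conj P (fun i => eps i * cis (phi0 i)).
    by rewrite AE; apply: diag_conj_ext => i; have [] := phi0P i.
  have phi0h i : - (pi / 2) < phi0 i < pi / 2.
    by apply: (phi_half 0%N); rewrite hT0; have [] := phi0P i.
  have A2 : A *m A = diag_conj P (fun i => cis (phi0 i) ^+ 2).
    rewrite AE0 (diag_conj_mul Pu); apply: diag_conj_ext => i.
    by rewrite mulrACA eps2 mul1r.
  rewrite /signm A2 (sqrtm_diag_conj Pu phi0h) (diag_conj_inv Pu (fun i => cis0 (phi0 i))).2.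
  rewrite AE0 (diag_conj_mul Pu); apply: diag_conj_ext => i.
  by rewrite (mulfK (cis0 _)).
have quotE (phi : 'I_m -> R) :
    diag_conj P (fun i => eps i * cis (phi i)) *m invmx (signm A) = diag_conj P (fun i => cis (phi i)).
  rewrite signE (diag_conj_inv Pu eps0).2 (diag_conj_mul Pu); apply: diag_conj_ext => i.
  by rewrite mulrAC (divff (eps0 i)) mul1r.
split; first exact: T_half.
- move=> k j hj; have [phi [hphi ->]] := Xk k.
  have x1 i : `|eps i * cis (phi i)| = 1 by rewrite normrM eps_norm cis_norm mulr1.
  exact: (zolo_den_diag_conj Pu (T_half k) hj x1).2.
- have rho0 : 0 < (zolo_rho Theta)^-1 < 1.
    have r0 : 0 < zolo_rho Theta by apply: lt_trans rho1.
    by rewrite invr_gt0 r0 invf_lt1.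
  apply: (@squeeze_cvgr _ _ _ _ (fun=> 0) (fun k => 4 * (zolo_rho Theta)^-1 ^+ k)).
  + near=> k; have [phi [hphi ->]] := Xk k.
    have T0 : 0 <= T k by have := T_half k; lra.
    have bound : T k <= 4 * (zolo_rho Theta)^-1 ^+ k.
      apply: le_trans (T_le k) _; rewrite -exprVn ler_wpM2l//.
      apply: ler_wiXn2l; [lra|lra|].
      by apply: ltnW; apply: ltn_expl; clear -hn; lia.
    rewrite signE; have -> : diag_conj P (fun i => eps i * cis (phi i)) - diag_conj P eps =
        diag_conj P (fun i => eps i * (cis (phi i) - 1)).
      rewrite -[- diag_conj P eps]scaleN1r diag_conj_scale diag_conj_add; apply: diag_conj_ext => i; ring.
    have nle i : ComplexField.Normc.normc (eps i * (cis (phi i) - 1)) <= T k.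
      rewrite ComplexField.Normc.normcM (unit_normc (eps_norm i)) mul1r.
      exact: le_trans (cis_dist _) (hphi i).
    have /andP[-> h] := mxnorm2_diag_conj uP T0 nle.
    exact: le_trans h bound.
  + exact: cvg_cst.
  + rewrite -[X in _ --> X](mulr0 4); apply: cvgM; first exact: cvg_cst.
    by apply: cvg_expr; rewrite ger0_norm; lra.
- exact: rho1.
- move=> k; have [phi [hphi ->]] := Xk k; rewrite quotE.
  have [pl ->] := logm_diag_conj Pu (fun i => phi_half k (phi i) (hphi i)).
  split; first exact: pl.
  apply: le_trans (T_le k).
  have T0 : 0 <= T k by have := T_half k; lra.
  have nle i : ComplexField.Normc.normc (0 +i* phi i) <= T k.
    by rewrite /= expr0n/= add0r sqrtr_sqr.
  by have /andP[] := mxnorm2_diag_conj uP T0 nle.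
Unshelve. all: by end_near. Qed.
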